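(* Let $\underline M$ be a pure Anderson motive over a field $L\supset\mathbb F_q$ and $E=\mathrm{End}(\underline M)\otimes_AQ$. Every maximal order in $E$ occurs as the endomorphism ring $f\cdot\mathrm{End}(\underline M')\cdot f^{-1}\subset E$ of a pure Anderson motive $\underline M'$ isogenous to $\underline M$ via an isogeny $f:\underline M'\to\underline M$.
   Context: Setting. $C$ is a smooth projective geometrically irreducible curve over the finite field $\mathbb F_q$, $\infty\in C(\mathbb F_q)$ a fixed point, $A=\Gamma(C\setminus\{\infty\},\mathcal O_C)$, $Q=\mathrm{Quot}(A)$. For a field $L\supset\mathbb F_q$: $C_L=C\times_{\mathbb F_q}L$, $A_L=A\otimes_{\mathbb F_q}L$, $\sigma^*$ the endomorphism $a\otimes b\mapsto a\otimes b^q$ of $A_L$ (also the corresponding pullback on $C_L$), $\sigma^*M=M\otimes_{A_L,\sigma^*}A_L$. Pure Anderson motives. Fix an $\mathbb F_q$-homomorphism $c^*:A\to L$ and let $J=(a\otimes1-1\otimes c^*(a):a\in A)\subset A_L$. A pure Anderson motive $\underline M=(M,\tau)$ of rank $r$, dimension $d$ and characteristic $c^*$ over $L$ is a locally free $A_L$-module $M$ of rank $r$ with an injective $A_L$-homomorphism $\tau:\sigma^*M\to M$ such that $\mathrm{coker}\,\tau$ has $L$-dimension $d$ and is annihilated by $J^d$, and $M$ extends to a locally free sheaf $\mathcal M$ of rank $r$ on $C_L$ such that for some integers $k,l>0$ the map $\tau^l=\tau\circ\sigma^*\tau\circ\cdots\circ(\sigma^* )^{l-1}\tau$ induces an isomorphism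 of stalks $(\sigma^* )^l\mathcal M_\infty\to\mathcal M(k\cdot\infty)_\infty$. Morphisms (same $c^*$) are $A_L$-homomorphisms $f:M\to M'$ with $f\circ\tau=\tau'\circ\sigma^*f$; an isogeny is an injective morphism with torsion cokernel; isogenies become invertible in $\mathrm{Hom}(\cdot,\cdot)\otimes_AQ$. $\mathrm{End}(\underline M)$ is a finitely generated projective $A$-module. ''Order'' means $A$-order in the finite-dimensional $Q$-algebra $E$. *)

(* Defs.v *)
From HB Require Import structures.
From mathcomp Require Import all_boot all_order all_algebra all_field.
From mathcomp Require Import boolp classical_sets.

Set Implicit Arguments.
Unset Strict Implicit.
Unset Printing Implicit Defensive.

Import GRing.Theory.
Local Open Scope ring_scope.
Local Open Scope quotient_scope.

Section Tensor.
Variables (R : Type) (M N : zmodType) (actM : R -> M -> M) (actN : R -> N -> N).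

Record balanced (P : zmodType) (b : M -> N -> P) : Prop := Balanced {
  balDl : forall m m' n, b (m + m') n = b m n + b m' n;
  balDr : forall m n n', b m (n + n') = b m n + b m n';
  balS : forall r m n, b (actM r m) n = b m (actN r n) }.

Definition formal_eval (P : zmodType) (b : M -> N -> P) (s : seq (M * N)) : P :=
  \sum_(p <- s) b p.1 p.2.

(* A list of pairs stands for the sum of the corresponding pure tensors; two
   lists give the same tensor iff all balanced maps take the same value on them,
   so the quotient has the universal property of the tensor product. *)
Definition tens_eq : rel (seq (M * N)) := fun s t =>
  `[< forall (P : zmodType) (b : M -> N -> P),
        balanced b -> formal_eval b s = formal_eval b t >].

Lemma tens_eq_equiv : equiv_class_of tens_eq.
Proof.
split.
- by move=> s; apply/asboolP.
- by move=> s t; apply/asboolP/asboolP => H P b /H.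
- move=> s t u /asboolP H1 /asboolP H2; apply/asboolP => P b hb.
  by rewrite (H1 _ _ hb) (H2 _ _ hb).
Qed.

Canonical tens_equiv := EquivRelPack tens_eq_equiv.

Definition tensor := {eq_quot tens_equiv}.

HB.instance Definition _ := Choice.on tensor.
HB.instance Definition _ := EqQuotient.on tensor.

Definition pure (m : M) (n : N) : tensor := \pi_tensor [:: (m, n)].

Definition tens_lift (P : zmodType) (b : M -> N -> P) (x : tensor) : P :=
  formal_eval b (repr x).

Lemma tens_eqP s t : (\pi_tensor s = \pi_tensor t) <->
  forall (P : zmodType) (b : M -> N -> P),
    balanced b -> formal_eval b s = formal_eval b t.
Proof.
split=> [/eqmodP/asboolP //|H].
by apply/eqmodP/asboolP.
Qed.

Lemma tens_lift_pi (P : zmodType) (b : M -> N -> P) s :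
  balanced b -> tens_lift b (\pi_tensor s) = formal_eval b s.
Proof.
by move=> hb; apply: (proj1 (tens_eqP _ _) _ _ _ hb); rewrite reprK.
Qed.

Lemma balanced0l (P : zmodType) (b : M -> N -> P) n : balanced b -> b 0 n = 0.
Proof. by move=> hb; apply: (addrI (b 0 n)); rewrite -(balDl hb) !addr0. Qed.

Lemma balanced0r (P : zmodType) (b : M -> N -> P) m : balanced b -> b m 0 = 0.
Proof. by move=> hb; apply: (addrI (b m 0)); rewrite -(balDr hb) !addr0. Qed.

Lemma balancedNl (P : zmodType) (b : M -> N -> P) m n :
  balanced b -> b (- m) n = - b m n.
Proof.
by move=> hb; apply: (addrI (b m n)); rewrite -(balDl hb) !subrr balanced0l.
Qed.

Definition tens_add (x y : tensor) : tensor := \pi_tensor (repr x ++ repr y).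
Definition tens_opp (x : tensor) : tensor :=
  \pi_tensor [seq (- p.1, p.2) | p <- repr x].

Lemma eval_cat (P : zmodType) (b : M -> N -> P) s t :
  formal_eval b (s ++ t) = formal_eval b s + formal_eval b t.
Proof. by rewrite /formal_eval big_cat. Qed.

Lemma eval_add (P : zmodType) (b : M -> N -> P) x y : balanced b ->
  formal_eval b (repr (tens_add x y)) =
  formal_eval b (repr x) + formal_eval b (repr y).
Proof. by move=> hb; rewrite -[LHS]/(tens_lift b _) tens_lift_pi // eval_cat. Qed.

Lemma tensor_ext (x y : tensor) :
  (forall (P : zmodType) (b : M -> N -> P),
     balanced b -> tens_lift b x = tens_lift b y) -> x = y.
Proof. by move=> H; rewrite -(reprK x) -(reprK y); apply/tens_eqP. Qed.

Lemma tens_addA : associative tens_add.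
Proof.
by move=> x y z; apply: tensor_ext => P b hb; rewrite /tens_lift !eval_add // addrA.
Qed.

Lemma tens_addC : commutative tens_add.
Proof.
by move=> x y; apply: tensor_ext => P b hb; rewrite /tens_lift !eval_add // addrC.
Qed.

Lemma tens_add0 : left_id (\pi_tensor [::]) tens_add.
Proof.
move=> x; apply: tensor_ext => P b hb; rewrite /tens_lift eval_add //.
by rewrite -[X in X + _]/(tens_lift b _) tens_lift_pi // /formal_eval big_nil add0r.
Qed.

Lemma tens_addN : left_inverse (\pi_tensor [::]) tens_opp tens_add.
Proof.
move=> x; apply: tensor_ext => P b hb; rewrite /tens_lift eval_add //.
rewrite -[X in X + _]/(tens_lift b _) -[RHS]/(tens_lift b _) !tens_lift_pi //.
rewrite /formal_eval big_nil big_map -big_split /= big1 // => p _.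
by rewrite balancedNl // addNr.
Qed.

HB.instance Definition _ := GRing.isZmodule.Build tensor
  tens_addA tens_addC tens_add0 tens_addN.

Lemma tens_liftD (P : zmodType) (b : M -> N -> P) x y : balanced b ->
  tens_lift b (x + y) = tens_lift b x + tens_lift b y.
Proof. exact: eval_add. Qed.

Lemma tens_lift_pure (P : zmodType) (b : M -> N -> P) m n : balanced b ->
  tens_lift b (pure m n) = b m n.
Proof. by move=> hb; rewrite tens_lift_pi // /formal_eval big_seq1. Qed.

Lemma balanced_pure : balanced pure.
Proof.
split=> *; apply: tensor_ext => P b hb; rewrite ?tens_liftD ?tens_lift_pure //.
- exact: balDl.
- exact: balDr.
- exact: balS.
Qed.

Lemma pi_nil : \pi_tensor [::] = 0 :> tensor. Proof. by []. Qed.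

Lemma pi_cons p s : \pi_tensor (p :: s) = pure p.1 p.2 + \pi_tensor s.
Proof.
apply: tensor_ext => P b hb; rewrite tens_liftD // tens_lift_pure //.
by rewrite !tens_lift_pi // /formal_eval big_cons.
Qed.

Lemma tens_ind (Q : tensor -> Prop) :
  Q 0 -> (forall x y, Q x -> Q y -> Q (x + y)) ->
  (forall m n, Q (pure m n)) -> forall x, Q x.
Proof.
move=> Q0 QD Qp x; rewrite -(reprK x); elim: (repr x) => [|p s IH] //.
by rewrite pi_cons; apply: QD.
Qed.

Lemma tens_lift0 (P : zmodType) (b : M -> N -> P) :
  balanced b -> tens_lift b 0 = 0.
Proof. by move=> hb; rewrite -pi_nil tens_lift_pi // /formal_eval big_nil. Qed.

Lemma tens_liftB (P : zmodType) (b : M -> N -> P) x y : balanced b ->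
  tens_lift b (x - y) = tens_lift b x - tens_lift b y.
Proof.
move=> hb; apply: (addIr (tens_lift b y)).
by rewrite -tens_liftD // !subrK.
Qed.

Lemma balanced_comp (P P' : zmodType) (b : M -> N -> P) (g : P -> P') :
  balanced b -> {morph g : x y / x + y} -> balanced (fun m n => g (b m n)).
Proof.
move=> hb hg; split=> *; first by rewrite (balDl hb) hg.
  by rewrite (balDr hb) hg.
by rewrite (balS hb).
Qed.

Lemma eq_tens_lift (P : zmodType) (b b' : M -> N -> P) x :
  (forall m n, b m n = b' m n) -> tens_lift b x = tens_lift b' x.
Proof. by move=> H; apply: eq_bigr => p _. Qed.

Lemma tens_lift_add2 (P : zmodType) (b b' : M -> N -> P) x :
  tens_lift (fun m n => b m n + b' m n) x = tens_lift b x + tens_lift b' x.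
Proof. exact: big_split. Qed.

End Tensor.

(* M (x)_{R, phi} S as an S-module. *)
Section BaseChange.
Variables (R : pzRingType) (S : comPzRingType) (phi : {rmorphism R -> S}).

Definition base_change (M : lmodType R) :=
  tensor (fun (r : R) (m : M) => r *: m) (fun (r : R) (s : S) => phi r * s).

HB.instance Definition _ (M : lmodType R) := GRing.Zmodule.on (base_change M).

Definition bc_pure (M : lmodType R) (m : M) (s : S) : base_change M :=
  @pure R M S _ _ m s.

Section Module.
Variable M : lmodType R.

Definition bc_scale (s : S) (x : base_change M) : base_change M :=
  tens_lift (fun m t => bc_pure m (s * t)) x.

Lemma bc_scale_bal s : balanced (fun (r : R) (m : M) => r *: m)
  (fun (r : R) (t : S) => phi r * t) (fun m t => bc_pure m (s * t)).
Proof.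
split=> *; first by rewrite /bc_pure (balDl (balanced_pure _ _)).
  by rewrite mulrDr /bc_pure (balDr (balanced_pure _ _)).
by rewrite /bc_pure (balS (balanced_pure _ _)) mulrCA.
Qed.

Lemma bc_scaleD s : {morph bc_scale s : x y / x + y}.
Proof. by move=> x y; apply: tens_liftD; apply: bc_scale_bal. Qed.

Lemma bc_scale_pure s m t : bc_scale s (bc_pure m t) = bc_pure m (s * t).
Proof. by apply: (tens_lift_pure _ _ (bc_scale_bal s)). Qed.

Lemma bc_scale0 s : bc_scale s 0 = 0.
Proof. by apply: (addrI (bc_scale s 0)); rewrite -bc_scaleD !addr0. Qed.

Lemma bc_scaleA a b x : bc_scale a (bc_scale b x) = bc_scale (a * b) x.
Proof.
move: x; apply: tens_ind => [|x y hx hy|m t]; first by rewrite !bc_scale0.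
  by rewrite !bc_scaleD hx hy.
by rewrite !bc_scale_pure mulrA.
Qed.

Lemma bc_scale1 : left_id 1 bc_scale.
Proof.
apply: tens_ind => [|x y hx hy|m t]; first by rewrite !bc_scale0.
  by rewrite !bc_scaleD hx hy.
by rewrite !bc_scale_pure mul1r.
Qed.

Lemma bc_scaleDl x : {morph bc_scale^~ x : a b / a + b}.
Proof.
move=> a b; move: x; apply: tens_ind => [|x y hx hy|m t].
- by rewrite !bc_scale0 addr0.
- by rewrite !bc_scaleD hx hy addrACA.
- by rewrite !bc_scale_pure mulrDl /bc_pure (balDr (balanced_pure _ _)).
Qed.

HB.instance Definition _ := GRing.Zmodule_isLmodule.Build S (base_change M)
  bc_scaleA bc_scale1 bc_scaleD bc_scaleDl.

End Module.

Lemma bc_ind (M : lmodType R) (Q : base_change M -> Prop) :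
  Q 0 -> (forall x y, Q x -> Q y -> Q (x + y)) ->
  (forall m s, Q (bc_pure m s)) -> forall x, Q x.
Proof. exact: tens_ind. Qed.

Lemma bc_pureDl (M : lmodType R) (m m' : M) s :
  bc_pure (m + m') s = bc_pure m s + bc_pure m' s.
Proof. exact: (balDl (balanced_pure _ _)). Qed.

Lemma bc_pureDr (M : lmodType R) (m : M) s s' :
  bc_pure m (s + s') = bc_pure m s + bc_pure m s'.
Proof. exact: (balDr (balanced_pure _ _)). Qed.

Lemma bc_pureS (M : lmodType R) r (m : M) s :
  bc_pure (r *: m) s = bc_pure m (phi r * s).
Proof. exact: (balS (balanced_pure _ _)). Qed.

Lemma bc_pureZ (M : lmodType R) (m : M) s t :
  t *: bc_pure m s = bc_pure m (t * s).
Proof. exact: bc_scale_pure. Qed.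

Definition bc_map (M M' : lmodType R) (f : M -> M') (x : base_change M) :
  base_change M' := tens_lift (fun m s => bc_pure (f m) s) x.

Section Map.
Variables (M M' : lmodType R) (f : {linear M -> M'}).

Lemma bc_map_bal : balanced (fun (r : R) (m : M) => r *: m)
  (fun (r : R) (t : S) => phi r * t) (fun m s => bc_pure (f m) s).
Proof.
split=> *; first by rewrite raddfD bc_pureDl.
  by rewrite bc_pureDr.
by rewrite linearZ bc_pureS.
Qed.

Lemma bc_map_pure m s : bc_map f (bc_pure m s) = bc_pure (f m) s.
Proof. exact: (tens_lift_pure _ _ bc_map_bal). Qed.

Lemma bc_mapD : {morph bc_map f : x y / x + y}.
Proof. by move=> x y; apply: tens_liftD; apply: bc_map_bal. Qed.

Lemma bc_map0 : bc_map f 0 = 0.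
Proof. exact: (tens_lift0 bc_map_bal). Qed.

Lemma bc_map_linear : linear (bc_map f).
Proof.
move=> a x y; rewrite bc_mapD; congr (_ + _).
move: x; apply: bc_ind => [|x z hx hz|m t].
- by rewrite scaler0 !bc_map0 scaler0.
- by rewrite scalerDr !bc_mapD hx hz scalerDr.
- by rewrite bc_pureZ !bc_map_pure bc_pureZ.
Qed.

End Map.

Lemma bc_map_id (M : lmodType R) x : bc_map (@idfun M) x = x.
Proof.
move: x; apply: bc_ind => [|x y hx hy|m s]; first by rewrite (bc_map0 idfun).
  by rewrite (bc_mapD idfun) hx hy.
by rewrite (bc_map_pure idfun).
Qed.

Lemma bc_map_comp (M M' M'' : lmodType R) (f : {linear M' -> M''})
  (g : {linear M -> M'}) x : bc_map (f \o g) x = bc_map f (bc_map g x).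
Proof.
move: x; apply: bc_ind => [|x y hx hy|m s]; first by rewrite !bc_map0.
  by rewrite !bc_mapD hx hy.
by rewrite !bc_map_pure.
Qed.

Lemma bc_map_zero (M M' : lmodType R) (x : base_change M) :
  bc_map (\0 : M -> M') x = 0.
Proof.
move: x; apply: bc_ind => [|x y hx hy|m s]; first by rewrite bc_map0.
  by rewrite bc_mapD hx hy addr0.
rewrite bc_map_pure -[LHS]/(bc_pure (0 : M') s).
by apply: (addrI (bc_pure (0 : M') s)); rewrite -bc_pureDl !addr0.
Qed.

Lemma bc_map_add (M M' : lmodType R) (f g : M -> M') (x : base_change M) :
  bc_map (f \+ g) x = bc_map f x + bc_map g x.
Proof.
rewrite /bc_map -tens_lift_add2; apply: eq_tens_lift => m s; exact: bc_pureDl.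
Qed.

Lemma bc_map_scale (M : lmodType R) (a : R) (x : base_change M) :
  (forall r (m : M), a *: (r *: m) = r *: (a *: m)) ->
  bc_map ( *:%R a) x = phi a *: x.
Proof.
move=> ha; have hl : linear ( *:%R a : M -> M).
  by move=> r m m'; rewrite scalerDr ha.
pose f : {linear M -> M} := HB.pack ( *:%R a : M -> M) (GRing.isLinear.Build _ _ _ _ _ hl).
move: x; apply: bc_ind => [|x y hx hy|m s]; first by rewrite (bc_map0 f) scaler0.
  by rewrite (bc_mapD f) hx hy scalerDr.
by rewrite (bc_map_pure f) /= bc_pureS bc_pureZ.
Qed.

End BaseChange.

Arguments base_change {R S} phi M.
Arguments bc_pure {R S} phi {M} m s.
Arguments bc_map {R S} phi {M M'} f x.
Arguments bc_pureS {R S} phi {M} r m s.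
Arguments bc_pureZ {R S} phi {M} m s t.

(* B (x)_R S as a ring, where R acts on B through the central map alpha. *)
Section AlgTensor.
Variables (R B : pzRingType) (S : comPzRingType).
Variables (alpha : {rmorphism R -> B}) (phi : {rmorphism R -> S}).

Definition central_map := forall r b, alpha r * b = b * alpha r.

Variable (calpha : central_map).

Definition alg_tensor of central_map :=
  tensor (fun (r : R) (b : B) => alpha r * b) (fun (r : R) (s : S) => phi r * s).

Local Notation T := (alg_tensor calpha).

HB.instance Definition _ := GRing.Zmodule.on T.

Definition at_pure (b : B) (s : S) : T := pure _ _ b s.

Lemma at_pureDl b b' s : at_pure (b + b') s = at_pure b s + at_pure b' s.
Proof. exact: (balDl (balanced_pure _ _)). Qed.
Lemma at_pureDr b s s' : at_pure b (s + s') = at_pure b s + at_pure b s'.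
Proof. exact: (balDr (balanced_pure _ _)). Qed.
Lemma at_pureS r b s : at_pure (alpha r * b) s = at_pure b (phi r * s).
Proof. exact: (balS (balanced_pure _ _)). Qed.

Lemma at_ind (Q : T -> Prop) :
  Q 0 -> (forall x y, Q x -> Q y -> Q (x + y)) ->
  (forall m n, Q (at_pure m n)) -> forall x, Q x.
Proof. exact: tens_ind. Qed.

Definition at_mul1 (b : B) (s : S) (y : T) : T :=
  tens_lift (fun b' s' => at_pure (b * b') (s * s')) y.

Lemma at_mul1_bal b s : balanced (fun (r : R) (b : B) => alpha r * b)
  (fun (r : R) (s : S) => phi r * s) (fun b' s' => at_pure (b * b') (s * s')).
Proof.
split=> *; first by rewrite mulrDr at_pureDl.
  by rewrite mulrDr at_pureDr.
by rewrite mulrA -calpha -mulrA at_pureS mulrCA.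
Qed.

Lemma at_mul1_pure b s b' s' :
  at_mul1 b s (at_pure b' s') = at_pure (b * b') (s * s').
Proof. exact: (tens_lift_pure _ _ (at_mul1_bal b s)). Qed.

Lemma at_mul1D b s : {morph at_mul1 b s : x y / x + y}.
Proof. by move=> x y; apply: tens_liftD; apply: at_mul1_bal. Qed.

Lemma at_mul10 b s : at_mul1 b s 0 = 0.
Proof. exact: (tens_lift0 (at_mul1_bal b s)). Qed.

Definition at_mul (x y : T) : T := tens_lift (fun b s => at_mul1 b s y) x.

Lemma at_mul_bal y : balanced (fun (r : R) (b : B) => alpha r * b)
  (fun (r : R) (s : S) => phi r * s) (fun b s => at_mul1 b s y).
Proof.
split.
- move=> m m' n; move: y; apply: at_ind => [|x z hx hz|b' s'].
  + by rewrite !at_mul10 addr0.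
  + by rewrite !at_mul1D hx hz addrACA.
  + by rewrite !at_mul1_pure mulrDl at_pureDl.
- move=> m n n'; move: y; apply: at_ind => [|x z hx hz|b' s'].
  + by rewrite !at_mul10 addr0.
  + by rewrite !at_mul1D hx hz addrACA.
  + by rewrite !at_mul1_pure mulrDl at_pureDr.
- move=> r m n; move: y; apply: at_ind => [|x z hx hz|b' s'].
  + by rewrite !at_mul10.
  + by rewrite !at_mul1D hx hz.
  + by rewrite !at_mul1_pure -!mulrA at_pureS.
Qed.

Lemma at_mul_pure b s b' s' :
  at_mul (at_pure b s) (at_pure b' s') = at_pure (b * b') (s * s').
Proof. by rewrite /at_mul (tens_lift_pure _ _ (at_mul_bal _)) at_mul1_pure. Qed.

Lemma at_mulDl : left_distributive at_mul +%R.
Proof. by move=> x y z; apply: tens_liftD; apply: at_mul_bal. Qed.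

Lemma at_mul0l y : at_mul 0 y = 0.
Proof. exact: (tens_lift0 (at_mul_bal y)). Qed.

Lemma at_mulDr : right_distributive at_mul +%R.
Proof.
move=> x y z; rewrite /at_mul -tens_lift_add2; apply: eq_tens_lift => b s.
exact: at_mul1D.
Qed.

Lemma at_mul0r x : at_mul x 0 = 0.
Proof. by apply: (addrI (at_mul x 0)); rewrite -at_mulDr !addr0. Qed.

Lemma at_mulA : associative at_mul.
Proof.
move=> x y z; move: x; apply: at_ind => [|x x' hx hx'|b s].
- by rewrite !at_mul0l.
- by rewrite !at_mulDl hx hx'.
move: y; apply: at_ind => [|x x' hx hx'|b' s'].
- by rewrite !(at_mul0r, at_mul0l).
- by rewrite !(at_mulDl, at_mulDr) hx hx'.
move: z; apply: at_ind => [|x x' hx hx'|b'' s''].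
- by rewrite !at_mul0r.
- by rewrite !at_mulDr hx hx'.
by rewrite !at_mul_pure !mulrA.
Qed.

Lemma at_mul1l : left_id (at_pure 1 1) at_mul.
Proof.
apply: at_ind => [|x x' hx hx'|b s]; first by rewrite at_mul0r.
  by rewrite at_mulDr hx hx'.
by rewrite at_mul_pure !mul1r.
Qed.

Lemma at_mul1r : right_id (at_pure 1 1) at_mul.
Proof.
apply: at_ind => [|x x' hx hx'|b s]; first by rewrite at_mul0l.
  by rewrite at_mulDl hx hx'.
by rewrite at_mul_pure !mulr1.
Qed.

HB.instance Definition _ := GRing.Zmodule_isPzRing.Build T
  at_mulA at_mul1l at_mul1r at_mulDl at_mulDr.

End AlgTensor.

Arguments at_pure {R B S alpha} phi calpha b s.


Section CommTensor.
Variables (R : pzRingType) (B S : comPzRingType).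
Variables (alpha : {rmorphism R -> B}) (phi : {rmorphism R -> S}).

Lemma central_comm : central_map alpha.
Proof. by move=> r b; apply: mulrC. Qed.

Definition ctensor := alg_tensor phi central_comm.
HB.instance Definition _ := GRing.PzRing.on ctensor.

Lemma ctensor_mulC : commutative (@GRing.mul ctensor).
Proof.
move=> x y; move: x; apply: at_ind => [|x x' hx hx'|b s].
- by rewrite mul0r mulr0.
- by rewrite mulrDl mulrDr hx hx'.
move: y; apply: at_ind => [|x x' hx hx'|b' s'].
- by rewrite mul0r mulr0.
- by rewrite mulrDl mulrDr hx hx'.
by rewrite -[LHS]/(at_mul _ _) -[RHS]/(at_mul _ _) !at_mul_pure mulrC (mulrC s).
Qed.

HB.instance Definition _ :=
  GRing.PzRing_hasCommutativeMul.Build ctensor ctensor_mulC.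

Definition ct_pure (b : B) (s : S) : ctensor := at_pure phi central_comm b s.

Lemma ct_ind (Q : ctensor -> Prop) :
  Q 0 -> (forall x y, Q x -> Q y -> Q (x + y)) ->
  (forall m n, Q (ct_pure m n)) -> forall x, Q x.
Proof. exact: tens_ind. Qed.

Lemma ct_pureM b s b' s' : ct_pure b s * ct_pure b' s' = ct_pure (b * b') (s * s').
Proof. exact: at_mul_pure. Qed.
Lemma ct_pureDl b b' s : ct_pure (b + b') s = ct_pure b s + ct_pure b' s.
Proof. exact: at_pureDl. Qed.
Lemma ct_pureDr b s s' : ct_pure b (s + s') = ct_pure b s + ct_pure b s'.
Proof. exact: at_pureDr. Qed.
Lemma ct_pureS r b s : ct_pure (alpha r * b) s = ct_pure b (phi r * s).
Proof. exact: at_pureS. Qed.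
Lemma ct_pure11 : ct_pure 1 1 = 1. Proof. by []. Qed.

Definition ct_inl (b : B) : ctensor := ct_pure b 1.
Definition ct_inr (s : S) : ctensor := ct_pure 1 s.

Lemma ct_inlB : zmod_morphism ct_inl.
Proof.
move=> x y; apply: (addIr (ct_inl y)).
by rewrite /ct_inl -ct_pureDl !subrK.
Qed.
Lemma ct_inlM : monoid_morphism ct_inl.
Proof. by split=> // x y; rewrite /ct_inl ct_pureM mulr1. Qed.
HB.instance Definition _ := GRing.isZmodMorphism.Build _ _ ct_inl ct_inlB.
HB.instance Definition _ := GRing.isMonoidMorphism.Build _ _ ct_inl ct_inlM.

Lemma ct_inrB : zmod_morphism ct_inr.
Proof.
move=> x y; apply: (addIr (ct_inr y)).
by rewrite /ct_inr -ct_pureDr !subrK.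
Qed.
Lemma ct_inrM : monoid_morphism ct_inr.
Proof. by split=> // x y; rewrite /ct_inr ct_pureM mulr1. Qed.
HB.instance Definition _ := GRing.isZmodMorphism.Build _ _ ct_inr ct_inrB.
HB.instance Definition _ := GRing.isMonoidMorphism.Build _ _ ct_inr ct_inrM.

Lemma ct_in_compat r : ct_inl (alpha r) = ct_inr (phi r).
Proof. by rewrite /ct_inl -[alpha r]mulr1 ct_pureS mulr1. Qed.

Section Lift.
Variables (P : comPzRingType) (f : {rmorphism B -> P}) (g : {rmorphism S -> P}).
Variable compat : forall r, f (alpha r) = g (phi r).

Definition ct_lift of (forall r, f (alpha r) = g (phi r)) := fun x : ctensor =>
  tens_lift (fun b s => f b * g s) x.

Local Notation h := (ct_lift compat).

Lemma ct_lift_bal : balanced (fun (r : R) (b : B) => alpha r * b)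
  (fun (r : R) (s : S) => phi r * s) (fun b s => f b * g s).
Proof.
split=> *; first by rewrite rmorphD mulrDl.
  by rewrite rmorphD mulrDr.
by rewrite !rmorphM compat mulrAC mulrC mulrA -mulrA mulrC -mulrA.
Qed.

Lemma ct_lift_pure b s : h (ct_pure b s) = f b * g s.
Proof. exact: (tens_lift_pure _ _ ct_lift_bal). Qed.

Lemma ct_liftB : zmod_morphism h.
Proof. by move=> x y; apply: tens_liftB; apply: ct_lift_bal. Qed.

HB.instance Definition _ := GRing.isZmodMorphism.Build _ _ h ct_liftB.

Lemma ct_liftM : monoid_morphism h.
Proof.
split; first by rewrite -ct_pure11 ct_lift_pure !rmorph1 mulr1.
move=> x y; move: x; apply: ct_ind => [|x x' hx hx'|b s].
- by rewrite mul0r raddf0 mul0r.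
- by rewrite mulrDl !raddfD /= hx hx' mulrDl.
move: y; apply: ct_ind => [|x x' hx hx'|b' s'].
- by rewrite mulr0 raddf0 mulr0.
- by rewrite mulrDr !raddfD /= hx hx' mulrDr.
by rewrite ct_pureM !ct_lift_pure !rmorphM mulrACA.
Qed.

HB.instance Definition _ := GRing.isMonoidMorphism.Build _ _ h ct_liftM.
End Lift.

End CommTensor.

Arguments ctensor {R B S} alpha phi.
Arguments ct_pure {R B S} alpha phi b s.
Arguments ct_inl {R B S} alpha phi b.
Arguments ct_inr {R B S} alpha phi s.
Arguments ct_lift {R B S alpha phi P f g} compat x : rename.

Section IterRmorphism.
Variables (T : pzRingType) (f : {rmorphism T -> T}) (n : nat).
Definition iter_rmorph (x : T) : T := iter n f x.
Lemma iter_rmorphB : zmod_morphism iter_rmorph.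
Proof. by rewrite /iter_rmorph => x y; elim: n => //= m ->; rewrite rmorphB. Qed.
Lemma iter_rmorphM : monoid_morphism iter_rmorph.
Proof.
rewrite /iter_rmorph; split; first by elim: n => //= m ->; rewrite rmorph1.
by move=> x y; elim: n => //= m ->; rewrite rmorphM.
Qed.
HB.instance Definition _ := GRing.isZmodMorphism.Build _ _ iter_rmorph iter_rmorphB.
HB.instance Definition _ := GRing.isMonoidMorphism.Build _ _ iter_rmorph iter_rmorphM.
End IterRmorphism.

Section Frobenius.
Variables (k : finFieldType) (L : fieldType) (j : {rmorphism k -> L}).

(* The morphism j is only recorded so that x |-> x ^+ #|k| is known to be additive. *)
Definition frob of {rmorphism k -> L} := fun x : L => x ^+ #|k|.

Lemma frob_pchar : [pchar L].-nat #|k|.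
Proof.
have [p p_pr pk] := finPcharP k.
have pL : p \in [pchar L] by rewrite (fmorph_pchar j).
rewrite (eq_pnat _ (pcharf_eq pL)).
have -> : #|k| = #|pPrimeCharType pk| by [].
by rewrite card_pprimeChar pnatX pnat_id.
Qed.

Lemma frobB : zmod_morphism (frob j).
Proof.
move=> x y; apply: (addIr (frob j y)).
by rewrite /frob -exprDn_pchar ?frob_pchar // !subrK.
Qed.
Lemma frobM : monoid_morphism (frob j).
Proof. by split=> [|x y]; rewrite /frob ?expr1n ?exprMn. Qed.
HB.instance Definition _ := GRing.isZmodMorphism.Build _ _ (frob j) frobB.
HB.instance Definition _ := GRing.isMonoidMorphism.Build _ _ (frob j) frobM.

Lemma frobK c : frob j (j c) = j c.
Proof. by rewrite /frob -rmorphXn expf_card. Qed.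
End Frobenius.

Section Subring.
Variable K : fieldType.

Record subring := Subring {
  subring_set :> K -> Prop;
  subring1 : subring_set 1;
  subringB : forall x y, subring_set x -> subring_set y -> subring_set (x - y);
  subringM : forall x y, subring_set x -> subring_set y -> subring_set (x * y) }.

Variable S : subring.

Definition subring_mem : {pred K} := fun x => `[< S x >].

Lemma subring_memP x : reflect (S x) (x \in subring_mem).
Proof. exact: asboolP. Qed.

Lemma subring_mem_closed : subring_closed subring_mem.
Proof.
split; first by apply/subring_memP; exact: subring1.
  by move=> x y /subring_memP hx /subring_memP hy; apply/subring_memP/subringB.
by move=> x y /subring_memP hx /subring_memP hy; apply/subring_memP/subringM.
Qed.

HB.instance Definition _ := GRing.isSubringClosed.Build K subring_mem subring_mem_closed.

Definition ringOf := {x : K | x \in subring_mem}.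
HB.instance Definition _ := [isSub of ringOf for @sval K _].
HB.instance Definition _ := [Choice of ringOf by <:].
HB.instance Definition _ := [SubChoice_isSubComNzRing of ringOf by <:].

Definition in_ringOf (x : K) (h : S x) : ringOf := Sub x (introT (subring_memP x) h).

Lemma ringOfP (x : ringOf) : S (val x).
Proof. exact/subring_memP/(valP x). Qed.

Definition ringOf_incl (x : ringOf) : K := val x.
HB.instance Definition _ := GRing.RMorphism.copy ringOf_incl (val : ringOf -> K).

Definition uniformizer (pi : K) : Prop :=
  [/\ S pi, ~ S pi^-1 &
    forall x, x != 0 -> exists (n : int) (u : K), [/\ S u, S u^-1 & x = u * pi ^ n]].

(* S is a discrete valuation ring with fraction field K. *)
Definition dvr_of : Prop := exists pi, uniformizer pi.

End Subring.

Definition is_fraction_field (T : comPzRingType) (F : fieldType)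
    (h : {rmorphism T -> F}) : Prop :=
  injective h /\ forall z, exists x y : T, y != 0 /\ z = h x / h y.

Definition ideal (T : comPzRingType) (I : T -> Prop) : Prop :=
  [/\ I 0, forall x y, I x -> I y -> I (x + y) & forall a x, I x -> I (a * x)].

Definition prime_ideal (T : comPzRingType) (I : T -> Prop) : Prop :=
  [/\ ideal I, ~ I 1 & forall x y, I (x * y) -> I x \/ I y].

Definition is_domain (T : comPzRingType) : Prop :=
  1 <> 0 :> T /\ forall x y : T, x * y = 0 -> x = 0 \/ y = 0.

Definition is_nilpotent (T : pzRingType) (x : T) : Prop := exists n, x ^+ n = 0.

Definition irreducible_spectrum (T : comPzRingType) : Prop :=
  prime_ideal (@is_nilpotent T).

(* Regularity of a noetherian domain of dimension at most one: the maximal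
   ideal of each local ring T_I is generated by one element (0 for I = 0). *)
Definition regular_dim1 (T : comPzRingType) : Prop :=
  is_domain T /\ forall I : T -> Prop, prime_ideal I ->
    exists2 pi, I pi & forall x, I x -> exists s y, ~ I s /\ s * x = y * pi.

Section Curve.
Variable k : finFieldType.

Definition function_field1 (K : fieldType) (iota : {rmorphism k -> K}) : Prop :=
  exists t : K,
    (forall p : {poly k}, p != 0 -> (map_poly iota p).[t] != 0) /\
    exists (n : nat) (b : 'I_n -> K), forall x : K,
      exists (q : {poly k}) (p : 'I_n -> {poly k}), q != 0 /\
        (map_poly iota q).[t] * x = \sum_i (map_poly iota (p i)).[t] * b i.

Record ksubring (K : fieldType) (iota : {rmorphism k -> K}) := KSubring {
  ks_ring :> subring K;
  ks_const : forall c, ks_ring (iota c) }.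

Section KSubring.
Variables (K : fieldType) (iota : {rmorphism k -> K}) (S : ksubring iota).

Definition ks_cst (c : k) : ringOf S := in_ringOf (ks_const S c).
Lemma ks_cstB : zmod_morphism ks_cst.
Proof. by move=> x y; apply: val_inj; rewrite /= rmorphB. Qed.
Lemma ks_cstM : monoid_morphism ks_cst.
Proof.
by split=> [|x y]; apply: val_inj; rewrite /= ?rmorph1 ?rmorphM.
Qed.
HB.instance Definition _ := GRing.isZmodMorphism.Build _ _ ks_cst ks_cstB.
HB.instance Definition _ := GRing.isMonoidMorphism.Build _ _ ks_cst ks_cstM.
End KSubring.

(* A smooth projective curve is given by its function field K; its closed points
   are identified with their local rings, which are all the discrete valuation
   rings of K / k (the abstract nonsingular curve of K, as in Hartshorne I.6).
   Smooth means geometrically regular. *)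
Record curve := Curve {
  curve_field : fieldType;
  curve_const : {rmorphism k -> curve_field};
  curve_dim1 : function_field1 curve_const;
  curve_irr : forall (L : fieldType) (j : {rmorphism k -> L}),
    irreducible_spectrum (ctensor curve_const j);
  curve_smooth : forall P : ksubring curve_const, dvr_of P ->
    forall (L : fieldType) (j : {rmorphism k -> L}),
    regular_dim1 (ctensor (ks_cst P) j) }.

Definition place (C : curve) := {P : ksubring (curve_const C) | dvr_of P}.
Definition local_ring (C : curve) (P : place C) : ksubring (curve_const C) := sval P.

(* A point of C(k): a point P with a k-algebra morphism O_P -> k. *)
Record rational_point (C : curve) := RationalPoint {
  rp_place :> place C;
  rp_ev : {rmorphism ringOf (local_ring rp_place) -> k};
  rp_evK : forall c, rp_ev (ks_cst (local_ring rp_place) c) = c }.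

Section RegularRing.
Variables (C : curve) (inf : place C).
Local Notation K := (curve_field C).

Definition regular_away (x : K) : Prop :=
  forall P : place C, ~ (forall y, local_ring P y <-> local_ring inf y) ->
    local_ring P x.

Lemma regular_away1 : regular_away 1.
Proof. by move=> P _; apply: subring1. Qed.
Lemma regular_awayB x y : regular_away x -> regular_away y -> regular_away (x - y).
Proof. by move=> hx hy P hP; apply: subringB; [apply: hx|apply: hy]. Qed.
Lemma regular_awayM x y : regular_away x -> regular_away y -> regular_away (x * y).
Proof. by move=> hx hy P hP; apply: subringM; [apply: hx|apply: hy]. Qed.
Lemma regular_away_const c : regular_away (curve_const C c).
Proof. by move=> P _; apply: ks_const. Qed.

(* A = \Gamma(C \ {inf}, O_C). *)
Definition affine_ring : ksubring (curve_const C) :=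
  @KSubring _ _ (Subring regular_away1 regular_awayB regular_awayM)
    regular_away_const.
End RegularRing.
End Curve.

Section Extension.
Variables (k : finFieldType) (L : fieldType) (j : {rmorphism k -> L}).

Section Sigma.
Variables (B : comPzRingType) (alpha : {rmorphism k -> B}).
Local Notation T := (ctensor alpha j).

Lemma sigma_compat c :
  ct_inl alpha j (alpha c) = (ct_inr alpha j \o frob j) (j c).
Proof. by rewrite /= frobK ct_in_compat. Qed.

(* sigma^* : b (x) l |-> b (x) l^q. *)
Definition sigma : T -> T := ct_lift sigma_compat.
HB.instance Definition _ := GRing.RMorphism.on sigma.

Lemma sigma_pure b l : sigma (ct_pure alpha j b l) = ct_pure alpha j b (frob j l).
Proof. by rewrite /sigma ct_lift_pure /= /ct_inl /ct_inr ct_pureM mulr1 mul1r. Qed.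
End Sigma.
Arguments sigma {B alpha} x.

Variable C : curve k.
Local Notation K := (curve_field C).

(* The function field of C_L together with the endomorphism sigma^*. *)
Record function_fieldL := FunctionFieldL {
  ffL :> fieldType;
  ffL_K : {rmorphism K -> ffL};
  ffL_L : {rmorphism L -> ffL};
  ffL_compat : forall c, ffL_K (curve_const C c) = ffL_L (j c);
  ffL_frac : is_fraction_field (ct_lift ffL_compat);
  ffL_sigma : {rmorphism ffL -> ffL};
  ffL_sigmaK : forall x, ffL_sigma (ffL_K x) = ffL_K x;
  ffL_sigmaL : forall x, ffL_sigma (ffL_L x) = ffL_L (frob j x) }.

Variable F : function_fieldL.

Section SubExtension.
Variable S : ksubring (curve_const C).
Local Notation SL := (ctensor (ks_cst S) j).

Lemma to_ffL_compat c :
  (ffL_K F \o @ringOf_incl _ S) (ks_cst S c) = ffL_L F (j c).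
Proof. exact: ffL_compat. Qed.

Definition to_ffL : SL -> F := ct_lift to_ffL_compat.
HB.instance Definition _ := GRing.RMorphism.on to_ffL.

Lemma to_ffL_sigma x : to_ffL (sigma x) = ffL_sigma F (to_ffL x).
Proof.
move: x; apply: ct_ind => [|x y hx hy|b l]; first by rewrite !rmorph0.
  by rewrite !rmorphD /= hx hy.
by rewrite sigma_pure /to_ffL !ct_lift_pure rmorphM /= ffL_sigmaK ffL_sigmaL.
Qed.
End SubExtension.

Variable inf : rational_point C.
Local Notation O := (local_ring inf).
Local Notation OL := (ctensor (ks_cst O) j).

Lemma ev_compat c : (j \o rp_ev inf) (ks_cst O c) = idfun (j c).
Proof. by rewrite /= rp_evK. Qed.

(* Evaluation at the point inf_L; its kernel is the prime ideal of that point. *)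
Definition evL : OL -> L := ct_lift ev_compat.
HB.instance Definition _ := GRing.RMorphism.on evL.

Lemma evL_sigma x : evL (sigma x) = frob j (evL x).
Proof.
move: x; apply: ct_ind => [|x y hx hy|b l]; first by rewrite !rmorph0.
  by rewrite !rmorphD /= hx hy.
rewrite sigma_pure /evL !ct_lift_pure rmorphM /=.
by rewrite frobK.
Qed.

(* The local ring O_{C_L, inf_L}, inside the function field. *)
Definition stalk_set (z : F) : Prop :=
  exists x y : OL, evL y != 0 /\ z = to_ffL x / to_ffL y.

Lemma stalk1 : stalk_set 1.
Proof. by exists 1, 1; rewrite !rmorph1 divr1 oner_eq0. Qed.

Lemma stalkM z w : stalk_set z -> stalk_set w -> stalk_set (z * w).
Proof.
move=> [x [y [hy ->]]] [x' [y' [hy' ->]]]; exists (x * x'), (y * y').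
by rewrite !rmorphM mulf_neq0 // invfM mulrACA.
Qed.

Lemma stalkB z w : stalk_set z -> stalk_set w -> stalk_set (z - w).
Proof.
move=> [x [y [hy ->]]] [x' [y' [hy' ->]]].
have [y0|yn0] := eqVneq (to_ffL y) 0.
  exists (- x'), y'; split=> //.
  by rewrite y0 invr0 mulr0 sub0r rmorphN mulNr.
have [y0|yn0'] := eqVneq (to_ffL y') 0.
  by exists x, y; split=> //; rewrite y0 invr0 mulr0 subr0.
exists (x * y' - x' * y), (y * y'); rewrite rmorphM mulf_neq0 //; split=> //.
by rewrite rmorphB !rmorphM -[- (_ / _)]mulNr addf_div // mulNr.
Qed.

Definition stalk_ring : subring F := Subring stalk1 stalkB stalkM.
Local Notation OinfL := (ringOf stalk_ring).

Lemma stalk_sigma_proof (z : OinfL) : stalk_ring (ffL_sigma F (val z)).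
Proof.
have [x [y [hy ->]]] := ringOfP z.
exists (sigma x), (sigma y); rewrite evL_sigma fmorph_eq0 hy; split=> //.
by rewrite fmorph_div !to_ffL_sigma.
Qed.

Definition stalk_sigma (z : OinfL) : OinfL := in_ringOf (stalk_sigma_proof z).
Lemma stalk_sigmaB : zmod_morphism stalk_sigma.
Proof. by move=> x y; apply: val_inj; rewrite /= rmorphB. Qed.
Lemma stalk_sigmaM : monoid_morphism stalk_sigma.
Proof. by split=> [|x y]; apply: val_inj; rewrite /= ?rmorph1 ?rmorphM. Qed.
HB.instance Definition _ := GRing.isZmodMorphism.Build _ _ stalk_sigma stalk_sigmaB.
HB.instance Definition _ := GRing.isMonoidMorphism.Build _ _ stalk_sigma stalk_sigmaM.

End Extension.

Arguments sigma {k L j B alpha} x.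
Arguments to_ffL {k L j C} F S x.
Arguments stalk_ring {k L j C} F inf.
Arguments stalk_sigma {k L j C F inf} z.

Section Modules.
Variables (T : comPzRingType) (M : lmodType T).

Definition is_basis (r : nat) (e : 'I_r -> M) : Prop :=
  (forall m, exists a : 'I_r -> T, m = \sum_i a i *: e i) /\
  (forall a : 'I_r -> T, \sum_i a i *: e i = 0 -> forall i, a i = 0).

Definition free_of_rank (r : nat) : Prop := exists e : 'I_r -> M, is_basis e.

(* The localization M_f is free of rank r over T_f. A basis of M_f can be
   rescaled by powers of f to consist of images of elements of M. *)
Definition loc_free_at (r : nat) (f : T) : Prop :=
  exists e : 'I_r -> M,
    (forall m, exists (n : nat) (a : 'I_r -> T), f ^+ n *: m = \sum_i a i *: e i) /\
    (forall a : 'I_r -> T, \sum_i a i *: e i = 0 ->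
       forall i, exists n : nat, f ^+ n * a i = 0).

Definition locally_free (r : nat) : Prop :=
  exists (n : nat) (f : 'I_n -> T),
    (exists b : 'I_n -> T, \sum_i b i * f i = 1) /\ forall i, loc_free_at r (f i).
End Modules.

Section Motive.
Variables (k : finFieldType) (C : curve k) (inf : rational_point C).
Variables (L : fieldType) (j : {rmorphism k -> L}).
Local Notation A := (affine_ring inf).
Local Notation AL := (ctensor (ks_cst A) j).

Record characteristic := Characteristic {
  char_map :> {rmorphism ringOf A -> L};
  char_mapK : forall x, char_map (ks_cst A x) = j x }.

Variables (c : characteristic) (F : function_fieldL j C).

(* The ideal J generated by the elements a (x) 1 - 1 (x) c(a). *)
Definition idealJ (x : AL) : Prop :=
  exists (n : nat) (b : 'I_n -> AL) (a : 'I_n -> ringOf A),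
    x = \sum_i b i * (ct_inl (ks_cst A) j (a i) - ct_inr (ks_cst A) j (c (a i))).

Local Notation sigmaA := (sigma : AL -> AL).

Section TauModule.
Variables (M : lmodType AL) (tau : {linear base_change sigmaA M -> M}).

Definition in_im_tau (m : M) : Prop := exists x, tau x = m.

(* dim_L (coker tau) = d. *)
Definition coker_dim (d : nat) : Prop :=
  exists e : 'I_d -> M,
    (forall m, exists l : 'I_d -> L,
       in_im_tau (m - \sum_i ct_inr (ks_cst A) j (l i) *: e i)) /\
    (forall l : 'I_d -> L, in_im_tau (\sum_i ct_inr (ks_cst A) j (l i) *: e i) ->
       forall i, l i = 0).

(* Products of d elements of J generate J^d. *)
Definition coker_killed (d : nat) : Prop :=
  forall x : 'I_d -> AL, (forall i, idealJ (x i)) ->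
    forall m, in_im_tau ((\prod_i x i) *: m).

Definition generic_fibre := base_change (to_ffL F A) M.

(* The sigma-semilinear endomorphism of the generic fibre induced by tau. *)
Definition tau_gen (v : generic_fibre) : generic_fibre :=
  tens_lift (fun m x =>
    bc_pure (to_ffL F A) (tau (bc_pure sigmaA m 1)) (ffL_sigma F x)) v.

Lemma tau_gen_pure m x :
  tau_gen (bc_pure _ m x) =
  bc_pure (to_ffL F A) (tau (bc_pure sigmaA m 1)) (ffL_sigma F x).
Proof.
apply: tens_lift_pure; split=> [m1 m2 s|m1 s s'|a m1 s].
- by rewrite bc_pureDl raddfD bc_pureDl.
- by rewrite raddfD bc_pureDr.
- have -> : bc_pure sigmaA (a *: m1) 1 = sigma a *: bc_pure sigmaA m1 1.
    by rewrite bc_pureS bc_pureZ.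
  by rewrite linearZ bc_pureS rmorphM /= to_ffL_sigma.
Qed.

(* A locally free sheaf of rank r on C_L extending M amounts to its stalk W at
   inf, free of rank r, with an identification theta of generic fibres. The stalk
   of (sigma^* )^l of the sheaf is W (x)_{sigma^l} O, and that of its twist by
   kk * inf is pi^-kk W, inside the generic fibre. *)
Definition pure_at_inf (r : nat) : Prop :=
  exists (W : lmodType (ringOf (stalk_ring F inf)))
    (theta : {linear base_change (@ringOf_incl _ (stalk_ring F inf)) W ->
                     generic_fibre}),
  [/\ free_of_rank W r, bijective theta &
    exists (kk l : nat) (pi : curve_field C)
      (phi : {linear
         base_change (iter_rmorph (stalk_sigma : ringOf (stalk_ring F inf) -> _) l) W -> W}),
      [/\ (0 < kk)%N, (0 < l)%N, uniformizer (local_ring inf) pi, bijective phi &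
        forall w : W,
          iter l tau_gen (theta (bc_pure _ w 1)) =
          (ffL_K F pi ^- kk) *: theta (bc_pure _ (phi (bc_pure _ w 1)) 1)]].
End TauModule.

Record motive := Motive {
  mot_mod :> lmodType AL;
  mot_tau : {linear base_change sigmaA mot_mod -> mot_mod};
  mot_rank : nat;
  mot_dim : nat;
  mot_locfree : locally_free mot_mod mot_rank;
  mot_inj : injective mot_tau;
  mot_coker : coker_dim mot_tau mot_dim;
  mot_char : coker_killed mot_tau mot_dim;
  mot_pure : pure_at_inf mot_tau mot_rank }.

Record mhom (M M' : motive) := Hom {
  hom_fun :> M -> M';
  hom_linear : linear hom_fun;
  hom_tau : forall x, hom_fun (mot_tau M x) = mot_tau M' (bc_map sigmaA hom_fun x) }.

HB.instance Definition _ (M M' : motive) (f : mhom M M') :=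
  GRing.isLinear.Build _ _ _ _ (hom_fun f) (hom_linear f).

HB.instance Definition _ (M M' : motive) := gen_eqMixin (mhom M M').
HB.instance Definition _ (M M' : motive) := gen_choiceMixin (mhom M M').

Lemma hom_ext (M M' : motive) (f g : mhom M M') : (forall x, f x = g x) -> f = g.
Proof.
case: f g => [f lf tf] [g lg tg] /= /funext efg; subst g.
by congr Hom; apply: Prop_irrelevance.
Qed.

Section HomGroup.
Variables M M' : motive.
Implicit Types f g : mhom M M'.

Definition hom0 : mhom M M'.
Proof.
apply: (@Hom _ _ (\0 : M -> M')); first exact: linearP.
by move=> x; rewrite bc_map_zero raddf0.
Defined.

Definition hom_add f g : mhom M M'.
Proof.
apply: (@Hom _ _ (f \+ g)); first exact: linearP.
by move=> x; rewrite bc_map_add raddfD /= !hom_tau.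
Defined.

Definition hom_opp f : mhom M M'.
Proof.
apply: (@Hom _ _ (\- f)); first exact: linearP.
move=> x; apply: (addrI (f (mot_tau M x))).
rewrite /= subrr hom_tau -raddfD -bc_map_add -[LHS](raddf0 (mot_tau M')).
congr (mot_tau M' _); rewrite -(bc_map_zero (phi := sigmaA) M' x).
by congr (bc_map _ _ _); apply: funext => m; rewrite /= subrr.
Defined.

Lemma hom_addA : associative hom_add.
Proof. by move=> f g h; apply: hom_ext => x; apply: addrA. Qed.
Lemma hom_addC : commutative hom_add.
Proof. by move=> f g; apply: hom_ext => x; apply: addrC. Qed.
Lemma hom_add0 : left_id hom0 hom_add.
Proof. by move=> f; apply: hom_ext => x; apply: add0r. Qed.
Lemma hom_addN : left_inverse hom0 hom_opp hom_add.
Proof. by move=> f; apply: hom_ext => x; apply: addNr. Qed.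

HB.instance Definition _ := GRing.isZmodule.Build (mhom M M')
  hom_addA hom_addC hom_add0 hom_addN.
End HomGroup.

Definition hom_id (M : motive) : mhom M M.
Proof.
apply: (@Hom _ _ (@idfun M)); first exact: linearP.
by move=> x; rewrite bc_map_id.
Defined.

Definition hom_comp (M M' M'' : motive) (f : mhom M' M'') (g : mhom M M') : mhom M M''.
Proof.
apply: (@Hom _ _ (f \o g)); first exact: linearP.
by move=> x; rewrite bc_map_comp /= !hom_tau.
Defined.

Section EndRing.
Variable M : motive.

Definition mEnd := mhom M M.
HB.instance Definition _ := GRing.Zmodule.on mEnd.

Lemma End_mulA : associative (@hom_comp M M M).
Proof. by move=> f g h; apply: hom_ext. Qed.
Lemma End_mul1 : left_id (hom_id M) (@hom_comp M M M).
Proof. by move=> f; apply: hom_ext. Qed.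
Lemma End_mulr1 : right_id (hom_id M) (@hom_comp M M M).
Proof. by move=> f; apply: hom_ext. Qed.
Lemma End_mulDl : left_distributive (@hom_comp M M M) (@hom_add M M).
Proof. by move=> f g h; apply: hom_ext. Qed.
Lemma End_mulDr : right_distributive (@hom_comp M M M) (@hom_add M M).
Proof. by move=> f g h; apply: hom_ext => x; apply: (raddfD f). Qed.

HB.instance Definition _ := GRing.Zmodule_isPzRing.Build mEnd
  End_mulA End_mul1 End_mulr1 End_mulDl End_mulDr.

Definition End_scalar (a : ringOf A) : mEnd.
Proof.
apply: (@Hom _ _ ( *:%R (ct_inl (ks_cst A) j a) : M -> M)).
  by move=> r x y; rewrite scalerDr !scalerA mulrC.
move=> x; rewrite bc_map_scale; last by move=> r m; rewrite !scalerA mulrC.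
by rewrite linearZ /= {2}/ct_inl sigma_pure /frob expr1n.
Defined.

Lemma End_scalarB : zmod_morphism End_scalar.
Proof.
move=> a b; apply: hom_ext => x /=; rewrite raddfB scalerBl.
by rewrite -[RHS]/(hom_fun (End_scalar a) x - hom_fun (End_scalar b) x).
Qed.
Lemma End_scalarM : monoid_morphism End_scalar.
Proof.
split=> [|a b]; apply: hom_ext => x /=; first by rewrite rmorph1 scale1r.
by rewrite rmorphM -scalerA.
Qed.
HB.instance Definition _ := GRing.isZmodMorphism.Build _ _ End_scalar End_scalarB.
HB.instance Definition _ := GRing.isMonoidMorphism.Build _ _ End_scalar End_scalarM.

Lemma End_scalar_central : central_map End_scalar.
Proof. by move=> a f; apply: hom_ext => x /=; rewrite linearZ. Qed.

(* E = End(M) (x)_A Q. *)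
Variables (Q : fieldType) (iQ : {rmorphism ringOf A -> Q}).

Definition EndQ := alg_tensor iQ End_scalar_central.
HB.instance Definition _ := GRing.PzRing.on EndQ.

Definition EndQ_pure (f : mEnd) (x : Q) : EndQ := at_pure iQ End_scalar_central f x.

Definition is_order (R : EndQ -> Prop) : Prop :=
  [/\ R 1, forall x y, R x -> R y -> R (x * y),
      exists (n : nat) (b : 'I_n -> EndQ), forall x, R x <->
        exists a : 'I_n -> ringOf A, x = \sum_i EndQ_pure (End_scalar (a i)) 1 * b i &
      forall x, exists (n : nat) (u : 'I_n -> Q) (b : 'I_n -> EndQ),
        (forall i, R (b i)) /\ x = \sum_i EndQ_pure 1 (u i) * b i].

Definition is_maximal_order (R : EndQ -> Prop) : Prop :=
  is_order R /\ forall R' : EndQ -> Prop, is_order R' ->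
    (forall x, R x -> R' x) -> forall x, R' x -> R x.
End EndRing.

Definition isogeny (M' M : motive) (f : mhom M' M) : Prop :=
  injective f /\ forall m : M, exists2 a : AL, a != 0 & exists m', f m' = a *: m.

(* g (x) 1/a is the inverse of the isogeny f in Hom(M, M') (x)_A Q. *)
Definition isogeny_inverse (M' M : motive) (f : mhom M' M) (g : mhom M M')
    (a : ringOf A) : Prop :=
  [/\ a != 0, hom_comp f g = End_scalar M a & hom_comp g f = End_scalar M' a].

(* x belongs to f End(M') f^-1, where f^-1 = g (x) 1/a. *)
Definition conj_End (M' M : motive) (f : mhom M' M) (g : mhom M M') (a : ringOf A)
    (Q : fieldType) (iQ : {rmorphism ringOf A -> Q}) (x : EndQ M iQ) : Prop :=
  exists h : mEnd M', x = EndQ_pure iQ (hom_comp f (hom_comp h g)) (iQ a)^-1.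

End Motive.

(* Main.v *)
(* Write the generators of the maximal order R as h_i / a with h_i in End(M), and
   let M' = sum_i h_i(M), so that aM <= M' <= M and R M' <= M'.  The ring
   f End(M') f^-1 of elements of E stabilising M' contains R; it is an order, hence
   equal to R, because A-valued coordinates of endomorphisms bound its denominators
   and A / bA is finite for b <> 0.
   M' is a motive: its cokernel is a quotient of a power of the one of M, so J^dim
   still kills it; M' and M have the same generic fibre, so purity is inherited;
   and M' is locally free because A (x) L is regular at the primes containing a.
   For the last point, A (x) L is the intersection of the regular rings O_P (x) L,
   so it is completely integrally closed, and its quotients A (x) L / y are finite
   dimensional over L by a counting argument; the usual proof that a one-dimensional
   normal ring is regular then applies. *)
Require Import Defs.
From HB Require Import structures.
From mathcomp Require Import all_boot all_order all_algebra all_field.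
From mathcomp Require Import boolp classical_sets ring.

Set Implicit Arguments.
Unset Strict Implicit.
Unset Printing Implicit Defensive.

Import GRing.Theory.
Local Open Scope ring_scope.

(** [M'] is [a] times the module [R M] generated by [M] under [R] inside [M (x) Q]: this makes it
    stable under [R], and [1] in [R] gives [aM <= M']. [A] is given only as an intersection of
    valuation rings, so no chain condition is at hand. Its place is taken by the finite dimension of
    [T / yT] for nonzero [y]: it yields maximal members in families of ideals containing [y], primes
    above proper ideals, and finite orders at a prime. Tensors are treated through their
    coefficients. [K] and [L] are linearly disjoint in the function field of [C_L], because the
    elements of [L] fixed by sigma are those of [k]; an identity in [A (x) L] can therefore be read
    off along elements of [L] independent over [k]. A motive needs its cokernel killed by [J^d] for
    the dimension [d] of that same cokernel. For [M'] this [d] is only known to be finite and is not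
    compared with the dimension of [M], so killing by the old power of [J] has to be converted into
    killing by [J^d]. *)

(** * Linear algebra modulo a submodule *)

Lemma left_kernel (L : fieldType) (m n : nat) (W : 'M[L]_(m, n)) :
  (n < m)%N -> exists2 v : 'rV[L]_m, v != 0 & v *m W = 0.
Proof.
move=> nm; have : kermx W != 0.
  rewrite -mxrank_eq0 mxrank_ker subn_eq0 -ltnNge.
  exact: leq_ltn_trans (rank_leq_col W) nm.
by case/rowV0Pn => v /sub_kermxP hv v0; exists v.
Qed.

Definition fcons (X : Type) (n : nat) (x : X) (f : 'I_n -> X) : 'I_n.+1 -> X :=
  fun i => if unlift ord0 i is Some i' then f i' else x.

Lemma fcons0 (X : Type) (n : nat) (x : X) (f : 'I_n -> X) : fcons x f ord0 = x.
Proof. by rewrite /fcons unlift_none. Qed.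

Lemma fconsS (X : Type) (n : nat) (x : X) (f : 'I_n -> X) i :
  fcons x f (lift ord0 i) = f i.
Proof. by rewrite /fcons liftK. Qed.

Section RelativeFreeness.
Variables (T : comPzRingType) (V : lmodType T).

Definition submodule (S : V -> Prop) : Prop :=
  [/\ S 0, forall x y, S x -> S y -> S (x + y) & forall a x, S x -> S (a *: x)].

Lemma submodule_sum (S : V -> Prop) (I : Type) (r : seq I) (P : pred I) (f : I -> V) :
  submodule S -> (forall i, P i -> S (f i)) -> S (\sum_(i <- r | P i) f i).
Proof. by case=> h0 hD _ hf; apply: big_ind. Qed.

Variables (L : fieldType) (lam : {rmorphism L -> T}).

(** Linear independence over [L] in the quotient of [V] by [S], without forming that quotient;
    dimensions occur below only as bounds on the length of such families. *)
Definition rel_free (S : V -> Prop) (d : nat) (e : 'I_d -> V) : Prop :=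
  forall c : 'I_d -> L, S (\sum_i lam (c i) *: e i) -> forall i, c i = 0.

Definition in_rel_span (S : V -> Prop) (d : nat) (e : 'I_d -> V) (x : V) : Prop :=
  exists c : 'I_d -> L, S (x - \sum_i lam (c i) *: e i).

Variable S : V -> Prop.
Hypothesis hS : submodule S.

Lemma rel_free_cons d (e : 'I_d -> V) x :
  rel_free S e -> ~ in_rel_span S e x -> rel_free S (fcons x e).
Proof.
move=> he hx c; rewrite big_ord_recl fcons0.
under eq_bigr do rewrite fconsS.
move=> hc.
have c0 : c ord0 = 0.
  apply: contra_notP hx => /eqP c0; exists (fun i => - ((c ord0)^-1 * c (lift ord0 i))).
  case: hS => _ _ /(_ (lam (c ord0)^-1) _ hc).
  rewrite scalerDr scalerA -rmorphM mulVf // rmorph1 scale1r scaler_sumr.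
  congr S; congr (_ + _); rewrite -sumrN; apply: eq_bigr => i _.
  by rewrite scalerA -rmorphM rmorphN scaleNr opprK.
move: hc; rewrite c0 rmorph0 scale0r add0r => /he hc i.
by case: (unliftP ord0 i) => [i'|] ->.
Qed.

Lemma max_rel_free (J : V -> Prop) (D : nat) :
  (forall d (e : 'I_d -> V), (forall i, J (e i)) -> rel_free S e -> (d <= D)%N) ->
  exists d (e : 'I_d -> V),
    [/\ forall i, J (e i), rel_free S e & forall x, J x -> in_rel_span S e x].
Proof.
move=> hD.
pose P d := exists e : 'I_d -> V, (forall i, J (e i)) /\ rel_free S e.
have exP : exists d, `[< P d >].
  exists 0%N; apply/asboolP; exists (fun=> 0); split; first by case.
  by move=> c _ [].
have ubP d : `[< P d >] -> (d <= D)%N by move=> /asboolP [e [h1 h2]]; apply: hD h2.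
case: (ex_maxnP exP ubP) => d /asboolP [e [he1 he2]] hmax.
exists d, e; split=> // x hx; apply: contrapT => hn.
suff : (d.+1 <= d)%N by rewrite ltnn.
apply: hmax; apply/asboolP; exists (fcons x e); split; last exact: rel_free_cons.
by move=> i; case: (unliftP ord0 i) => [i'|] ->; rewrite ?fcons0 ?fconsS.
Qed.

(** If [d > n], the coefficients of the [e i] along [g] form a matrix with a nonzero left kernel
    vector, which is a relation between the [e i] modulo [S]. *)
Lemma rel_free_leq d (e : 'I_d -> V) n (g : 'I_n -> V) :
  (forall i, in_rel_span S g (e i)) -> rel_free S e -> (d <= n)%N.
Proof.
move=> /choice [c hc] he; rewrite leqNgt; apply/negP => nd.
have [v /eqP v0] := left_kernel (\matrix_(i, s) c i s) nd.
move=> /matrixP hv; apply: v0; apply/rowP => i; rewrite mxE.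
move: i; apply: (he (v 0)).
have : S (\sum_i lam (v 0 i) *: (e i - \sum_s lam (c i s) *: g s)).
  by apply: submodule_sum => // i _; case: hS => _ _ hZ; apply: hZ.
congr S; under eq_bigr do rewrite scalerBr.
rewrite sumrB -[RHS]subr0; congr (_ - _).
under eq_bigr do rewrite scaler_sumr.
rewrite exchange_big big1 //= => s _; under eq_bigr do rewrite scalerA -rmorphM.
rewrite -scaler_suml -rmorph_sum.
move: (hv 0 s); rewrite !mxE => h; rewrite (_ : \sum_i _ = 0) ?rmorph0 ?scale0r //.
by rewrite -[RHS]h; apply: eq_bigr => i _; rewrite mxE.
Qed.

End RelativeFreeness.

(** * Finiteness of quotients *)

Section Counting.
Variables (L F : fieldType) (g : {rmorphism L -> F}) (t : F).
Variables (n : nat) (b : 'I_n -> F) (V : F -> Prop).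

Local Notation pe p := ((map_poly g p).[t]).

Hypothesis V_span : forall x, V x -> exists q : {poly L}, pe q != 0 /\
  exists p : 'I_n -> {poly L}, pe q * x = \sum_s pe (p s) * b s.
Hypothesis VM : forall x y, V x -> V y -> V (x * y).
Hypothesis Vb : forall i, V (b i).

Lemma pe_prod (I : Type) (r : seq I) (P : pred I) (q : I -> {poly L}) :
  pe (\prod_(i <- r | P i) q i) = \prod_(i <- r | P i) pe (q i).
Proof. by rewrite rmorph_prod horner_prod. Qed.

Lemma common_denominator (I : finType) (x : I -> F) : (forall i, V (x i)) ->
  exists q : {poly L}, pe q != 0 /\ exists p : I -> 'I_n -> {poly L},
    forall i, pe q * x i = \sum_s pe (p i s) * b s.
Proof.
move=> hx; have /choice [q hq] := fun i => V_span (hx i).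
have /choice [p hp] := fun i => proj2 (hq i).
exists (\prod_i q i); rewrite pe_prod; split.
  by apply/prodf_neq0 => i _; case: (hq i).
exists (fun i s => (\prod_(i' | i' != i) q i') * p i s) => i.
rewrite (bigD1 i) //= mulrAC hp mulr_suml; apply: eq_bigr => s _.
by rewrite rmorphM hornerM pe_prod mulrC mulrA.
Qed.

(** Vectors of [n] polynomials of size at most [B] form an [L]-space of dimension [n * B]. *)
Lemma poly_vec_dependent (I : finType) (B : nat) (w : I -> 'rV[{poly L}]_n) :
  (forall i s, size (w i 0%R s) <= B)%N -> (n * B < #|I|)%N ->
  exists2 c : I -> L, exists i, c i != 0 & \sum_i (c i)%:P *: w i = 0.
Proof.
move=> hB hI.
have hc : (#|{: 'I_n * 'I_B}| < #|I|)%N by rewrite card_prod !card_ord.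
pose W := \matrix_(i < #|I|, k < #|{: 'I_n * 'I_B}|)
   (w (enum_val i) 0 (enum_val k).1)`_(enum_val k).2.
have [v v0 hv] := left_kernel W hc.
exists (fun i => v 0 (enum_rank i)).
  by have /rV0Pn [i hi] := v0; exists (enum_val i); rewrite enum_valK.
apply/rowP => s; rewrite summxE mxE; apply/polyP => m; rewrite coef_sum coef0.
under eq_bigr do rewrite mxE coefCM.
have [mB|Bm] := ltnP m B; last first.
  by rewrite big1 // => i _; rewrite nth_default ?mulr0 // (leq_trans (hB i s)).
have /rowP /(_ (enum_rank (s, Ordinal mB))) := hv; rewrite !mxE => h0; rewrite -[RHS]h0.
rewrite (reindex (@enum_val I predT)) /=; last first.
  by apply: onW_bij; apply: enum_val_bij.
by apply: eq_bigr => i _; rewrite mxE !enum_rankK enum_valK.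
Qed.

Lemma size_mulmx_leq (v : 'rV[{poly L}]_n) (Y : 'M[{poly L}]_n) (e d : nat) s :
  (forall s, size (v 0%R s) <= e)%N -> (forall i s, size (Y i s) <= d.+1)%N ->
  (size ((v *m Y) 0%R s) <= e + d)%N.
Proof.
move=> hv hY; rewrite mxE; apply: leq_trans (size_sum _ _ _) _.
apply/bigmax_leqP => i _; apply: leq_trans (size_polyMleq _ _) _.
by rewrite -subn1 leq_subLR add1n -addnS leq_add.
Qed.

Definition pvec_eval (v : 'rV[{poly L}]_n) : F := \sum_s pe (v 0 s) * b s.

Lemma pvec_eval_sum (I : finType) (w : I -> 'rV[{poly L}]_n) (c : I -> {poly L}) :
  pvec_eval (\sum_i c i *: w i) = \sum_i pe (c i) * pvec_eval (w i).
Proof.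
rewrite /pvec_eval; under [RHS]eq_bigr do rewrite mulr_sumr.
rewrite exchange_big; apply: eq_bigr => s _ /=.
rewrite summxE rmorph_sum horner_sum mulr_suml; apply: eq_bigr => i _.
by rewrite mxE rmorphM hornerM mulrA.
Qed.

Lemma pvec_evalZ (c : {poly L}) v : pvec_eval (c *: v) = pe c * pvec_eval v.
Proof.
rewrite /pvec_eval mulr_sumr; apply: eq_bigr => s _.
by rewrite mxE rmorphM hornerM mulrA.
Qed.

(* The elements y^u x_i, u < U, i < d, lie in a space of dimension
   n * (delta * U + constant), so they are dependent for U large if d > n * delta. *)
Lemma poly_dependent (y : F) : V y -> exists D, forall d (x : 'I_d -> F),
  (forall i, V (x i)) -> (D < d)%N ->
  exists p : 'I_d -> {poly L},
    (exists i, p i != 0) /\ \sum_i (map_poly g (p i)).[y] * x i = 0.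
Proof.
(* [q] clears the denominators of all [y * b i]: on coefficient vectors, multiplication by [q(t) y]
   becomes the matrix [Y], which raises degrees by at most [delta]. *)
move=> hy; have [q [q0 [Y hY]]] := common_denominator (fun i => VM hy (Vb i)).
pose delta := (size q + \sum_i \sum_s size (Y i s))%N.
have sq : (size q <= delta.+1)%N by rewrite leqW // leq_addr.
have sY i s : (size (Y i s) <= delta.+1)%N.
  apply/leqW/(leq_trans _ (leq_addl _ _)).
  by rewrite (bigD1 i) //= (bigD1 s) //= -addnA leq_addr.
pose YM := \matrix_(i, s) Y i s.
have evY v : pvec_eval (v *m YM) = pe q * y * pvec_eval v.
  rewrite /pvec_eval; under eq_bigr do rewrite mxE rmorph_sum horner_sum mulr_suml.
  rewrite exchange_big mulr_sumr; apply: eq_bigr => i _ /=.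
  rewrite mulrCA -mulrA hY mulr_sumr; apply: eq_bigr => s _.
  by rewrite mxE rmorphM hornerM mulrA.
exists (n * delta)%N => d x hx hd.
have [q' [q'0 [X hX]]] := common_denominator hx.
pose eps := (\sum_i \sum_s size (X i s))%N.
have sX i s : (size (X i s) <= eps)%N.
  by rewrite /eps (bigD1 i) //= (bigD1 s) //= -addnA leq_addr.
(* For [d > n * delta], the number [(U + 1) * d] of vectors exceeds [n * (eps + U * delta)] once [U]
   is at least [n * eps]. *)
pose U := (n * eps)%N.
(* The power of [q] equalizes the denominators: [w (u, i)] represents [y^u x_i] times
   [q(t)^U q'(t)], a nonzero factor independent of [u] and [i] that cancels from the relation. *)
pose w (k : 'I_U.+1 * 'I_d) : 'rV[{poly L}]_n :=
  q ^+ (U - k.1) *: iter k.1 (fun v => v *m YM) (\row_s X k.2 s).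
have sw k s : (size (w k 0%R s) <= eps + U * delta)%N.
  have sit u s' :
      (size (iter u (fun v => v *m YM) (\row_s0 X k.2 s0) 0%R s') <= eps + u * delta)%N.
    elim: u s' => [|u IH] s' /=; first by rewrite mxE mul0n addn0 sX.
    rewrite mulSn [(delta + _)%N]addnC addnA.
    by apply: size_mulmx_leq => // i s0; rewrite mxE.
  have squ u : (size (q ^+ u) <= (u * delta).+1)%N.
    elim: u => [|u IH]; first by rewrite expr0 size_poly1.
    rewrite exprS; apply: leq_trans (size_polyMleq _ _) _.
    rewrite -subn1 leq_subLR add1n mulSn -addnS -addSn; exact: leq_add.
  rewrite mxE; apply: leq_trans (size_polyMleq _ _) _.
  rewrite -subn1 leq_subLR add1n.
  apply: leq_trans (leq_add (squ _) (sit _ _)) _.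
  rewrite addSn ltnS addnCA leq_add2l -mulnDl subnK //.
  by rewrite -ltnS ltn_ord.
have [||c [[u0 i0] hc0] hc] := @poly_vec_dependent _ (eps + U * delta) w.
- exact: sw.
- rewrite card_prod !card_ord; apply: leq_trans (leq_mul (leqnn _) hd).
  by rewrite mulnDr -/U mulSn mulnS mulnCA addSn ltnS leq_addl.
exists (fun i => \poly_(u < U.+1) c (inord u, i)); split.
  exists i0; apply: contraNneq hc0 => /polyP /(_ u0).
  by rewrite coef_poly ltn_ord coef0 inord_val => ->.
have e1 k : pvec_eval (w k) = pe q ^+ U * pe q' * (y ^+ k.1 * x k.2).
  have it u : pvec_eval (iter u (fun v => v *m YM) (\row_s X k.2 s)) =
      pe q ^+ u * pe q' * (y ^+ u * x k.2).
    elim: u => [|u IH] /=.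
      rewrite !expr0 !mul1r hX; apply: eq_bigr => s _; by rewrite mxE.
    rewrite evY IH !exprS -!mulrA; congr (_ * _).
    by rewrite mulrCA; congr (_ * _); rewrite mulrCA.
  rewrite pvec_evalZ it rmorphXn horner_exp !mulrA -exprD subnK //.
  by rewrite -ltnS ltn_ord.
have : pvec_eval (\sum_k (c k)%:P *: w k) = 0.
  by rewrite hc /pvec_eval big1 // => s _; rewrite mxE rmorph0 horner0 mul0r.
rewrite pvec_eval_sum.
under eq_bigr do rewrite e1 mulrCA map_polyC hornerC.
rewrite -mulr_sumr => /eqP.
rewrite mulf_eq0 mulf_eq0 (negPf q'0) orbF expf_eq0 (negPf q0) andbF /= => /eqP.
move=> h0; have : \sum_i \sum_u g (c (u, i)) * (y ^+ u * x i) = 0.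
  by rewrite exchange_big pair_bigA -[RHS]h0; apply: eq_bigr => -[u i].
move=> h; rewrite -[RHS]h; apply: eq_bigr => i _.
rewrite (@horner_coef_wide _ U.+1); last first.
  by apply: leq_trans (size_poly _ _) _; apply: size_poly.
rewrite mulr_suml; apply: eq_bigr => u _.
by rewrite coef_map coef_poly ltn_ord inord_val mulrA.
Qed.

End Counting.

Section FiniteQuotients.
Variables (T : comPzRingType) (L : fieldType) (lam : {rmorphism L -> T}).

Definition finite_quotients : Prop := forall y : T, y != 0 ->
  exists D, forall d (e : 'I_d -> T^o),
    rel_free lam (fun z : T^o => exists w : T, z = y * w :> T) e -> (d <= D)%N.

Variables (F : fieldType) (psi : {rmorphism T -> F}) (g : {rmorphism L -> F}).
Hypothesis psi_inj : injective psi.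
Hypothesis psi_lam : forall l, psi (lam l) = g l.

Lemma poly_eval_lift (p : {poly L}) (y : T) :
  exists z, psi z = (map_poly g p).[psi y].
Proof.
exists (\sum_(i < size p) lam p`_i * y ^+ i).
rewrite (horner_coef_wide _ (size_poly _ _)) rmorph_sum.
by apply: eq_bigr => i _; rewrite coef_map rmorphM rmorphXn psi_lam.
Qed.

(** Modulo [y] only the constant terms of the [p i] survive. If all of them vanish, the relation is
    divisible by [y] and can be replaced by one with shorter polynomials. *)
Lemma dependent_mod (y : T) d (x : 'I_d -> T) (p : 'I_d -> {poly L}) : y != 0 ->
  (exists i, p i != 0) -> \sum_i (map_poly g (p i)).[psi y] * psi (x i) = 0 ->
  exists2 c : 'I_d -> L, exists i, c i != 0 &
    exists w, \sum_i lam (c i) * x i = y * w.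
Proof.
move=> y0; have py0 : psi y != 0 by rewrite -(rmorph0 psi) (inj_eq psi_inj).
have [N] := ubnP (\sum_i size (p i)); elim: N p => // N IH p hN [i0 hi0] hp.
have pE i : p i = ((p i)`_0)%:P + 'X * drop_poly 1 (p i).
  rewrite -{1}(poly_take_drop 1 (p i)) expr1 [_ * 'X]mulrC; congr (_ + _).
  by apply/polyP => m; rewrite coef_take_poly coefC; case: m.
have [[i1 hi1]|h0] := pselect (exists i, (p i)`_0 != 0).
  exists (fun i => (p i)`_0); first by exists i1.
  have /choice [z hz] := fun i => poly_eval_lift (drop_poly 1 (p i)) y.
  exists (- \sum_i z i * x i); apply: psi_inj.
  rewrite mulrN rmorphN rmorphM !rmorph_sum; apply/eqP; rewrite -addr_eq0; apply/eqP.
  rewrite -[RHS]hp mulr_sumr -big_split; apply: eq_bigr => i _ /=.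
  rewrite [in RHS](pE i) rmorphD /= [map_poly g (_ * _)]rmorphM /= map_polyC map_polyX /=.
  by rewrite !hornerE !rmorphM psi_lam hz mulrDl mulrA.
have pX i : p i = 'X * drop_poly 1 (p i).
  rewrite {1}(pE i) (_ : (p i)`_0 = 0) ?add0r //.
  by apply/eqP; apply: contra_notT h0 => ?; exists i.
have sp i : (size (drop_poly 1 (p i)) <= size (p i))%N.
  by rewrite size_drop_poly leq_subr.
have di0 : drop_poly 1 (p i0) != 0.
  by apply: contraNneq hi0 => h; rewrite pX h mulr0.
apply: (IH (fun i => drop_poly 1 (p i))); last 1 first.
- apply: (mulfI py0); rewrite mulr0 -[RHS]hp mulr_sumr; apply: eq_bigr => i _.
  by rewrite [in RHS]pX rmorphM /= map_polyX hornerM hornerX mulrA.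
- rewrite -ltnS; apply: leq_trans hN; rewrite ltnS (bigD1 i0) //= [in leqRHS](bigD1 i0) //=.
  rewrite -addSn leq_add ?leq_sum // {2}pX mulrC size_mulX //.
- by exists i0.
Qed.

Lemma finite_quotients_of_counting :
  (forall y : T, y != 0 -> exists D, forall d (x : 'I_d -> T), (D < d)%N ->
    exists p : 'I_d -> {poly L}, (exists i, p i != 0) /\
      \sum_i (map_poly g (p i)).[psi y] * psi (x i) = 0) ->
  finite_quotients.
Proof.
move=> h y y0; have [D hD] := h y y0; exists D => d e he; rewrite leqNgt; apply/negP.
move=> /(hD _ e) [p [hp1 hp2]]; have [c [i ci] hc] := dependent_mod y0 hp1 hp2.
by have := he c hc i; apply/eqP.
Qed.

End FiniteQuotients.

Section Chains.
Variables (T : comPzRingType) (L : fieldType) (lam : {rmorphism L -> T}).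
Variables (V : lmodType T) (S : V -> Prop) (D : nat).
Hypothesis hS : submodule S.
Hypothesis hD : forall d (e : 'I_d -> V), rel_free lam S e -> (d <= D)%N.

(* Dividing a linear relation between the p_i by its first nonzero coefficient. *)
Lemma chain_dependent (p x : nat -> T) (m : V) :
  (forall i, p i.+1 = p i * x i) ->
  exists i v, (i <= D)%N /\ S ((p i * (1 + x i * v)) *: m).
Proof.
move=> hp; have : ~ rel_free lam S (fun i : 'I_D.+1 => p i *: m).
  by move/hD; rewrite ltnn.
move=> /existsNP [c /not_implyP [hc /existsNP [i1 /eqP hi1]]].
case: (@arg_minnP _ i1 (fun i => c i != 0) (fun i => i : nat) hi1) => i0 c0 min0.
have pj k : exists v, p (i0 + k.+1)%N = p i0 * x i0 * v.
  elim: k => [|k [v hv]]; first by exists 1; rewrite addn1 hp mulr1.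
  by exists (v * x (i0 + k.+1)%N); rewrite addnS hp hv !mulrA.
have /choice [v hv] : forall i : 'I_D.+1, exists v, i != i0 ->
    lam (c i) * p i = p i0 * x i0 * v.
  move=> i; have [ii0|i0i] := ltnP i i0.
    exists 0 => _; have [->|/min0] := eqVneq (c i) 0; first by rewrite rmorph0 mul0r mulr0.
    by rewrite leqNgt ii0.
  have [->|ne] := eqVneq i i0; first by exists 0.
  have lt : (i0 < i)%N by rewrite ltn_neqAle i0i andbT eq_sym.
  have [v hv] := pj (i - i0.+1)%N; exists (lam (c i) * v) => _.
  by rewrite -(subnKC lt) addSnnS hv mulrCA.
exists i0, (lam (c i0)^-1 * \sum_(i | i != i0) v i); split; first by rewrite -ltnS ltn_ord.
case: hS => _ _ /(_ (lam (c i0)^-1) _ hc); congr S.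
under eq_bigr do rewrite scalerA.
rewrite -scaler_suml scalerA; congr (_ *: m).
rewrite (bigD1 i0) //= (eq_bigr _ hv) -mulr_sumr.
have e : lam (c i0)^-1 * lam (c i0) = 1 by rewrite -rmorphM mulVf // rmorph1.
by rewrite mulrDr [X in X + _]mulrA e; ring.
Qed.

End Chains.

(** * Regular primes *)

Section RegularPrimes.
Variables (T : comPzRingType) (L : fieldType) (lam : {rmorphism L -> T}).
Hypothesis T_dom : is_domain T.
Hypothesis T_fq : finite_quotients lam.

Lemma dom_cancel (y u v : T) : y != 0 -> u * y = v * y -> u = v.
Proof.
case: T_dom => _ hd y0 h; apply/eqP; rewrite -subr_eq0; apply/eqP.
have /hd [//|/eqP] : (u - v) * y = 0 by rewrite mulrBl h subrr.
by rewrite (negPf y0).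
Qed.

Lemma dom_neq0 (x y : T) : x != 0 -> y != 0 -> x * y != 0.
Proof.
by case: T_dom => _ hd /eqP x0 /eqP y0; apply/eqP => /hd [].
Qed.

Lemma dom_exp_neq0 (x : T) n : x != 0 -> x ^+ n != 0.
Proof.
move=> x0; elim: n => [|n IH]; first by rewrite expr0; case: T_dom => /eqP.
by rewrite exprS dom_neq0.
Qed.

Lemma multiples_submodule (y : T) :
  submodule (fun z : T^o => exists w : T, z = y * w :> T).
Proof.
split=> [|_ _ [u ->] [v ->]|a _ [u ->]]; first by exists 0; rewrite mulr0.
  by exists (u + v); rewrite mulrDr.
by exists (a * u); rewrite mulrCA.
Qed.

Lemma ideal_sum (I : T -> Prop) (J : Type) (r : seq J) (P : pred J) (f : J -> T) :
  ideal I -> (forall i, P i -> I (f i)) -> I (\sum_(i <- r | P i) f i).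
Proof. by case=> h0 hD _ hf; apply: big_ind. Qed.

Lemma idealB (I : T -> Prop) x y : ideal I -> I x -> I y -> I (x - y).
Proof.
by case=> _ hD hM hx hy; apply: hD => //; rewrite -mulN1r; apply: hM.
Qed.

(** A descending chain of principal ideals becomes stationary at some step modulo [y]: the
    conclusion says that [p i] lies in [p i.+1 T + y T]. *)
Lemma chain_relation (y : T) (p x : nat -> T) : y != 0 ->
  (forall i, p i.+1 = p i * x i) -> exists i v w, p i * (1 + x i * v) = y * w.
Proof.
move=> y0 hp; have [D hD] := T_fq y0.
have [i [v [_ [w hw]]]] := chain_dependent (multiples_submodule y) hD (1 : T^o) hp.
by exists i, v, w; rewrite -[LHS]mulr1; exact: hw.
Qed.

(** Ideals containing [y] correspond to subspaces of the finite-dimensional [T / yT]; a member with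
    the longest independent family modulo [y] is maximal. *)
Lemma ideal_family_max (Fam : (T -> Prop) -> Prop) (y : T) : y != 0 ->
  (exists I, Fam I) -> (forall I, Fam I -> ideal I /\ I y) ->
  exists I, Fam I /\
    forall I', Fam I' -> (forall x, I x -> I' x) -> forall x, I' x -> I x.
Proof.
move=> y0 [I0 hI0] hF; have [D hD] := T_fq y0.
pose P d := exists I (e : 'I_d -> T^o), [/\ Fam I, forall i, I (e i) &
   rel_free lam (fun z : T^o => exists w : T, z = y * w :> T) e].
have exP : exists d, `[< P d >].
  exists 0%N; apply/asboolP; exists I0, (fun=> 0); split=> //; first by case.
  by move=> c _ [].
have ubP d : `[< P d >] -> (d <= D)%N by move=> /asboolP [I [e [_ _ /hD]]].
case: (ex_maxnP exP ubP) => d /asboolP [I [e [hI he1 he2]]] hmax.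
exists I; split=> // I' hI' sub x hx; apply: contrapT => hn.
suff : (d.+1 <= d)%N by rewrite ltnn.
apply: hmax; apply/asboolP; exists I', (fcons (x : T^o) e); split=> //.
  by move=> i; case: (unliftP ord0 i) => [i'|] ->; rewrite ?fcons0 ?fconsS //; apply: sub.
apply: rel_free_cons => //; first exact: multiples_submodule.
case=> c [w hw]; apply: hn; have [idI Iy] := hF _ hI; case: (idI) => _ hD' hM.
rewrite -[x](subrK (\sum_i lam (c i) *: e i)) hw.
apply: hD'; first by rewrite mulrC; apply: hM.
by apply: ideal_sum => // i _; apply: hM.
Qed.

(** An ideal maximal among the proper ones above [D] is prime: for [u] outside it, the ideal
    enlarged by [u] contains [1]. *)
Lemma prime_ideal_above (D : T -> Prop) (y : T) : y != 0 -> ideal D -> D y -> ~ D 1 ->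
  exists m : T -> Prop, prime_ideal m /\ forall x, D x -> m x.
Proof.
move=> y0 hD Dy D1.
have [||I [[idI subI I1] hmax]] := @ideal_family_max
    (fun I => [/\ ideal I, forall x, D x -> I x & ~ I 1]) y y0.
- by exists D; split.
- by move=> I [idI subI _]; split=> //; apply: subI.
exists I; split=> //; split=> // u v huv; case: (idI) => h0 hDI hM.
have [|hu] := pselect (I u); [by left | right].
have [h1|h1] := pselect (exists2 a, I a & exists c, 1 = a + c * u).
  have [a ha [c hc]] := h1; rewrite -[v]mul1r hc mulrDl -mulrA; apply: hDI; last exact: hM.
  by rewrite mulrC; apply: hM.
case: hu; apply: (hmax (fun z => exists2 a, I a & exists c, z = a + c * u)).
- split.
  + split=> [|_ _ [a ha [c ->]] [a' ha' [c' ->]]|r _ [a ha [c ->]]].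
    * by exists 0 => //; exists 0; rewrite mul0r addr0.
    * exists (a + a'); first exact: hDI.
      by exists (c + c'); rewrite mulrDl addrACA.
    * exists (r * a); first exact: hM.
      by exists (r * c); rewrite mulrDr mulrA.
  + by move=> x /subI hx; exists x => //; exists 0; rewrite mul0r addr0.
  + by [].
- by move=> x hx; exists x => //; exists 0; rewrite mul0r addr0.
- by exists 0 => //; exists 1; rewrite mul1r add0r.
Qed.

Section AtPrime.
Variables (m : T -> Prop) (pi : T).
Hypothesis m_prime : prime_ideal m.
Hypothesis m_pi : m pi.
Hypothesis pi_neq0 : pi != 0.

Lemma prime_notM (x y : T) : ~ m x -> ~ m y -> ~ m (x * y).
Proof. by case: m_prime => _ _ h hx hy /h []. Qed.

Lemma prime_notX (x : T) n : ~ m x -> ~ m (x ^+ n).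
Proof.
move=> hx; elim: n => [|n IH]; first by rewrite expr0; case: m_prime.
by rewrite exprS; apply: prime_notM.
Qed.

Lemma not_prime_neq0 (x : T) : ~ m x -> x != 0.
Proof. by case: m_prime => -[h0 _ _] _ _ hx; apply: contra_notN hx => /eqP ->. Qed.

Lemma prime_mulr (a x : T) : m x -> m (a * x).
Proof. by case: m_prime => -[_ _ h] _ _; apply: h. Qed.

Lemma prime_addr_pi (s v : T) : m (s * (1 + pi * v)) -> m s.
Proof.
move=> h; rewrite -[s](addrK (s * (pi * v))) -{1}[s]mulr1 -mulrDr.
case: m_prime => hm _ _; apply: idealB => //.
by rewrite mulrCA [pi * _]mulrC; apply: prime_mulr.
Qed.

Hypothesis pi_gen : forall x, m x -> exists s y, ~ m s /\ s * x = y * pi.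

(** This replaces the Krull intersection theorem. If every power of [pi] divided [y] locally, a
    relation [pi^i (1 + pi v) = y w] would make [pi^i (1 + pi v)] locally divisible by [pi^(i+1)],
    although [1 + pi v] is outside [m]. *)
Lemma prime_order (y : T) : y != 0 ->
  exists n s u, [/\ ~ m s, ~ m u & s * y = u * pi ^+ n].
Proof.
move=> y0; apply: contrapT => hn.
have inf n : exists s w, ~ m s /\ s * y = w * pi ^+ n.
  elim: n => [|n [s [w [hs hw]]]].
    by exists 1, y; rewrite expr0 mul1r mulr1; case: m_prime.
  have [mw|nmw] := pselect (m w); last by case: hn; exists n, s, w.
  have [s' [w' [hs' hw']]] := pi_gen mw.
  exists (s' * s), w'; split; first exact: prime_notM.
  by rewrite -mulrA hw mulrA hw' exprS mulrA.
have [i [v [w hw]]] := @chain_relation y (fun i => pi ^+ i) (fun=> pi) y0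
  (fun i => exprSr pi i).
have [s [w' [hs hw']]] := inf i.+1.
apply: (hs); apply: (@prime_addr_pi s v).
suff -> : s * (1 + pi * v) = w' * w * pi by apply: prime_mulr.
apply: (@dom_cancel (pi ^+ i)); first exact: dom_exp_neq0.
rewrite -mulrA [_ * pi ^+ i]mulrC hw mulrA hw' exprS; ring.
Qed.

End AtPrime.

(* After inverting an element outside m, any element of I of minimal order
   generates I. *)
Lemma locally_principal (m : T -> Prop) (pi s0 : T) (I : T -> Prop) :
  prime_ideal m -> m pi -> pi != 0 -> ~ m s0 ->
  (forall x, m x -> exists y, s0 * x = y * pi) ->
  ideal I -> (exists2 y, y != 0 & I y) ->
  exists s z, [/\ ~ m s, I z & forall x, I x -> exists w, s * x = w * z].
Proof.
move=> hm mpi pi0 hs0 hgen hI [y y0 Iy].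
have gen x : m x -> exists s y, ~ m s /\ s * x = y * pi.
  by move=> /hgen [y' hy']; exists s0, y'.
pose P n := exists z s u, [/\ I z, ~ m s, ~ m u & s * z = u * pi ^+ n].
have exP : exists n, `[< P n >].
  have [n [s [u [h1 h2 h3]]]] := prime_order hm mpi pi0 gen y0.
  by exists n; apply/asboolP; exists y, s, u.
case: (ex_minnP exP) => n /asboolP [z [s [u [Iz hs hu hz]]]] hmin.
have key x : I x -> exists w, s0 ^+ n * x = w * pi ^+ n.
  move=> Ix; have [->|x0] := eqVneq x 0; first by exists 0; rewrite mulr0 mul0r.
  have [n' [s' [u' [h1 h2 h3]]]] := prime_order hm mpi pi0 gen x0.
  have nn' : (n <= n')%N by apply: hmin; apply/asboolP; exists x, s', u'.
  (* One factor [pi] is split off at a time: while [i < n'], the product [s' * w] is a multiple of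
     [pi], so [w] lies in [m] and [hgen] applies. The multiplier [s0] is the same for all [x], hence
     so is the final [s]. *)
  have : forall i, (i <= n')%N -> exists w, s0 ^+ i * x = w * pi ^+ i; last exact.
  elim=> [|i IH] hi; first by exists x; rewrite !expr0 mul1r mulr1.
  have [w hw] := IH (ltnW hi).
  have mw : m w.
    have : m (s' * w).
      suff -> : s' * w = s0 ^+ i * u' * pi ^+ (n' - i.+1) * pi.
        by apply: prime_mulr.
      apply: (@dom_cancel (pi ^+ i)); first exact: dom_exp_neq0.
      rewrite -mulrA -hw mulrCA h3 -!mulrA; congr (_ * (_ * _)).
      by rewrite -exprS -exprD addnC subnKC.
    by case: hm => _ _ /[apply] -[].
  have [w' hw'] := hgen _ mw; exists w'.
  by rewrite exprS -mulrA hw mulrA hw' exprS mulrA.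
exists (u * s0 ^+ n), z; split=> //; first by apply: prime_notM => //; apply: prime_notX.
move=> x /key [w hw]; exists (w * s).
rewrite -mulrA hw mulrCA -mulrA hz; ring.
Qed.

(* b divides c as soon as all (c / b)^i have the common denominator b. *)
Definition root_closed (b : T) : Prop := forall c : T,
  (forall i, exists t, c ^+ i * b = b ^+ i * t) -> exists t, c = b * t.

(** If [b] does not divide [c], the colon ideal of [b] by [c] lies in a prime [m], where [c] must
    have smaller order than [b]; then some power of [c / b] has a pole larger than [b] can
    cancel. *)
Lemma regular_root_closed (b : T) : b != 0 -> regular_dim1 T -> root_closed b.
Proof.
move=> b0 [_ hreg] c hc; apply: contrapT => hn.
have c0 : c != 0 by apply: contra_notN hn => /eqP ->; exists 0; rewrite mulr0.
pose D x := exists t, x * c = b * t.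
have hD : ideal D.
  split=> [|x y [t ht] [t' ht']|a x [t ht]]; first by exists 0; rewrite mulr0 mul0r.
    by exists (t + t'); rewrite mulrDl ht ht' mulrDr.
  by exists (a * t); rewrite -mulrA ht mulrCA.
have [||m [hm Dm]] := @prime_ideal_above D b b0 hD.
- by exists c.
- by case=> t; rewrite mul1r => h; apply: hn; exists t.
have [pi mpi gen] := hreg m hm.
have pi0 : pi != 0.
  have /gen [s [y [hs hy]]] : m b by apply: Dm; exists c.
  have := dom_neq0 (not_prime_neq0 hm hs) b0; rewrite hy.
  by apply: contraNneq => ->; rewrite mulr0.
have [be [sb [ub [hsb hub eb]]]] := prime_order hm mpi pi0 gen b0.
have [ga [sc [uc [hsc huc ec]]]] := prime_order hm mpi pi0 gen c0.
have [le|lt] := leqP be ga.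
  apply: (prime_notM hm hub hsc); apply: Dm.
  exists (uc * pi ^+ (ga - be) * sb).
  have epi : pi ^+ ga = pi ^+ (ga - be) * pi ^+ be by rewrite -exprD subnK.
  rewrite -mulrA ec epi.
  transitivity (uc * pi ^+ (ga - be) * (ub * pi ^+ be)); first ring.
  rewrite -eb; ring.
(* Since [ga < be], the exponent [be + 1] is large enough: [c^(be+1) b] has order
   [(be + 1) ga + be], which is less than [(be + 1) be]. *)
have [t ht] := hc be.+1.
have nm : ~ m (uc ^+ be.+1 * ub * sb ^+ be.+1).
  apply: (prime_notM hm); last exact: prime_notX.
  by apply: (prime_notM hm) => //; apply: prime_notX.
apply: nm.
suff -> : uc ^+ be.+1 * ub * sb ^+ be.+1 =
    sc ^+ be.+1 * sb * ub ^+ be.+1 * t * pi ^+ (be.+1 * be - (ga * be.+1 + be).+1) * pi.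
  exact: prime_mulr.
have le : ((ga * be.+1 + be).+1 <= be.+1 * be)%N.
  apply: (@leq_trans (ga.+1 * be.+1)); last by rewrite mulnC leq_mul.
  by rewrite mulSn addnC addSn.
apply: (@dom_cancel (pi ^+ (ga * be.+1 + be))); first exact: dom_exp_neq0.
rewrite -!mulrA -exprS -exprD subnK //.
have e1 : sc ^+ be.+1 * c ^+ be.+1 = uc ^+ be.+1 * pi ^+ (ga * be.+1).
  by rewrite -exprMn ec exprMn exprM.
have e2 : sb ^+ be.+1 * b ^+ be.+1 = ub ^+ be.+1 * pi ^+ (be.+1 * be).
  by rewrite -exprMn eb exprMn -exprM mulnC.
have := congr1 (fun z => sc ^+ be.+1 * sb * sb ^+ be.+1 * z) ht.
have -> : sc ^+ be.+1 * sb * sb ^+ be.+1 * (c ^+ be.+1 * b) =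
   (sc ^+ be.+1 * c ^+ be.+1) * (sb * b) * sb ^+ be.+1 by ring.
have -> : sc ^+ be.+1 * sb * sb ^+ be.+1 * (b ^+ be.+1 * t) =
   sc ^+ be.+1 * sb * (sb ^+ be.+1 * b ^+ be.+1) * t by ring.
rewrite e1 e2 eb exprD => h.
transitivity (uc ^+ be.+1 * pi ^+ (ga * be.+1) * (ub * pi ^+ be) * sb ^+ be.+1).
  ring.
rewrite h; ring.
Qed.

(* A maximal colon ideal (b : c) inside m equals m; then c / b maps m into T but,
   as it is not in T, not into m. *)
Lemma root_closed_regular (m : T -> Prop) (b : T) :
  prime_ideal m -> m b -> b != 0 -> root_closed b ->
  exists pi s0, [/\ m pi, pi != 0, ~ m s0 &
    forall x, m x -> exists y, s0 * x = y * pi].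
Proof.
move=> hm mb b0 hroot.
pose colon c x := exists t, x * c = b * t.
have col_id c : ideal (colon c).
  split=> [|x y [t ht] [t' ht']|a x [t ht]]; first by exists 0; rewrite mulr0 mul0r.
    by exists (t + t'); rewrite mulrDl ht ht' mulrDr.
  by exists (a * t); rewrite -mulrA ht mulrCA.
pose Fam I := exists2 c, I = colon c & forall x, I x -> m x.
have [||q [[c -> qm] hmax]] := @ideal_family_max Fam b b0.
- exists (colon 1); exists 1 => // x [t]; rewrite mulr1 => ->.
  by rewrite mulrC; apply: prime_mulr.
- by move=> _ [c -> _]; split=> //; exists c.
have mq x : m x -> colon c x.
  move=> mx.
  (* The least [n] for which [x^n] lies in [colon c] up to a factor outside [m] is positive. By
     minimality [colon (c * s * x ^+ n.-1)] still lies in [m]; it contains [colon c] and [x], so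
     maximality puts [x] into [colon c]. *)
  pose P n := exists2 s, ~ m s & colon c (s * x ^+ n).
  have exP : exists n, `[< P n >].
    have [i [v [w hw]]] := @chain_relation b (fun i => x ^+ i) (fun=> x) b0
      (fun i => exprSr x i).
    exists i; apply/asboolP; exists (1 + x * v).
      by move=> h; case: (hm) => _ h1 _; apply: h1; apply: (@prime_addr_pi m x _ _ 1 v);
        rewrite ?mul1r.
    by exists (w * c); rewrite [(1 + _) * _]mulrC hw mulrA.
  case: (ex_minnP exP) => -[|n] /asboolP [s hs hq] hmin.
    by case: hs; apply: qm; move: hq; rewrite expr0 mulr1.
  apply: (hmax (colon (c * s * x ^+ n))).
  - exists (c * s * x ^+ n) => // y [t ht]; apply: contrapT => hy.
    suff : (n < n)%N by rewrite ltnn.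
    apply: hmin; apply/asboolP; exists (y * s); first exact: prime_notM.
    exists t; rewrite -ht; ring.
  - move=> y [t ht]; exists (t * s * x ^+ n).
    by rewrite !mulrA ht.
  - case: hq => t ht; exists t; rewrite -ht exprS; ring.
have q1 : ~ colon c 1 by move=> /qm; case: hm.
(* If [c / b] mapped [m] into itself, all [(c / b)^i b] would stay in [m], and [root_closed] would
   make [b] divide [c]. An element [pi] of [m] sent to some [s0] outside [m] generates [m] locally,
   with uniform multiplier [s0]. *)
have : ~ (forall x, m x -> forall t, x * c = b * t -> m t).
  move=> h; apply: q1; rewrite /colon mul1r; apply: hroot => i.
  suff [t _ ht] : exists2 t, m t & c ^+ i * b = b ^+ i * t by exists t.
  elim: i => [|i [t mt ht]]; first by exists b; rewrite ?expr0 ?mul1r.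
  have [t' ht'] := mq _ mt; exists t'; first exact: h ht'.
  by rewrite exprS -mulrA ht mulrCA [c * t]mulrC ht' mulrA -exprSr.
move=> /existsNP [pi /not_implyP [mpi /existsNP [s0 /not_implyP [hpi hs0]]]].
exists pi, s0; split=> //.
  apply/eqP => pi0; move: hpi; rewrite pi0 mul0r => h.
  by move: (dom_neq0 b0 (not_prime_neq0 hm hs0)); rewrite -h eqxx.
move=> x /mq [t ht]; exists t; apply: (dom_cancel b0).
transitivity (x * (b * s0)); first ring.
rewrite -hpi mulrCA ht; ring.
Qed.

End RegularPrimes.

(** * Scalar extension of the curve *)

Section LinearDisjointness.
Variables (k : finFieldType) (L : fieldType) (j : {rmorphism k -> L}).

Lemma frob_fixed (x : L) : frob j x = x -> exists c, x = j c.
Proof.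
move=> hx; have : root (map_poly j ('X^#|k| - 'X)) x.
  by rewrite rmorphB /= map_polyXn map_polyX /root !hornerE /= -/(frob j x) hx subrr.
rewrite finField_genPoly rmorph_prod /root horner_prod prodf_seq_eq0 => /hasP /=.
case=> c _; rewrite rmorphB /= map_polyX map_polyC !hornerE /= subr_eq0 => /eqP ->.
by exists c.
Qed.

Definition lin_indep (n : nat) (l : 'I_n -> L) : Prop :=
  rel_free j (fun z : L^o => z = 0) (l : 'I_n -> L^o).

Lemma zero_submodule : submodule (fun z : L^o => z = 0).
Proof.
by split=> [|x y -> ->|a x ->] //; rewrite ?addr0 ?scaler0.
Qed.

Lemma lin_indep_cons n (l : 'I_n -> L) (x : L) : lin_indep l ->
  ~ (exists c : 'I_n -> k, x = \sum_i j (c i) * l i) -> lin_indep (fcons x l).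
Proof.
move=> hl hx; apply: rel_free_cons => //; first exact: zero_submodule.
by case=> c /eqP; rewrite subr_eq0 => /eqP h; apply: hx; exists c.
Qed.

Section TensorExpansion.
Variables (B : comPzRingType) (alpha : {rmorphism k -> B}).

Definition tensor_span (n : nat) (l : 'I_n -> L) (x : ctensor alpha j) : Prop :=
  exists b : 'I_n -> B, x = \sum_i ct_pure alpha j (b i) (l i).

Lemma ct_pure0l (x : L) : ct_pure alpha j 0 x = 0.
Proof. by apply: (addrI (ct_pure alpha j 0 x)); rewrite -ct_pureDl !addr0. Qed.

Lemma ct_pure_suml (x : L) (I : Type) (r : seq I) (P : pred I) (f : I -> B) :
  ct_pure alpha j (\sum_(i <- r | P i) f i) x = \sum_(i <- r | P i) ct_pure alpha j (f i) x.
Proof.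
apply: (big_morph (fun b => ct_pure alpha j b x)); last exact: ct_pure0l.
by move=> b b'; rewrite ct_pureDl.
Qed.

Lemma tensor_span0 n (l : 'I_n -> L) : tensor_span l 0.
Proof.
by exists (fun=> 0); rewrite big1 // => i _; rewrite ct_pure0l.
Qed.

Lemma tensor_spanD n (l : 'I_n -> L) x y :
  tensor_span l x -> tensor_span l y -> tensor_span l (x + y).
Proof.
move=> [b ->] [b' ->]; exists (fun i => b i + b' i).
by rewrite -big_split; apply: eq_bigr => i _; rewrite ct_pureDl.
Qed.

Lemma tensor_span_pure n (l : 'I_n -> L) b i : tensor_span l (ct_pure alpha j b (l i)).
Proof.
exists (fun i' => if i' == i then b else 0); rewrite (bigD1 i) //= eqxx big1 ?addr0 //.
by move=> i' /negPf ->; rewrite ct_pure0l.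
Qed.

Lemma tensor_span_sum n (l : 'I_n -> L) (I : Type) (r : seq I) (P : pred I) f :
  (forall i, P i -> tensor_span l (f i)) -> tensor_span l (\sum_(i <- r | P i) f i).
Proof.
by move=> hf; apply: big_ind => //; [apply: tensor_span0 | apply: tensor_spanD].
Qed.

Lemma ct_pure_sumr b (I : Type) (r : seq I) (P : pred I) (f : I -> L) :
  ct_pure alpha j b (\sum_(i <- r | P i) f i) = \sum_(i <- r | P i) ct_pure alpha j b (f i).
Proof.
apply: (big_morph (ct_pure alpha j b)); first by move=> x y; rewrite ct_pureDr.
by apply: (addrI (ct_pure alpha j b 0)); rewrite -ct_pureDr !addr0.
Qed.

(** Extending a given independent family, rather than choosing one per tensor, allows finitely many
    tensors to be expanded along the same elements of [L]. *)
Lemma tensor_span_extend (x : ctensor alpha j) n (l : 'I_n -> L) : lin_indep l ->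
  exists n' (l' : 'I_n' -> L), [/\ lin_indep l', tensor_span l' x &
    forall y, tensor_span l y -> tensor_span l' y].
Proof.
move: x n l; apply: ct_ind => [|x y hx hy|b x] n l hl.
- by exists n, l; split=> //; apply: tensor_span0.
- have [n1 [l1 [h1 h2 h3]]] := hx n l hl; have [n2 [l2 [h4 h5 h6]]] := hy n1 l1 h1.
  exists n2, l2; split=> //; first by apply: tensor_spanD => //; apply: h6.
  by move=> z /h3 /h6.
- have [[c hc]|hx] := pselect (exists c : 'I_n -> k, x = \sum_i j (c i) * l i).
    exists n, l; split=> //; rewrite hc ct_pure_sumr; apply: tensor_span_sum => i _.
    by rewrite -ct_pureS; apply: tensor_span_pure.
  exists n.+1, (fcons x l); split; first exact: lin_indep_cons.
    by rewrite -[x in ct_pure _ _ _ x](fcons0 x l); apply: tensor_span_pure.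
  move=> _ [b' ->]; apply: tensor_span_sum => i _.
  by rewrite -(fconsS x l); apply: tensor_span_pure.
Qed.

Lemma tensor_family_span (N : nat) (x : 'I_N -> ctensor alpha j) :
  exists n (l : 'I_n -> L), lin_indep l /\ forall i, tensor_span l (x i).
Proof.
elim: N x => [|N IH] x.
  by exists 0%N, (fun=> 0); split; [move=> c _ [] | case].
have [n [l [hl hx]]] := IH (fun i => x (lift ord0 i)).
have [n' [l' [h1 h2 h3]]] := tensor_span_extend (x ord0) hl.
exists n', l'; split=> // i; case: (unliftP ord0 i) => [i'|] -> //.
exact/h3/hx.
Qed.

Lemma tensor_expand (x : ctensor alpha j) :
  exists n (l : 'I_n -> L), lin_indep l /\ tensor_span l x.
Proof.
by have [n [l [hl /(_ ord0) hx]]] := tensor_family_span (fun _ : 'I_1 => x); exists n, l.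
Qed.

End TensorExpansion.

Variables (C : curve k) (F : function_fieldL j C).
Local Notation K := (curve_field C).
Local Notation fK := (ffL_K F).
Local Notation fL := (ffL_L F).

Definition ksubspace (U : K -> Prop) : Prop :=
  [/\ U 0, forall x y, U x -> U y -> U (x + y) &
      forall c x, U x -> U (curve_const C c * x)].

(* After dividing by the first l, apply sigma and subtract: this removes the
   first term and replaces the other l by l^q - l, which are again independent. *)
Lemma lin_disjoint0 n (l : 'I_n -> L) (z : 'I_n -> K) : lin_indep l ->
  \sum_i fK (z i) * fL (l i) = 0 -> forall i, z i = 0.
Proof.
elim: n l z => [|n IH] l z hl hz; first by case.
have l0 : l ord0 != 0.
  apply/eqP => l0; suff /eqP : 1 = 0 :> k by rewrite oner_eq0.
  apply: (hl (fun i => if i == ord0 then 1 else 0) _ ord0).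
  rewrite big1 // => i _; case: eqVneq => [->|_]; last by rewrite rmorph0 scale0r.
  by rewrite l0 scaler0.
pose l' i := l (lift ord0 i) / l ord0.
have hz' : fK (z ord0) + \sum_i fK (z (lift ord0 i)) * fL (l' i) = 0.
  apply: (mulIf (_ : fL (l ord0) != 0)); first by rewrite fmorph_eq0.
  rewrite mul0r -[RHS]hz mulrDl big_ord_recl; congr (_ + _).
  rewrite mulr_suml; apply: eq_bigr => i _.
  by rewrite -mulrA -rmorphM divfK.
have hs : \sum_i fK (z (lift ord0 i)) * fL (frob j (l' i) - l' i) = 0.
  have := congr1 (ffL_sigma F) hz'.
  rewrite rmorph0 rmorphD /= ffL_sigmaK rmorph_sum /=.
  under eq_bigr do rewrite rmorphM /= ffL_sigmaK ffL_sigmaL.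
  move=> h1; have := congr2 (fun x y => x - y) h1 hz'; rewrite subrr.
  move=> h2; rewrite -[RHS]h2 [in RHS]opprD addrACA subrr add0r -sumrB.
  by apply: eq_bigr => i _; rewrite rmorphB mulrBr.
have zS i : z (lift ord0 i) = 0.
  apply: (IH (fun i => frob j (l' i) - l' i) (fun i => z (lift ord0 i))) => // c hc.
  (* A relation between the [l'^q - l'] gives a combination of the [l'] fixed by Frobenius, hence an
     element of [k]; this contradicts the independence of [1] and the [l'] unless it is trivial. *)
  have /frob_fixed [c0 hc0] : frob j (\sum_i j (c i) * l' i) = \sum_i j (c i) * l' i.
    apply/eqP; rewrite -subr_eq0 rmorph_sum /= -sumrB -[X in _ == X]hc; apply/eqP.
    by apply: eq_bigr => i1 _; rewrite rmorphM /= frobK -mulrBr.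
  move=> i1; pose c' := fcons (- c0) c.
  rewrite -[LHS](fconsS (- c0) c); apply: hl.
  rewrite big_ord_recl fcons0; under eq_bigr do rewrite fconsS.
  rewrite /= rmorphN scaleNr -[j c0 *: _]/(j c0 * l ord0) -hc0 mulr_suml addrC.
  apply/eqP; rewrite subr_eq0; apply/eqP; apply: eq_bigr => i2 _.
  by rewrite -mulrA divfK.
move=> i; case: (unliftP ord0 i) => [i'|] -> //.
have /eqP := hz'; rewrite big1 ?addr0 ?fmorph_eq0; first by move/eqP.
by move=> i' _; rewrite zS rmorph0 mul0r.
Qed.

(** Membership in [U] passes to the coefficients along any independent family. Each [l'] is either
    rewritten in terms of [l], changing the [z i] by elements of [U], or adjoined to [l] with
    coefficient in [U]. *)
Lemma lin_disjoint (U : K -> Prop) m (y : 'I_m -> K) (l' : 'I_m -> L)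
    n (z : 'I_n -> K) (l : 'I_n -> L) :
  ksubspace U -> lin_indep l -> (forall i, U (y i)) ->
  \sum_i fK (z i) * fL (l i) = \sum_i fK (y i) * fL (l' i) -> forall i, U (z i).
Proof.
move=> [U0 UD UZ]; elim: m n y l' z l => [|m IH] n y l' z l hl hy.
  by rewrite big_ord0 => /(lin_disjoint0 hl) hz i; rewrite hz.
rewrite big_ord_recl => e.
have [[c hc]|hn] := pselect (exists c : 'I_n -> k, l' ord0 = \sum_i j (c i) * l i).
  move=> i; rewrite -[z i](subrK (curve_const C (c i) * y ord0)).
  apply: UD; last by apply: UZ.
  move: i; apply: (IH _ (fun i => y (lift ord0 i)) (fun i => l' (lift ord0 i))
    (fun i => z i - curve_const C (c i) * y ord0) l) => //.
  under eq_bigr do rewrite rmorphB mulrBl.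
  rewrite sumrB e hc rmorph_sum mulr_sumr addrAC -sumrB big1 ?add0r // => i _.
  by rewrite /= !rmorphM /= ffL_compat mulrA [fK _ * _]mulrC subrr.
have hz : forall i, U (fcons (- y ord0) z i).
  apply: (IH _ (fun i => y (lift ord0 i)) (fun i => l' (lift ord0 i))
    _ (fcons (l' ord0) l)) => //; first exact: lin_indep_cons.
  rewrite big_ord_recl !fcons0; under eq_bigr do rewrite !fconsS.
  by rewrite rmorphN mulNr e addKr.
by move=> i; rewrite -(fconsS (- y ord0) z).
Qed.

Lemma to_ffL_pure (S : ksubring (curve_const C)) x l :
  to_ffL F S (ct_pure _ j x l) = fK (val x) * fL l.
Proof. by rewrite /to_ffL ct_lift_pure. Qed.

Lemma to_ffL_inj (S : ksubring (curve_const C)) : injective (to_ffL F S).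
Proof.
apply: raddf_inj => x; have [n [l [hl [b ->]]]] := tensor_expand x.
rewrite raddf_sum /=; under eq_bigr do rewrite to_ffL_pure.
move=> /(lin_disjoint0 hl) hb; rewrite big1 // => i _.
by rewrite (_ : b i = 0) ?ct_pure0l //; apply: val_inj; rewrite hb.
Qed.

Lemma tensor_domain (S : ksubring (curve_const C)) : is_domain (ctensor (ks_cst S) j).
Proof.
split=> [h|x y h].
  by have /eqP := congr1 (to_ffL F S) h; rewrite rmorph1 rmorph0 oner_eq0.
have /eqP := congr1 (to_ffL F S) h; rewrite rmorphM rmorph0 mulf_eq0.
by case/orP => /eqP h'; [left | right]; apply: (@to_ffL_inj S); rewrite rmorph0.
Qed.

End LinearDisjointness.

Section CurveFiniteness.
Variables (k : finFieldType) (C : curve k).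
Local Notation K := (curve_field C).

(** The counting argument over [k] itself, where all of [K] is spanned by the [b i] over [k(t)]. As
    [k] is finite, the quotients are finite sets. *)
Lemma ksubring_finite_quotients (S : ksubring (curve_const C)) :
  finite_quotients (ks_cst S).
Proof.
have [t [ht [n [b hb]]]] := curve_dim1 C.
apply: (@finite_quotients_of_counting _ _ _ _ (@ringOf_incl _ S) (curve_const C)).
- exact: val_inj.
- by [].
have span (x : K) : True -> exists q : {poly k}, (map_poly (curve_const C) q).[t] != 0 /\
    exists p : 'I_n -> {poly k}, (map_poly (curve_const C) q).[t] * x =
      \sum_s (map_poly (curve_const C) (p s)).[t] * b s.
  move=> _; have [q [p [q0 h]]] := hb x.
  by exists q; split; [apply: ht | exists p].
move=> y y0; have [D hD] := poly_dependent (V := fun=> True) span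
  (fun _ _ _ _ => I) (fun=> I) (y := val y) I.
by exists D => d x; apply: hD.
Qed.

Variables (L : fieldType) (j : {rmorphism k -> L}) (F : function_fieldL j C).

Lemma tensor_finite_quotients (S : ksubring (curve_const C)) :
  finite_quotients (ct_inr (ks_cst S) j).
Proof.
have [t [ht [n [b hb]]]] := curve_dim1 C.
have mapj (p : {poly k}) : (map_poly (ffL_L F) (map_poly j p)).[ffL_K F t] =
    ffL_K F (map_poly (curve_const C) p).[t].
  rewrite -horner_map -!map_poly_comp; congr (_.[_]).
  by apply: eq_map_poly => c; rewrite /= ffL_compat.
apply: (@finite_quotients_of_counting _ _ _ _ (to_ffL F S) (ffL_L F)).
- exact: to_ffL_inj.
- by move=> l; rewrite [LHS]to_ffL_pure rmorph1 mul1r.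
(* The image of [K (x) L] instead of all of [F]: its elements are spanned by the [b i] with
   denominators coming from [k[t]], and it contains the image of [S (x) L]. *)
pose V (x : F) := exists u, x = ct_lift (ffL_compat F) u.
have span (z : F) : V z -> exists q : {poly L}, (map_poly (ffL_L F) q).[ffL_K F t] != 0 /\
    exists p : 'I_n -> {poly L}, (map_poly (ffL_L F) q).[ffL_K F t] * z =
      \sum_s (map_poly (ffL_L F) (p s)).[ffL_K F t] * ffL_K F (b s).
  move=> [u ->]; move: u; apply: ct_ind => [|x x' [q [q0 [p hp]]] [q' [q'0 [p' hp']]]|x l].
  + exists 1; rewrite rmorph1 hornerC oner_eq0; split=> //; exists (fun=> 0).
    by rewrite rmorph0 mulr0 big1 // => i _; rewrite rmorph0 horner0 mul0r.
  + exists (q * q'); rewrite rmorphM hornerM mulf_neq0 //; split=> //.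
    exists (fun i => q' * p i + q * p' i).
    rewrite rmorphD mulrDr [in X in X + _]mulrC [in X in X + _]mulrA.
    rewrite -[X in _ + X]mulrA hp' [_ * (map_poly _ q).[_]]mulrC hp [X in X + _]mulrC.
    rewrite !mulr_sumr -big_split; apply: eq_bigr => i _ /=.
    by rewrite rmorphD !rmorphM /= hornerD !hornerM mulrDl !mulrA.
  + have [q [p [q0 h]]] := hb x.
    exists (map_poly j q); rewrite mapj fmorph_eq0; split; first exact: ht.
    exists (fun i => l%:P * map_poly j (p i)).
    rewrite ct_lift_pure mulrA -rmorphM h rmorph_sum mulr_suml; apply: eq_bigr => i _.
    rewrite [map_poly (ffL_L F) (_ * _)]rmorphM /= map_polyC /= hornerM hornerC mapj.
    rewrite rmorphM /=; ring.
have VM x y : V x -> V y -> V (x * y).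
  by move=> [u ->] [v ->]; exists (u * v); rewrite rmorphM.
have Vb i : V (ffL_K F (b i)).
  by exists (ct_inl _ j (b i)); rewrite ct_lift_pure rmorph1 mulr1.
have Vpsi z : V (to_ffL F S z).
  move: z; apply: ct_ind => [|z z' [u hu] [u' hu']|z l].
  - by exists 0; rewrite !rmorph0.
  - by exists (u + u'); rewrite !rmorphD /= hu hu'.
  - by exists (ct_pure _ j (val z) l); rewrite to_ffL_pure ct_lift_pure.
move=> y y0; have [D hD] := poly_dependent span VM Vb (Vpsi y).
by exists D => d x; apply: hD => i; apply: Vpsi.
Qed.

Variable inf : rational_point C.
Local Notation A := (affine_ring inf).
Local Notation AL := (ctensor (ks_cst A) j).

Lemma regular_at_place (P : place C) : regular_dim1 (ctensor (ks_cst (local_ring P)) j).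
Proof. exact: curve_smooth (svalP P) _ _. Qed.

(** Because [b] comes from [A], division by it acts on the coefficients [x i] of [c] one by one.
    Regularity of [O_P (x) L] gives the quotient there, [lin_disjoint] puts each [x i / b] into
    [O_P], and running over all [P] away from [inf] puts it into [A]. *)
Lemma affine_root_closed (b : ringOf A) : b != 0 -> root_closed (ct_inl (ks_cst A) j b).
Proof.
move=> b0 c hc; have [n [l [hl [x hx]]]] := tensor_expand c.
have vb0 : val b != 0 by apply: contraNneq b0 => h; apply/eqP/val_inj.
suff xb i : exists y : ringOf A, x i = b * y.
  have /choice [y hy] := xb; exists (\sum_i ct_pure _ j (y i) (l i)).
  rewrite hx mulr_sumr; apply: eq_bigr => i _.
  by rewrite ct_pureM mul1r hy.
suff h : A (val (x i) / val b).
  by exists (in_ringOf h); apply: val_inj; rewrite /= mulrC divfK.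
move=> P hP; move: i.
set O := local_ring P.
have lift_O (t : AL) : exists t' : ctensor (ks_cst O) j, to_ffL F O t' = to_ffL F A t.
  move: t; apply: ct_ind => [|u v [u' hu] [v' hv]|u v].
  - by exists 0; rewrite !rmorph0.
  - by exists (u' + v'); rewrite !rmorphD /= hu hv.
  - have hu : O (val u) by apply: (ringOfP u).
    by exists (ct_pure _ j (in_ringOf hu) v); rewrite !to_ffL_pure.
have hb : O (val b) by apply: (ringOfP b).
pose b' := ct_inl (ks_cst O) j (in_ringOf hb).
have b'E : to_ffL F O b' = to_ffL F A (ct_inl (ks_cst A) j b) by rewrite !to_ffL_pure.
have b'0 : b' != 0.
  apply: contraNneq vb0 => h; have := congr1 (to_ffL F O) h.
  by rewrite rmorph0 to_ffL_pure rmorph1 mulr1 /= => /eqP; rewrite fmorph_eq0.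
have [c' c'E] := lift_O c.
have [|t ht] := @regular_root_closed _ _ _ (tensor_domain F O)
    (@tensor_finite_quotients O) b' b'0 (regular_at_place P) c'.
  move=> i; have [t ht] := hc i; have [t' t'E] := lift_O t; exists t'.
  apply: (@to_ffL_inj _ _ _ _ F O).
  have := congr1 (to_ffL F A) ht.
  by rewrite !rmorphM !rmorphXn /= -c'E -b'E -t'E.
have [n' [l' [_ [y hy]]]] := tensor_expand t.
apply: (@lin_disjoint _ _ _ _ F O n' (fun i => val (y i)) l' n _ l) => //.
- split=> [|u v hu hv|a u hu].
  + by rewrite -(subrr 1); apply: subringB; apply: subring1.
  + by rewrite -[v]opprK -[- v]add0r; apply: subringB => //; apply: subringB => //;
      rewrite -(subrr 1); apply: subringB; apply: subring1.
  + by apply: subringM => //; apply: ks_const.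
- by move=> i; apply: ringOfP.
apply: (mulfI (_ : ffL_K F (val b) != 0)); first by rewrite fmorph_eq0.
have := congr1 (to_ffL F O) ht; rewrite rmorphM /= c'E hx hy !rmorph_sum /=.
rewrite to_ffL_pure rmorph1 mulr1 /=.
under eq_bigr do rewrite to_ffL_pure.
under [in RHS]eq_bigr do rewrite to_ffL_pure.
move=> <-; rewrite mulr_sumr; apply: eq_bigr => i _.
by rewrite mulrA -rmorphM [val b * _]mulrC divfK.
Qed.

Lemma affine_regular (m : AL -> Prop) (b : ringOf A) :
  prime_ideal m -> b != 0 -> m (ct_inl (ks_cst A) j b) ->
  exists pi s0, [/\ m pi, pi != 0, ~ m s0 &
    forall x, m x -> exists y, s0 * x = y * pi].
Proof.
move=> hm b0 mb.
apply: (root_closed_regular (tensor_domain F A) (@tensor_finite_quotients A) hm mb).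
  apply: contraNneq b0 => h; have := congr1 (to_ffL F A) h.
  rewrite rmorph0 to_ffL_pure rmorph1 mulr1 => /eqP; rewrite fmorph_eq0 => /eqP h'.
  by apply/eqP/val_inj.
exact: affine_root_closed.
Qed.

End CurveFiniteness.

(** * Locally free modules *)

Section LocallyFreeSubmodule.
Variables (T : comPzRingType) (L : fieldType) (lam : {rmorphism L -> T}).
Hypothesis T_dom : is_domain T.
Hypothesis T_fq : finite_quotients lam.
Variable b : T.
Hypothesis b_neq0 : b != 0.

Section Lattice.
Variable m : T -> Prop.
Hypothesis m_prime : prime_ideal m.
Hypothesis m_principal : forall I : T -> Prop, ideal I -> I b ->
  exists s z, [/\ ~ m s, I z & forall x, I x -> exists w, s * x = w * z].

(* The first coordinates of the elements of X form a locally principal ideal, which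
   splits off a rank one summand. *)
Lemma lattice_basis (r : nat) (X : ('I_r -> T) -> Prop) :
  (forall a u c v, X u -> X v -> X (fun i => a * u i + c * v i)) ->
  (forall v, X (fun i => b * v i)) ->
  exists s (e : 'I_r -> 'I_r -> T), [/\ ~ m s, forall i, X (e i),
    forall v, X v -> exists a : 'I_r -> T, forall l, s * v l = \sum_i a i * e i l &
    forall a : 'I_r -> T, (forall l, \sum_i a i * e i l = 0) -> forall i, a i = 0].
Proof.
elim: r X => [|r IH] X Xlin Xb.
  exists 1, (fun _ _ => 0); split; [by case: m_prime | by case | | by move=> a _ []].
  by move=> v _; exists (fun=> 0); case.
pose I x := exists2 v, X v & v ord0 = x.
have Xscale a v : X v -> X (fun i => a * v i).
  move=> hv; have := Xlin a v 0 v hv hv.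
  by congr X; apply: funext => i; rewrite mul0r addr0.
have hI : ideal I.
  split.
  - exists (fun=> b * 0); [exact: Xb | exact: mulr0].
  - move=> _ _ [u hu <-] [v hv <-]; exists (fun i => 1 * u i + 1 * v i); first exact: Xlin.
    by rewrite !mul1r.
  - by move=> a _ [u hu <-]; exists (fun i => a * u i) => //; apply: Xscale.
have Ib : I b by exists (fun=> b * 1); [exact: Xb | exact: mulr1].
have [s [z [hs [vz hvz vz0] hz]]] := m_principal hI Ib.
have z0 : z != 0.
  have [w hw] := hz _ Ib.
  have := dom_neq0 T_dom (not_prime_neq0 m_prime hs) b_neq0; rewrite hw.
  by apply: contraNneq => ->; rewrite mulr0.
pose X' w := X (fcons 0 w).
have [||s' [e [hs' he1 he2 he3]]] := IH X'.
- move=> a u c v hu hv; have := Xlin a _ c _ hu hv; congr X; apply: funext => i.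
  by case: (unliftP ord0 i) => [i'|] ->; rewrite ?fcons0 ?fconsS // !mulr0 addr0.
- move=> v; have := Xb (fcons 0 v); congr X; apply: funext => i.
  by case: (unliftP ord0 i) => [i'|] ->; rewrite ?fcons0 ?fconsS // !mulr0.
exists (s * s'), (fcons vz (fun i => fcons 0 (e i))); split.
- exact: prime_notM.
- by move=> i; case: (unliftP ord0 i) => [i'|] ->; rewrite ?fcons0 ?fconsS //; apply: he1.
- move=> v hv; have [w hw] := hz (v ord0) (ex_intro2 _ _ v hv erefl).
  have [a ha] : exists a : 'I_r -> T, forall l,
      s' * (s * v (lift ord0 l) - w * vz (lift ord0 l)) = \sum_i a i * e i l.
    apply: (he2 (fun l => s * v (lift ord0 l) - w * vz (lift ord0 l))).
    have := Xlin s v (- w) vz hv hvz; congr X; apply: funext => i.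
    case: (unliftP ord0 i) => [i'|] ->; rewrite ?fcons0 ?fconsS ?mulNr //.
    by rewrite hw vz0 subrr.
  exists (fcons (s' * w) a) => l; rewrite big_ord_recl !fcons0.
  under eq_bigr do rewrite !fconsS.
  case: (unliftP ord0 l) => [l'|] ->.
    under eq_bigr do rewrite fconsS.
    by rewrite -ha; ring.
  rewrite big1 ?addr0; last by move=> i _; rewrite fcons0 mulr0.
  by rewrite vz0; transitivity (s' * (s * v ord0)); [ring | rewrite hw; ring].
- move=> a ha; have a0 : a ord0 = 0.
    have := ha ord0; rewrite big_ord_recl fcons0 vz0 big1 ?addr0; last first.
      by move=> i _; rewrite fconsS fcons0 mulr0.
    by move=> h; apply: (dom_cancel T_dom z0); rewrite h mul0r.
  move=> i; case: (unliftP ord0 i) => [i'|] -> //.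
  move: i'; apply: he3 => l; have := ha (lift ord0 l); rewrite big_ord_recl a0 mul0r add0r.
  by under eq_bigr do rewrite !fconsS.
Qed.

End Lattice.

Hypothesis b_regular : forall m : T -> Prop, prime_ideal m -> m b ->
  exists pi s0, [/\ m pi, pi != 0, ~ m s0 & forall x, m x -> exists y, s0 * x = y * pi].

Variables (M N : lmodType T) (f : {linear N -> M}) (r : nat).
Hypothesis f_inj : injective f.
Hypothesis f_onto : forall x, exists y, f y = b *: x.

(** After inverting [b], [f] becomes an isomorphism. *)
Lemma loc_free_at_mul (phi : T) : loc_free_at M r phi -> loc_free_at N r (phi * b).
Proof.
move=> [e [he1 he2]]; have /choice [e' he'] := fun i => f_onto (e i).
exists e'; split.
  move=> x; have [n [a ha]] := he1 (f x).
  exists n.+1, (fun i => phi * b ^+ n * a i); apply: f_inj; rewrite linearZ linear_sum /=.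
  have -> : (phi * b) ^+ n.+1 = phi * b ^+ n.+1 * phi ^+ n.
    by rewrite exprMn !exprS; ring.
  rewrite -scalerA ha scaler_sumr; apply: eq_bigr => i _.
  by rewrite [RHS]linearZ /= he' !scalerA; congr (_ *: _); rewrite exprS; ring.
move=> a ha i; have [n hn] : exists n, phi ^+ n * (a i * b) = 0.
  apply: (he2 (fun i => a i * b)); have := congr1 f ha.
  rewrite raddf0 linear_sum /= => h; rewrite -[RHS]h; apply: eq_bigr => i' _.
  by rewrite [RHS]linearZ /= he' scalerA.
exists n.+1; transitivity (phi * b ^+ n * (phi ^+ n * (a i * b))); last by rewrite hn mulr0.
by rewrite exprMn !exprS; ring.
Qed.

(** The vectors of coordinates of elements of [f(N)] in the local basis of [M] form a lattice
    containing [b T^r], to which [lattice_basis] applies. *)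
Lemma loc_free_at_prime (m : T -> Prop) (phi : T) : prime_ideal m -> m b -> ~ m phi ->
  loc_free_at M r phi -> exists2 psi, ~ m psi & loc_free_at N r psi.
Proof.
move=> hm mb hphi [e [he1 he2]].
have phi0 n : phi ^+ n != 0 by apply: (not_prime_neq0 hm); apply: prime_notX.
have [pi [s0 [mpi pi0 hs0 hgen]]] := b_regular hm mb.
pose X (v : 'I_r -> T) := exists y, f y = \sum_i v i *: e i.
have [|||s [v [hs hv1 hv2 hv3]]] := @lattice_basis m hm _ r X.
- move=> I hI Ib.
  apply: (locally_principal T_dom T_fq hm mpi pi0 hs0 hgen hI).
  by exists b.
- move=> a u c v [y hy] [y' hy']; exists (a *: y + c *: y').
  rewrite linearD !linearZ /= hy hy' !scaler_sumr -big_split; apply: eq_bigr => i _ /=.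
  by rewrite !scalerA scalerDl.
- move=> v; have [y hy] := f_onto (\sum_i v i *: e i); exists y; rewrite hy scaler_sumr.
  by apply: eq_bigr => i _; rewrite scalerA.
have /choice [y hy] := hv1.
exists (s * phi); first exact: prime_notM.
exists y; split.
  move=> x; have [n [a ha]] := he1 (f x).
  have [|a' ha'] := hv2 (fun i => phi * s ^+ n * a i).
    exists ((phi * s ^+ n * phi ^+ n) *: x).
    rewrite linearZ /= -scalerA ha scaler_sumr.
    by apply: eq_bigr => i _; rewrite scalerA.
  exists n.+1, a'; apply: f_inj; rewrite linearZ linear_sum /=.
  have -> : (s * phi) ^+ n.+1 = s * phi * s ^+ n * phi ^+ n.
    by rewrite exprMn !exprS; ring.
  rewrite -scalerA ha scaler_sumr.
  under [RHS]eq_bigr do rewrite linearZ /= hy scaler_sumr.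
  rewrite exchange_big; apply: eq_bigr => l _ /=.
  under eq_bigr do rewrite scalerA.
  rewrite -scaler_suml -ha' scalerA; congr (_ *: _); ring.
move=> a ha i; exists 0%N; rewrite expr0 mul1r.
move: i; apply: hv3 => l.
have [n hn] : exists n, phi ^+ n * (\sum_i a i * v i l) = 0.
  apply: (he2 (fun l => \sum_i a i * v i l)); have := congr1 f ha.
  rewrite raddf0 linear_sum /= => h; rewrite -[RHS]h.
  under [RHS]eq_bigr do rewrite linearZ /= hy scaler_sumr.
  rewrite exchange_big; apply: eq_bigr => l' _ /=.
  by rewrite scaler_suml; apply: eq_bigr => i _; rewrite scalerA.
by apply: (dom_cancel T_dom (phi0 n)); rewrite mul0r mulrC.
Qed.

(** The ideal generated by the [g] at which [N] becomes free contains [b]. If it were proper, it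
    would lie in a prime containing [b], and [loc_free_at_prime] would produce such a [g] outside
    that prime. *)
Lemma locally_free_sub : locally_free M r -> locally_free N r.
Proof.
move=> [n [phi [[c hc] hphi]]].
pose I x := exists n (a g : 'I_n -> T),
  (forall i, loc_free_at N r (g i)) /\ x = \sum_i a i * g i.
have hI : ideal I.
  split.
  - by exists 0%N, (fun=> 0), (fun=> 0); split; [case | rewrite big_ord0].
  - move=> _ _ [n1 [a1 [g1 [h1 ->]]]] [n2 [a2 [g2 [h2 ->]]]].
    exists (n1 + n2)%N, (fun i => match split i with inl i' => a1 i' | inr i' => a2 i' end),
      (fun i => match split i with inl i' => g1 i' | inr i' => g2 i' end); split.
      by move=> i; case: (split i).
    rewrite big_split_ord /=; congr (_ + _); apply: eq_bigr => i _.
      by rewrite (unsplitK (inl i)).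
    by rewrite (unsplitK (inr i)).
  - move=> a _ [n1 [a1 [g1 [h1 ->]]]]; exists n1, (fun i => a * a1 i), g1; split=> //.
    by rewrite mulr_sumr; apply: eq_bigr => i _; rewrite mulrA.
have Ig g : loc_free_at N r g -> I g.
  by exists 1%N, (fun=> 1), (fun=> g); split=> //; rewrite big_ord1 mul1r.
have Ib : I b.
  exists n, c, (fun i => phi i * b); split; first by move=> i; apply: loc_free_at_mul.
  by rewrite -[LHS]mul1r -hc mulr_suml; apply: eq_bigr => i _; rewrite mulrA.
have [[n1 [a1 [g1 [h1 h2]]]]|hn] := pselect (I 1).
  by exists n1, g1; split=> //; exists a1.
have [m [hm Im]] := prime_ideal_above T_fq b_neq0 hI Ib hn.
have [i hi] : exists i, ~ m (phi i).
  apply: contrapT => h; case: (hm) => -[m0 mD mM] m1 _; apply: m1; rewrite -hc.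
  apply: (ideal_sum (I := m)) => // i _; apply: mM; apply: contrapT => hi.
  by apply: h; exists i.
have [psi hpsi1 hpsi2] := loc_free_at_prime hm (Im _ Ib) hi (hphi i).
by case: hpsi1; apply/Im/Ig.
Qed.

End LocallyFreeSubmodule.

(** * Torsion and coordinates in locally free modules *)

Lemma radical_ideal (T : comPzRingType) (I : T -> Prop) :
  ideal I -> ideal (fun x => exists n, I (x ^+ n)).
Proof.
move=> hI; case: (hI) => h0 hD hM; split.
- by exists 1%N; rewrite expr1.
- move=> x y [n hx] [p hy]; exists (n + p)%N; rewrite exprDn.
  apply: ideal_sum => // i _; rewrite -mulr_natl; apply: (hM _).
  have [le|lt] := leqP p i.
    by rewrite -(subnK le) exprD mulrA; apply: (hM _).
  have le : (n <= n + p - i)%N by rewrite -addnBA ?leq_addr // ltnW.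
  by rewrite -(subnK le) exprD mulrC mulrA; apply: (hM _).
- by move=> a x [n hx]; exists n; rewrite exprMn; apply: (hM _).
Qed.

(** The [t] with some power sending [x] into [S] form a radical ideal; it contains every [phi i],
    hence [1]. *)
Lemma unit_ideal_local (T : comPzRingType) (M : lmodType T) (n : nat)
    (c phi : 'I_n -> T) (S : M -> Prop) (x : M) :
  \sum_i c i * phi i = 1 -> submodule S ->
  (forall i, exists e, S (phi i ^+ e *: x)) -> S x.
Proof.
move=> hc [h0 hD hZ] hx.
have hI : ideal (fun t => S (t *: x)).
  split=> [|t u ht hu|a t ht]; first by rewrite scale0r.
    by rewrite scalerDl; apply: hD.
  by rewrite -scalerA; apply: hZ.
have hr := radical_ideal hI.
have [e] : exists e, S (1 ^+ e *: x).
  rewrite -hc; apply: (@ideal_sum _ (fun t => exists e, S (t ^+ e *: x))) => // i _.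
  by case: hr => _ _ hM; apply: (hM _ _ (hx i)).
by rewrite expr1n scale1r.
Qed.

Lemma bc_pure_suml (R : pzRingType) (S : comPzRingType) (phi : {rmorphism R -> S})
    (M : lmodType R) (I : Type) (r : seq I) (P : pred I) (f : I -> M) (u : S) :
  bc_pure phi (\sum_(i <- r | P i) f i) u = \sum_(i <- r | P i) bc_pure phi (f i) u.
Proof.
apply: (big_morph (fun z => bc_pure phi z u)); first by move=> x y; rewrite bc_pureDl.
by apply: (addrI (bc_pure phi (0 : M) u)); rewrite -bc_pureDl !addr0.
Qed.

Section LocallyFreeModule.
Variables (T : comPzRingType) (M : lmodType T) (r : nat).
Hypothesis T_dom : is_domain T.
Hypothesis M_free : locally_free M r.

Lemma locally_free_torsion (t : T) (x : M) : t != 0 -> t *: x = 0 -> x = 0.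
Proof.
have [n [phi [[c hc] hphi]]] := M_free => t0 htx.
apply: (unit_ideal_local hc (S := fun z => z = 0)).
  by split=> [|y z -> ->|a y ->] //; rewrite ?addr0 ?scaler0.
move=> i; have [e [he1 he2]] := hphi i.
have [p0|p0] := eqVneq (phi i) 0; first by exists 1%N; rewrite expr1 p0 scale0r.
have [m [a ha]] := he1 x; exists m; rewrite ha big1 // => l _.
suff -> : a l = 0 by rewrite scale0r.
have [|m' hm'] := he2 (fun l => t * a l) _ l.
  transitivity (phi i ^+ m *: (t *: x)); last by rewrite htx scaler0.
  rewrite scalerA mulrC -scalerA ha scaler_sumr.
  by apply: eq_bigr => l' _; rewrite scalerA.
apply: (dom_cancel T_dom (dom_neq0 T_dom (dom_exp_neq0 T_dom m' p0) t0)).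
by rewrite mul0r mulrC -mulrA; apply: hm'.
Qed.

Lemma locally_free_fg : exists n (e : 'I_n -> M),
  forall x, exists a : 'I_n -> T, x = \sum_i a i *: e i.
Proof.
have [n [phi [[c hc] hphi]]] := M_free.
have /choice [e he] := hphi.
exists #|{: 'I_n * 'I_r}|, (fun k => e (enum_val k).1 (enum_val k).2) => x.
pose S z := exists a : 'I_n -> 'I_r -> T, z = \sum_i \sum_l a i l *: e i l.
have [|i|a ->] := unit_ideal_local hc (S := S) (x := x) _ _.
- split=> [|_ _ [a ->] [a' ->]|t _ [a ->]].
  + by exists (fun _ _ => 0); rewrite big1 // => i _; rewrite big1 // => l _; rewrite scale0r.
  + exists (fun i l => a i l + a' i l); rewrite -big_split; apply: eq_bigr => i _ /=.
    by rewrite -big_split; apply: eq_bigr => l _; rewrite scalerDl.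
  + exists (fun i l => t * a i l); rewrite scaler_sumr; apply: eq_bigr => i _.
    by rewrite scaler_sumr; apply: eq_bigr => l _; rewrite scalerA.
- have [m [a ha]] := proj1 (he i) x; exists m.
  exists (fun i' l => if i' == i then a l else 0); rewrite (bigD1 i) //= [X in _ + X]big1.
    by rewrite addr0 ha; apply: eq_bigr => l _; rewrite eqxx.
  by move=> i' /negPf ->; rewrite big1 // => l _; rewrite scale0r.
exists (fun k => a (enum_val k).1 (enum_val k).2).
rewrite pair_big /= (reindex (@enum_val [the finType of ('I_n * 'I_r)%type] predT)) //=.
by apply: onW_bij; apply: enum_val_bij.
Qed.

(** Finite generation of [M] gives one power of [phi] that works for all [x]; uniqueness of
    coordinates then makes [gam] linear. *)
Lemma local_coordinates (phi : T) (e : 'I_r -> M) : phi != 0 ->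
  (forall x, exists (n : nat) (a : 'I_r -> T), phi ^+ n *: x = \sum_i a i *: e i) ->
  (forall a : 'I_r -> T, \sum_i a i *: e i = 0 ->
     forall i, exists n : nat, phi ^+ n * a i = 0) ->
  exists n (gam : M -> 'I_r -> T),
    [/\ forall x, phi ^+ n *: x = \sum_i gam x i *: e i,
        forall x y i, gam (x + y) i = gam x i + gam y i &
        forall t x i, gam (t *: x) i = t * gam x i].
Proof.
move=> phi0 he1 he2.
have indep (a a' : 'I_r -> T) : \sum_i a i *: e i = \sum_i a' i *: e i -> a =1 a'.
  move=> h i; have [|n hn] := he2 (fun i => a i - a' i) _ i.
    by under eq_bigr do rewrite scalerBl; rewrite sumrB h subrr.
  apply/eqP; rewrite -subr_eq0; apply/eqP.
  by apply: (dom_cancel T_dom (dom_exp_neq0 T_dom n phi0)); rewrite mul0r mulrC.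
have [n0 [g hg]] := locally_free_fg.
have /choice [nn hnn] := fun i => he1 (g i).
pose n := (\sum_i nn i)%N.
have unif x : exists a : 'I_r -> T, phi ^+ n *: x = \sum_i a i *: e i.
  have [c ->] := hg x; rewrite scaler_sumr.
  apply: (big_ind (fun z => exists a : 'I_r -> T, z = \sum_i a i *: e i)).
  - by exists (fun=> 0); rewrite big1 // => i _; rewrite scale0r.
  - move=> _ _ [a ->] [a' ->]; exists (fun i => a i + a' i).
    by rewrite -big_split; apply: eq_bigr => i _; rewrite scalerDl.
  - move=> i _; have [a ha] := hnn i; exists (fun l => c i * phi ^+ (n - nn i) * a l).
    have le : (nn i <= n)%N by rewrite /n (bigD1 i) //= leq_addr.
    under eq_bigr do rewrite -scalerA.
    rewrite -scaler_sumr -ha !scalerA; congr (_ *: _).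
    by rewrite -{1}(subnK le) exprD; ring.
have /choice [gam hgam] := unif; exists n, gam; split=> // [x y|t x].
  apply: indep; rewrite -hgam scalerDr !hgam -big_split.
  by apply: eq_bigr => i _; rewrite scalerDl.
apply: indep; rewrite -hgam scalerA mulrC -scalerA hgam scaler_sumr.
by apply: eq_bigr => i _; rewrite scalerA.
Qed.

(** An embedding of [M] into [T^r]: the coordinates at a single nonzero [phi i] are already
    injective, since [M] has no torsion. *)
Lemma locally_free_coordinates : exists (gam : M -> 'I_r -> T),
    [/\ forall x, (forall i, gam x i = 0) -> x = 0,
        forall x y i, gam (x + y) i = gam x i + gam y i &
        forall t x i, gam (t *: x) i = t * gam x i].
Proof.
have [n [phi [[c hc] hphi]]] := M_free.
have [i phi0] : exists i, phi i != 0.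
  apply: contrapT => h; case: T_dom => h1 _; apply: h1; rewrite -hc big1 // => i _.
  have [->|hi] := eqVneq (phi i) 0; first by rewrite mulr0.
  by case: h; exists i.
have [e [he1 he2]] := hphi i.
have [m [gam [hg1 hg2 hg3]]] := local_coordinates phi0 he1 he2.
exists gam; split=> // x hx; apply: (locally_free_torsion (dom_exp_neq0 T_dom m phi0)).
by rewrite hg1 big1 // => l _; rewrite hx scale0r.
Qed.

(* Replaces flatness of s. *)
Lemma base_change_torsion (s : {rmorphism T -> T}) (t : T) (y : base_change s M) :
  t != 0 -> t *: y = 0 -> y = 0.
Proof.
have [n [phi [[c hc] hphi]]] := M_free => t0 hty.
apply: (@unit_ideal_local _ _ _ (fun i => s (c i)) (fun i => s (phi i)) (fun z => z = 0)).
- by rewrite -(rmorph1 s) -hc rmorph_sum; apply: eq_bigr => i _; rewrite rmorphM.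
- by split=> [|u z -> ->|a z ->] //; rewrite ?addr0 ?scaler0.
move=> i; have [p0|p0] := eqVneq (phi i) 0.
  by exists 1%N; rewrite expr1 p0 rmorph0 scale0r.
have [e [he1 he2]] := hphi i.
have [m [gam [hg1 hg2 hg3]]] := local_coordinates p0 he1 he2.
exists m.
(* The coordinates of [M] transported along [s]. They take values in the domain [T], so they vanish
   on torsion, and they determine an element up to a power of [s (phi i)]. *)
pose kap l : base_change s M -> T := tens_lift (fun x u => u * s (gam x l)).
have bal l : balanced (fun (a : T) (x : M) => a *: x) (fun a u => s a * u)
    (fun x u => u * s (gam x l)).
  split=> *; first by rewrite hg2 rmorphD mulrDr.
    by rewrite mulrDl.
  by rewrite hg3 rmorphM; ring.
have kapD l u v : kap l (u + v) = kap l u + kap l v by apply: tens_liftD; apply: bal.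
have kap0 l : kap l 0 = 0 by apply: (tens_lift0 (bal l)).
have kapP l x u : kap l (bc_pure s x u) = u * s (gam x l).
  exact: (tens_lift_pure _ _ (bal l)).
have kapZ l a u : kap l (a *: u) = a * kap l u.
  move: u; apply: bc_ind => [|u v hu hv|x u].
  - by rewrite scaler0 kap0 mulr0.
  - by rewrite scalerDr !kapD hu hv mulrDr.
  - by rewrite bc_pureZ !kapP mulrA.
have key u : s (phi i) ^+ m *: u = \sum_l kap l u *: bc_pure s (e l) 1.
  move: u; apply: bc_ind => [|u v hu hv|x u].
  - by rewrite scaler0 big1 // => l _; rewrite kap0 scale0r.
  - by rewrite scalerDr hu hv -big_split; apply: eq_bigr => l _; rewrite kapD scalerDl.
  - rewrite -rmorphXn bc_pureZ -bc_pureS hg1.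
    rewrite bc_pure_suml; apply: eq_bigr => l _.
    by rewrite kapP bc_pureS bc_pureZ mulr1 mulrC.
rewrite key big1 // => l _; suff -> : kap l y = 0 by rewrite scale0r.
by apply: (dom_cancel T_dom t0); rewrite mul0r mulrC -kapZ hty kap0.
Qed.

End LocallyFreeModule.

Lemma bc_mapZ (R : pzRingType) (S : comPzRingType) (phi : {rmorphism R -> S})
    (M M' : lmodType R) (f : {linear M -> M'}) (s : S) (x : base_change phi M) :
  bc_map phi f (s *: x) = s *: bc_map phi f x.
Proof. by have := bc_map_linear f s x 0; rewrite addr0 bc_map0 addr0. Qed.

(** * Images of endomorphisms of a motive *)

Section TauGen.
Variables (k : finFieldType) (C : curve k) (inf : rational_point C).
Variables (L : fieldType) (j : {rmorphism k -> L}) (F : function_fieldL j C).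
Local Notation A := (affine_ring inf).
Local Notation AL := (ctensor (ks_cst A) j).
Local Notation sigmaA := (sigma : AL -> AL).
Variables (M : lmodType AL) (tau : {linear base_change sigmaA M -> M}).

Lemma tau_gen_bal : balanced (fun (r : AL) (m : M) => r *: m)
  (fun (r : AL) (s : F) => to_ffL F A r * s)
  (fun m x => bc_pure (to_ffL F A) (tau (bc_pure sigmaA m 1)) (ffL_sigma F x)).
Proof.
split=> [m1 m2 s|m1 s s'|a m1 s].
- by rewrite bc_pureDl raddfD bc_pureDl.
- by rewrite raddfD bc_pureDr.
- have -> : bc_pure sigmaA (a *: m1) 1 = sigma a *: bc_pure sigmaA m1 1.
    by rewrite bc_pureS bc_pureZ.
  by rewrite linearZ bc_pureS rmorphM /= to_ffL_sigma.
Qed.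

Lemma tau_genD : {morph @tau_gen _ _ _ _ _ F _ tau : x y / x + y}.
Proof. by move=> x y; apply: tens_liftD; apply: tau_gen_bal. Qed.

Lemma tau_gen0 : @tau_gen _ _ _ _ _ F _ tau 0 = 0.
Proof. exact: (tens_lift0 tau_gen_bal). Qed.

Lemma tau_genZ t (x : generic_fibre F M) :
  tau_gen tau (t *: x) = ffL_sigma F t *: tau_gen tau x.
Proof.
move: x; apply: bc_ind => [|x y hx hy|x s].
- by rewrite scaler0 tau_gen0 scaler0.
- by rewrite scalerDr !tau_genD hx hy scalerDr.
- by rewrite bc_pureZ !tau_gen_pure bc_pureZ rmorphM.
Qed.

End TauGen.

Section ImageMotive.
Variables (k : finFieldType) (C : curve k) (inf : rational_point C).
Variables (L : fieldType) (j : {rmorphism k -> L}) (c : characteristic inf j).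
Variable F : function_fieldL j C.
Local Notation A := (affine_ring inf).
Local Notation AL := (ctensor (ks_cst A) j).
Local Notation sigmaA := (sigma : AL -> AL).

Variables (M : motive c F) (n : nat) (h : 'I_n -> mEnd M).

Definition image_pred : {pred M} :=
  fun x => `[< exists y : 'I_n -> M, x = \sum_i h i (y i) >].

Lemma image_predP x :
  reflect (exists y : 'I_n -> M, x = \sum_i h i (y i)) (x \in image_pred).
Proof. exact: asboolP. Qed.

Lemma image_submod_closed : submod_closed image_pred.
Proof.
split.
  by apply/image_predP; exists (fun=> 0); rewrite big1 // => i _; rewrite raddf0.
move=> t u v /image_predP [y ->] /image_predP [y' ->]; apply/image_predP.
exists (fun i => t *: y i + y' i); rewrite scaler_sumr -big_split.
by apply: eq_bigr => i _; rewrite linearP.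
Qed.

HB.instance Definition _ := GRing.isSubmodClosed.Build AL M image_pred image_submod_closed.

Definition image_mod := {x : M | x \in image_pred}.
HB.instance Definition _ := [isSub of image_mod for @sval M _].
HB.instance Definition _ := [Choice of image_mod by <:].
HB.instance Definition _ := [SubChoice_isSubLmodule of image_mod by <:].

Definition image_incl (x : image_mod) : M := val x.
Lemma image_incl_linear : linear image_incl.
Proof. by move=> t x y; rewrite /image_incl linearP. Qed.
HB.instance Definition _ := GRing.isLinear.Build _ _ _ _ image_incl image_incl_linear.

Lemma image_incl_inj : injective image_incl.
Proof. exact: val_inj. Qed.

Lemma image_corestrict_proof i (y : M) : h i y \in image_pred.
Proof.
apply/image_predP; exists (fun i' => if i' == i then y else 0).
rewrite (bigD1 i) //= eqxx big1 ?addr0 // => i' /negPf ->; exact: raddf0.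
Qed.

Definition image_corestrict i (y : M) : image_mod := Sub (h i y) (image_corestrict_proof i y).
Lemma image_corestrict_linear i : linear (image_corestrict i).
Proof. by move=> t x y; apply: val_inj; rewrite /= linearP. Qed.
HB.instance Definition _ i :=
  GRing.isLinear.Build _ _ _ _ (image_corestrict i) (image_corestrict_linear i).

Lemma image_elim (x : image_mod) : exists y : 'I_n -> M, x = \sum_i image_corestrict i (y i).
Proof.
have /image_predP [y hy] := valP x; exists y; apply: val_inj.
by rewrite hy raddf_sum.
Qed.

(** Each [h i] commutes with tau, so tau sends [h i y (x) s] to the image under [h i] of tau of
    [y (x) s]. *)
Lemma image_tau_proof (x : base_change sigmaA image_mod) :
  mot_tau M (bc_map sigmaA image_incl x) \in image_pred.
Proof.
move: x; apply: bc_ind => [|x y hx hy|z s].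
- by rewrite bc_map0 raddf0 rpred0.
- by rewrite bc_mapD raddfD rpredD.
have [y ->] := image_elim z.
rewrite bc_map_pure raddf_sum bc_pure_suml raddf_sum /=.
apply: rpred_sum => i _.
rewrite -[bc_pure _ _ _](bc_map_pure sigmaA (h i) (y i) s) -hom_tau.
exact: image_corestrict_proof.
Qed.

Definition image_tau (x : base_change sigmaA image_mod) : image_mod :=
  Sub (mot_tau M (bc_map sigmaA image_incl x)) (image_tau_proof x).
Lemma image_tau_linear : linear image_tau.
Proof. by move=> t x y; apply: val_inj; rewrite /= bc_map_linear linearP. Qed.
HB.instance Definition _ := GRing.isLinear.Build _ _ _ _ image_tau image_tau_linear.

Lemma image_tau_corestrict i (w : base_change sigmaA M) :
  image_corestrict i (mot_tau M w) = image_tau (bc_map sigmaA (image_corestrict i) w).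
Proof.
apply: val_inj; rewrite /= hom_tau; congr (mot_tau M _).
by rewrite -bc_map_comp.
Qed.

Lemma image_tau_im (y : 'I_n -> M) : (forall i, in_im_tau (mot_tau M) (y i)) ->
  in_im_tau image_tau (\sum_i image_corestrict i (y i)).
Proof.
move=> /choice [w hw]; exists (\sum_i bc_map sigmaA (image_corestrict i) (w i)).
by rewrite raddf_sum; apply: eq_bigr => i _; rewrite /= -image_tau_corestrict hw.
Qed.

Lemma in_im_tau_submodule (V : lmodType AL) (tau : {linear base_change sigmaA V -> V}) :
  submodule (in_im_tau tau).
Proof.
split=> [|x y [u <-] [v <-]|t x [u <-]]; first by exists 0; rewrite raddf0.
  by exists (u + v); rewrite raddfD.
by exists (t *: u); rewrite linearZ.
Qed.

(** The images of a basis of the old cokernel under the [n] maps [image_corestrict i] span the new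
    one and bound its dimension. The value of [d] stays open, so [image_coker_killed] treats any
    such [d]. *)
Lemma image_coker_dim : exists d, coker_dim image_tau d.
Proof.
have [e [he _]] := mot_coker M.
pose I : finType := ('I_n * 'I_(mot_dim M))%type.
pose g (s : 'I_#|I|) := image_corestrict (enum_val s).1 (e (enum_val s).2).
have hS := in_im_tau_submodule image_tau.
have hg x : in_rel_span (ct_inr (ks_cst A) j) (in_im_tau image_tau) g x.
  have [y ->] := image_elim x; have /choice [l hl] := fun i => he (y i).
  exists (fun s => l (enum_val s).1 (enum_val s).2).
  have -> : \sum_s ct_inr (ks_cst A) j (l (enum_val s).1 (enum_val s).2) *: g s =
      \sum_i image_corestrict i (\sum_s ct_inr (ks_cst A) j (l i s) *: e s).
    under [RHS]eq_bigr do rewrite linear_sum /=.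
    rewrite pair_bigA /= (reindex (@enum_val I predT)) /=; last first.
      by apply: onW_bij; apply: enum_val_bij.
    by apply: eq_bigr => s _; rewrite linearZ.
  rewrite -sumrB; under eq_bigr do rewrite -raddfB; exact: image_tau_im.
have [|d [f [_ hf1 hf2]]] := max_rel_free (lam := ct_inr (ks_cst A) j) hS
    (J := fun=> True) (D := #|I|).
  by move=> d f _; apply: rel_free_leq.
by exists d, f; split=> // m; apply: hf2.
Qed.

Lemma idealJ_mulr (x v : AL) : idealJ c x -> idealJ c (x * v).
Proof.
move=> [m [b [a ->]]]; exists m, (fun i => v * b i), a.
by rewrite mulrC mulr_sumr; apply: eq_bigr => i _; rewrite mulrA.
Qed.

Lemma idealJN (x : AL) : idealJ c x -> idealJ c (- x).
Proof. by move=> /idealJ_mulr hx; rewrite -mulrN1. Qed.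

Lemma image_killed_old (x : 'I_(mot_dim M) -> AL) : (forall i, idealJ c (x i)) ->
  forall m, in_im_tau image_tau ((\prod_i x i) *: m).
Proof.
move=> hx m; have [y ->] := image_elim m.
have -> : (\prod_i x i) *: (\sum_i image_corestrict i (y i)) =
    \sum_i image_corestrict i ((\prod_i x i) *: y i).
  by rewrite scaler_sumr; apply: eq_bigr => i _; rewrite [RHS]linearZ.
by apply: image_tau_im => i; apply: mot_char.
Qed.

(* The cokernel is killed by J^(dim M), so the elements of J act on it by
   nilpotent operators; dim coker commuting nilpotent operators have product 0. *)
Lemma image_coker_killed d : coker_dim image_tau d -> coker_killed c image_tau d.
Proof.
move=> [e [he _]] x hx m.
have hS := in_im_tau_submodule image_tau; have [S0 SD SZ] := hS.
(* The [d] factors are padded by zeros to an infinite chain. [chain_dependent] may return [i = d];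
   there [x' i = 0], and its relation already says that [p d *: m] is in the image. *)
pose x' i := if insub i is Some i' then x i' else 0.
pose p i := \prod_(s < i) x' s.
have [D' hD'] : exists D', D' = d by exists d.
have hp i : p i.+1 = p i * x' i by rewrite /p big_ord_recr.
have [i [v [hi hv]]] := @chain_dependent _ _ (ct_inr (ks_cst A) j) _ _ d hS
  (fun d' f => @rel_free_leq _ _ _ _ _ hS d' f d e (fun i => he (f i))) p x' m hp.
have pd : \prod_i x i = p d.
  by apply: eq_bigr => s _; rewrite /x' valK.
rewrite pd.
have Spi : in_im_tau image_tau (p i *: m).
  move: hi; rewrite leq_eqVlt => /orP [/eqP ei|lt].
    by move: hv; rewrite /x' ei insubF ?ltnn // mul0r addr0 mulr1.
  have Jx : idealJ c (- (x' i * v)).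
    by apply: idealJN; apply: idealJ_mulr; rewrite /x' insubT.
  set u := - (x' i * v) in Jx.
  (* Geometric series: [1 + x' i * v = 1 - u] with [u] in [J] is invertible up to [u^(mot_dim M)],
     which kills the cokernel. *)
  have -> : p i *: m = (\sum_(s < mot_dim M) u ^+ s) *: ((p i * (1 + x' i * v)) *: m) +
      (\prod_(s < mot_dim M) u) *: (p i *: m).
    rewrite !scalerA -scalerDl; congr (_ *: m).
    rewrite prodr_const card_ord.
    have : 1 - u ^+ mot_dim M = (1 - u) * \sum_(s < mot_dim M) u ^+ s.
      have := subrXX 1 u (mot_dim M); rewrite expr1n => ->; congr (_ * _).
      by apply: eq_bigr => s _; rewrite expr1n mul1r.
    rewrite /u opprK => hu.
    transitivity (p i * ((1 + x' i * v) * \sum_(s < mot_dim M) (- (x' i * v)) ^+ s +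
      (- (x' i * v)) ^+ mot_dim M)); last ring.
    by rewrite -hu subrK mulr1.
  by apply: SD; [apply: SZ | apply: image_killed_old].
have [q hq] : exists q, p d = q * p i.
  rewrite -(subnK hi); elim: (d - i)%N => [|s [q hq]]; first by exists 1; rewrite mul1r.
  by exists (q * x' (s + i)%N); rewrite addSn hp hq mulrAC.
by rewrite hq -scalerA; apply: SZ.
Qed.

Variable a : ringOf A.
Hypothesis a_neq0 : a != 0.
Hypothesis a_image : forall x : M, ct_inl (ks_cst A) j a *: x \in image_pred.

Local Notation aL := (ct_inl (ks_cst A) j a).

Lemma to_ffL_inl_neq0 : to_ffL F A aL != 0.
Proof.
rewrite to_ffL_pure rmorph1 mulr1 fmorph_eq0.
by apply: contraNneq a_neq0 => h'; apply/eqP/val_inj.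
Qed.

Lemma ct_inl_neq0 : aL != 0.
Proof. by apply: contraNneq to_ffL_inl_neq0 => ->; rewrite rmorph0. Qed.

Definition image_mul (x : M) : image_mod := Sub (aL *: x) (a_image x).
Lemma image_mul_linear : linear image_mul.
Proof.
by move=> t x y; apply: val_inj; rewrite /= scalerDr !scalerA mulrC.
Qed.
HB.instance Definition _ := GRing.isLinear.Build _ _ _ _ image_mul image_mul_linear.

Lemma image_locally_free : locally_free image_mod (mot_rank M).
Proof.
apply: (locally_free_sub (tensor_domain F A) (@tensor_finite_quotients _ _ _ j F A)
   ct_inl_neq0 _ image_incl_inj _ (mot_locfree M)).
- by move=> m hm mb; apply: affine_regular hm a_neq0 mb.
- by move=> x; exists (image_mul x).
Qed.

Lemma bc_map_image_mul_incl (S : comPzRingType) (phi : {rmorphism AL -> S})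
    (x : base_change phi image_mod) :
  bc_map phi image_mul (bc_map phi image_incl x) = phi aL *: x.
Proof.
rewrite -bc_map_comp -bc_map_scale; last by move=> r m; rewrite !scalerA mulrC.
by congr bc_map; apply: funext => z; apply: val_inj.
Qed.

Lemma bc_map_image_incl_mul (S : comPzRingType) (phi : {rmorphism AL -> S})
    (x : base_change phi M) :
  bc_map phi image_incl (bc_map phi image_mul x) = phi aL *: x.
Proof.
by rewrite -bc_map_comp -bc_map_scale // => r m; rewrite !scalerA mulrC.
Qed.

Lemma sigma_inl : sigmaA aL = aL.
Proof. by rewrite sigma_pure /frob expr1n. Qed.

(** Multiplication by [a] on the pullback of [M'] factors through the pullback of [M], where tau is
    injective; so [a] kills the kernel, which has no torsion. *)
Lemma image_tau_inj : injective image_tau.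
Proof.
apply: raddf_inj => x hx.
have h0 : bc_map sigmaA image_incl x = 0.
  by apply: (@mot_inj _ _ _ _ _ _ _ M); rewrite raddf0 -[RHS](congr1 val hx).
apply: (base_change_torsion (tensor_domain F A) image_locally_free (s := sigmaA)
  (t := aL) ct_inl_neq0).
rewrite -{1}sigma_inl -bc_map_image_mul_incl h0; exact: bc_map0.
Qed.

Lemma image_tau_mul (w : base_change sigmaA M) :
  image_tau (bc_map sigmaA image_mul w) = image_mul (mot_tau M w).
Proof.
by apply: val_inj; rewrite /= bc_map_image_incl_mul [_ aL]sigma_inl linearZ.
Qed.

(** The stalk [W] at infinity is kept and only [theta] changes, by [psi], the inverse of the
    inclusion on generic fibres. [psi] commutes with tau because sigma fixes [a]. *)
Lemma image_pure : pure_at_inf F image_tau (mot_rank M).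
Proof.
have [W [theta [hW htheta [kk [l [pi [phi [h1 h2 h3 h4 h5]]]]]]]] := mot_pure M.
set aF := to_ffL F A aL.
have aF0 : aF != 0 := to_ffL_inl_neq0.
pose psi (v : generic_fibre F M) : generic_fibre F image_mod :=
  aF^-1 *: bc_map (to_ffL F A) image_mul v.
have psi_lin : linear psi.
  by move=> t x y; rewrite /psi bc_map_linear scalerDr !scalerA mulrC.
have psiZ t x : psi (t *: x) = t *: psi x.
  by rewrite /psi bc_mapZ !scalerA mulrC.
have psi_bij : bijective psi.
  exists (bc_map (to_ffL F A) image_incl) => x; rewrite /psi.
    by rewrite bc_mapZ bc_map_image_incl_mul scalerA mulVf // scale1r.
  by rewrite bc_map_image_mul_incl scalerA mulVf // scale1r.
have psi_tau v : tau_gen image_tau (psi v) = psi (tau_gen (mot_tau M) v).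
  rewrite /psi tau_genZ fmorphV -to_ffL_sigma sigma_inl; congr (_ *: _).
  move: v; apply: bc_ind => [|x y hx hy|x s].
  - by rewrite tau_gen0 !bc_map0 tau_gen0.
  - by rewrite tau_genD !bc_mapD tau_genD hx hy.
  - rewrite bc_map_pure !tau_gen_pure bc_map_pure; congr bc_pure.
    by have := image_tau_mul (bc_pure sigmaA x 1); rewrite bc_map_pure.
pose theta' := psi \o theta.
have theta'_lin : linear theta'.
  by move=> t x y; rewrite /theta' /= linearP psi_lin.
pose th : {linear base_change (@ringOf_incl _ (stalk_ring F inf)) W ->
  generic_fibre F image_mod} := HB.pack theta' (GRing.isLinear.Build _ _ _ _ _ theta'_lin).
exists W, th; split=> //; first exact: bij_comp.
exists kk, l, pi, phi; split=> // w.
have it m v : iter m (tau_gen image_tau) (psi v) = psi (iter m (tau_gen (mot_tau M)) v).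
  by elim: m => //= m ->; rewrite psi_tau.
by rewrite /= it h5 psiZ.
Qed.

Lemma image_motive : exists M' : motive c F,
  exists (f : mhom M' M) (g : mhom M M'),
    [/\ injective f, forall x, (exists z, f z = x) <-> x \in image_pred,
        forall z, g (f z) = aL *: z & forall x, f (g x) = aL *: x].
Proof.
have [d hd] := image_coker_dim.
pose M' : motive c F := Motive (mot_mod := image_mod) (mot_tau := image_tau)
  image_locally_free image_tau_inj hd (image_coker_killed hd) image_pure.
have f_tau (x : base_change sigmaA M') :
  image_incl (mot_tau M' x) = mot_tau M (bc_map sigmaA image_incl x) by [].
have g_tau (x : base_change sigmaA M) :
  image_mul (mot_tau M x) = mot_tau M' (bc_map sigmaA image_mul x).
  by rewrite -image_tau_mul.
exists M', (@Defs.Hom _ _ _ _ _ _ _ M' M image_incl image_incl_linear f_tau).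
exists (@Defs.Hom _ _ _ _ _ _ _ M M' image_mul image_mul_linear g_tau).
split=> [||z|x] //=.
- exact: image_incl_inj.
- by move=> x; split=> [[z <-]|hx]; [apply: valP | exists (Sub x hx)].
- exact: val_inj.
Qed.

End ImageMotive.

(** The embedding of [Q] into [F] induced by [g], with just the properties needed to build a
    balanced map in [epure_eq0]. *)
Lemma fraction_extend (T : comPzRingType) (Q F : fieldType) (i : {rmorphism T -> Q})
    (g : {rmorphism T -> F}) : is_fraction_field i -> injective g ->
  exists iota : Q -> F, [/\ forall x y, iota (x + y) = iota x + iota y,
    forall a x, iota (i a * x) = g a * iota x & forall x, x != 0 -> iota x != 0].
Proof.
move=> [i_inj frac] g_inj.
have ig0 x : i x != 0 -> g x != 0.
  by apply: contraNneq => h; rewrite (g_inj x 0) ?rmorph0.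
have i0 x : x != 0 -> i x != 0.
  by apply: contraNneq => h; apply/eqP/i_inj; rewrite h rmorph0.
have /choice [num hnum] := frac; have /choice [den hden] := hnum.
pose iota q := g (num q) / g (den q).
have iotaE q x y : y != 0 -> q = i x / i y -> iota q = g x / g y.
  move=> y0 hq; have [d0 hd] := hden q.
  apply/eqP; rewrite /iota eqr_div ?ig0 ?i0 // -!rmorphM; apply/eqP; congr (g _).
  apply: i_inj; rewrite !rmorphM; apply/eqP; rewrite -eqr_div ?i0 //.
  by rewrite -hd -hq.
have mul0 (x y : T) : x != 0 -> y != 0 -> x * y != 0.
  move=> x0 y0; apply: contraNneq (mulf_neq0 (i0 _ x0) (i0 _ y0)) => h.
  by rewrite -rmorphM h rmorph0.
exists iota; split.
- move=> x y; have [dx hx] := hden x; have [dy hy] := hden y.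
  rewrite (iotaE _ (num x * den y + num y * den x) (den x * den y)) ?mul0 //.
    by rewrite !rmorphD !rmorphM /= -addf_div ?ig0 ?i0.
  by rewrite !rmorphD !rmorphM /= -addf_div ?i0 // -hx -hy.
- move=> a x; have [dx hx] := hden x.
  rewrite (iotaE _ (a * num x) (den x)) //; first by rewrite rmorphM mulrA.
  by rewrite rmorphM -mulrA -hx.
- move=> x x0; have [dx hx] := hden x; rewrite mulf_neq0 ?invr_eq0 ?ig0 ?i0 //.
  by apply: contraNneq x0 => h; rewrite hx h rmorph0 mul0r.
Qed.

(** * The endomorphism algebra *)

Lemma linear_scale (T : pzRingType) (U V : lmodType T) (f : U -> V) :
  linear f -> forall t x, f (t *: x) = t *: f x.
Proof.
move=> hf; have f0 : f 0 = 0.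
  by have := hf (-1) 0 0; rewrite scaler0 addr0 scaleN1r addNr.
by move=> t x; have := hf t x 0; rewrite !addr0 f0 addr0.
Qed.

Section EndomorphismAlgebra.
Variables (k : finFieldType) (C : curve k) (inf : rational_point C).
Variables (L : fieldType) (j : {rmorphism k -> L}) (c : characteristic inf j).
Variable F : function_fieldL j C.
Local Notation A := (affine_ring inf).
Local Notation AL := (ctensor (ks_cst A) j).
Local Notation toAL a := (ct_inl (ks_cst A) j a).
Variables (Q : fieldType) (iQ : {rmorphism ringOf A -> Q}).
Hypothesis hQ : is_fraction_field iQ.
Variable M : motive c F.
Local Notation E := (EndQ M iQ).
Local Notation scal := (End_scalar M).
Local Notation epure := (EndQ_pure iQ).

Lemma iQ_neq0 a : a != 0 -> iQ a != 0.
Proof.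
by case: hQ => i_inj _; apply: contraNneq => h; apply/eqP/i_inj; rewrite h rmorph0.
Qed.

Lemma affine_mul_neq0 (a b : ringOf A) : a != 0 -> b != 0 -> a * b != 0.
Proof.
move=> a0 b0; apply: contraNneq (mulf_neq0 (iQ_neq0 a0) (iQ_neq0 b0)) => h.
by rewrite -rmorphM h rmorph0.
Qed.

Lemma inl_neq0 (a : ringOf A) : a != 0 -> toAL a != 0.
Proof. exact: (ct_inl_neq0 F). Qed.

Lemma motive_torsion (a : ringOf A) (x : M) : a != 0 -> toAL a *: x = 0 -> x = 0.
Proof.
by move=> a0; apply: (locally_free_torsion (tensor_domain F A) (mot_locfree M) (inl_neq0 a0)).
Qed.

Lemma End_sumE (I : Type) (r : seq I) (P : pred I) (h : I -> mEnd M) (x : M) :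
  (\sum_(i <- r | P i) h i : mEnd M) x = \sum_(i <- r | P i) h i x.
Proof. by apply: (big_morph (fun h : mEnd M => h x)). Qed.

Lemma End_scalar_mulE a (h : mEnd M) x : (scal a * h : mEnd M) x = toAL a *: h x.
Proof. by []. Qed.

Lemma mhomZ (M1 M2 : motive c F) (f : mhom M1 M2) t x : f (t *: x) = t *: f x.
Proof. exact: (linear_scale (hom_linear f)). Qed.

Lemma epureD (h h' : mEnd M) q : epure (h + h') q = epure h q + epure h' q.
Proof. exact: at_pureDl. Qed.

Lemma epureB (h h' : mEnd M) q : epure (h - h') q = epure h q - epure h' q.
Proof. by apply: (addIr (epure h' q)); rewrite -epureD !subrK. Qed.

Lemma epure_sum (I : Type) (r : seq I) (P : pred I) (h : I -> mEnd M) q :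
  epure (\sum_(i <- r | P i) h i) q = \sum_(i <- r | P i) epure (h i) q.
Proof.
apply: (big_morph (epure^~ q)) => [h1 h2|]; first exact: epureD.
by apply: (addrI (epure 0 q)); rewrite -epureD !addr0.
Qed.

Lemma epureS a (h : mEnd M) q : epure (scal a * h) q = epure h (iQ a * q).
Proof. exact: at_pureS. Qed.

Lemma epureM (h h' : mEnd M) q q' : epure h q * epure h' q' = epure (h * h') (q * q').
Proof. exact: at_mul_pure. Qed.

Lemma epure_cancel a (h : mEnd M) q : a != 0 -> epure (scal a * h) ((iQ a)^-1 * q) = epure h q.
Proof. by move=> a0; rewrite epureS mulrA divff ?mul1r // iQ_neq0. Qed.

(** A pure tensor is detected by the balanced maps sending [h, q] to the image of [q] in [F] times a
    coordinate of [h x], and the coordinates separate the points of [M]. *)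
Lemma epure_eq0 (h : mEnd M) q : q != 0 -> epure h q = 0 -> h = 0.
Proof.
move=> q0 h0.
have inlF_inj : injective (to_ffL F A \o ct_inl (ks_cst A) j).
  move=> a b /= /(@to_ffL_inj _ _ _ _ F A) hab; apply/eqP; rewrite -subr_eq0.
  by apply: contraTT isT => /inl_neq0; rewrite rmorphB /= hab subrr eqxx.
have [iota [iotaD iotaS iota0]] := fraction_extend hQ inlF_inj.
have [gam [hg1 hg2 hg3]] := locally_free_coordinates (tensor_domain F A) (mot_locfree M).
apply: hom_ext => x; apply: hg1 => i.
pose b (h : mEnd M) (q : Q) : F := iota q * to_ffL F A (gam (h x) i).
have bal : balanced (fun (r : ringOf A) (h : mEnd M) => scal r * h)
    (fun (r : ringOf A) (q : Q) => iQ r * q) b.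
  split=> [h1 h2 q1|h1 q1 q2|r h1 q1]; rewrite /b.
  - by rewrite hg2 rmorphD mulrDr.
  - by rewrite iotaD mulrDl.
  - by rewrite End_scalar_mulE hg3 iotaS rmorphM /=; ring.
have : tens_lift b (epure h q) = 0 by rewrite h0 (tens_lift0 bal).
rewrite (tens_lift_pure _ _ bal) => /eqP; rewrite mulf_eq0 (negPf (iota0 _ q0)) /= => /eqP h1.
by apply: (@to_ffL_inj _ _ _ _ F A); rewrite h1 rmorph0.
Qed.

Lemma epure_inj (h h' : mEnd M) q : q != 0 -> epure h q = epure h' q -> h = h'.
Proof.
move=> q0 hh'; apply/eqP; rewrite -subr_eq0; apply/eqP/(epure_eq0 q0).
by rewrite epureB hh' subrr.
Qed.

Lemma epure_frac (x : E) : exists (h : mEnd M) s, s != 0 /\ x = epure h (iQ s)^-1.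
Proof.
move: x; apply: at_ind => [|x y [h [s [s0 ->]]] [h' [s' [s'0 ->]]]|h q].
- exists 0, 1; split; first by apply: contraTneq isT => h1;
    have := oner_eq0 Q; rewrite -(rmorph1 iQ) h1 rmorph0 eqxx.
  by apply: (addrI (epure 0 (iQ 1)^-1)); rewrite -epureD !addr0.
- exists (scal s' * h + scal s * h'), (s * s'); split; first exact: affine_mul_neq0.
  rewrite epureD !epureS rmorphM invfM; congr (_ + _).
    by rewrite mulrCA divff ?mulr1 // iQ_neq0.
  by rewrite mulrA divff ?mul1r // iQ_neq0.
- have [x [y [y0 ->]]] := proj2 hQ q.
  by exists (scal x * h), y; split=> //; rewrite epureS.
Qed.

Lemma epure_common_denominator n (b : 'I_n -> E) :
  exists (a : ringOf A) (h : 'I_n -> mEnd M), a != 0 /\ forall i, b i = epure (h i) (iQ a)^-1.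
Proof.
elim: n b => [|n IH] b.
  have [_ [s [s0 _]]] := epure_frac 0.
  by exists s, (fun=> 0); split=> //; case.
have [a [h [a0 ha]]] := IH (fun i => b (lift ord0 i)).
have [h0 [s [s0 hs]]] := epure_frac (b ord0).
exists (s * a), (fcons (scal a * h0) (fun i => scal s * h i)); split.
  exact: affine_mul_neq0.
move=> i; case: (unliftP ord0 i) => [i'|] ->; rewrite ?fcons0 ?fconsS ?ha ?hs.
  by rewrite epureS rmorphM invfM mulrA divff ?mul1r // iQ_neq0.
by rewrite epureS rmorphM invfM mulrCA divff ?mulr1 // iQ_neq0.
Qed.

(* If the h_i span End(M) over Q, then A-valued coordinates of endomorphisms,
   obtained by expanding along k-independent elements of L, bound denominators. *)
Lemma End_bounded n (h : 'I_n -> mEnd M) :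
  (forall f : mEnd M, exists (s : ringOf A) (al : 'I_n -> ringOf A),
     s != 0 /\ scal s * f = \sum_i scal (al i) * h i) ->
  exists2 b : ringOf A, b != 0 & forall f : mEnd M,
    exists be : 'I_n -> ringOf A, scal b * f = \sum_i scal (be i) * h i.
Proof.
move=> hspan; set r := mot_rank M.
have [N [m hm]] := locally_free_fg (mot_locfree M).
have [gam [hg1 hg2 hg3]] := locally_free_coordinates (tensor_domain F A) (mot_locfree M).
have gam0 i : gam 0 i = 0 by have := hg3 0 0 i; rewrite scale0r mul0r.
have gam_sum (I : finType) (y : I -> M) i : gam (\sum_s y s) i = \sum_s gam (y s) i.
  by apply: (big_morph (fun x => gam x i)) => [x y'|]; [apply: hg2 | apply: gam0].
pose J : finType := ('I_N * 'I_r)%type.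
pose IJ : finType := ('I_n * J)%type.
(* One independent family [l] for the coordinates of all [h i] at all generators of [M] turns each
   [h i] into a row of elements of [A]. *)
have [n0 [l [hl hspl]]] := tensor_family_span
  (fun s : 'I_#|IJ| => gam (h (enum_val s).1 (m (enum_val s).2.1)) (enum_val s).2.2).
have /choice [co' hco'] := hspl.
pose co i (t : J) s := co' (enum_rank ((i, t) : IJ)) s.
have hco i (t : J) : gam (h i (m t.1)) t.2 = \sum_s ct_pure _ j (co i t s) (l s).
  by have := hco' (enum_rank ((i, t) : IJ)); rewrite enum_rankK.
pose K : finType := (J * 'I_n0)%type.
pose W := \matrix_(i < n, s < #|K|) iQ (co i (enum_val s).1 (enum_val s).2).
(* [b] is a common denominator of a generalized inverse of the coordinate matrix [W]. It depends
   only on the [h i], which makes the bound uniform in [f]. *)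
have [b [b0 [p hp]]] : exists b, b != 0 /\ exists p : 'I_#|K| -> 'I_n -> ringOf A,
    forall s i, iQ b * pinvmx W s i = iQ (p s i).
  have /choice [d hd] : forall t : 'I_#|K| * 'I_n, exists d, d != 0 /\
      exists x, iQ d * pinvmx W t.1 t.2 = iQ x.
    move=> t; have [x [y [y0 hxy]]] := proj2 hQ (pinvmx W t.1 t.2).
    by exists y; split=> //; exists x; rewrite hxy mulrCA divff ?mulr1 // iQ_neq0.
  have /choice [x hx] := fun t => proj2 (hd t).
  exists (\prod_t d t); split.
    have : iQ (\prod_t d t) != 0.
      by rewrite rmorph_prod; apply/prodf_neq0 => t _; apply/iQ_neq0; case: (hd t).
    by apply: contraNneq => ->; rewrite rmorph0.
  exists (fun s i => (\prod_(t | t != (s, i)) d t) * x (s, i)) => s i.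
  by rewrite (bigD1 (s, i)) //= [d _ * _]mulrC !rmorphM -mulrA hx.
exists b => // f; have [s [al [s0 hal]]] := hspan f.
have hf (t : J) : toAL s * gam (f (m t.1)) t.2 =
    \sum_u ct_pure _ j (\sum_i al i * co i t u) (l u).
  rewrite -hg3 -End_scalar_mulE hal End_sumE gam_sum.
  under eq_bigr do rewrite End_scalar_mulE hg3 hco mulr_sumr.
  rewrite exchange_big; apply: eq_bigr => u _ /=.
  by rewrite ct_pure_suml; apply: eq_bigr => i _; rewrite ct_pureM mul1r.
(* The coordinates of [f] along [l] are again in [A]: apply [lin_disjoint] to the [k]-subspace
   [s A], which contains the coefficients of [s] times any element of [A (x) L]. *)
have hw (t : J) u : exists w : ringOf A, \sum_i al i * co i t u = s * w.
  have [n' [l' [_ [y hy]]]] := tensor_expand (gam (f (m t.1)) t.2).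
  pose U (z : curve_field C) := exists w : ringOf A, z = val (s * w).
  suff [w hw] : U (val (\sum_i al i * co i t u)) by exists w; apply: val_inj.
  move: u; apply: (@lin_disjoint _ _ _ _ F U n' (fun i => val (s * y i)) l' n0 _ l) => //.
  - split=> [|_ _ [w ->] [w' ->]|e _ [w ->]].
    + by exists 0; rewrite mulr0 raddf0.
    + by exists (w + w'); rewrite mulrDr raddfD.
    + by exists (ks_cst A e * w); rewrite mulrCA [RHS]rmorphM.
  - by move=> i; exists (y i).
  have := congr1 (to_ffL F A) (hf t); rewrite hy mulr_sumr !rmorph_sum /=.
  under eq_bigr do rewrite ct_pureM mul1r to_ffL_pure.
  by under [in RHS]eq_bigr do rewrite to_ffL_pure.
have /choice [w0 hw0] := fun t : K => hw t.1 t.2.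
pose y := \row_(t < #|K|) iQ (w0 (enum_val t)).
pose q := \row_i (iQ (al i) / iQ s).
have hy : y = q *m W.
  apply/rowP => t; rewrite !mxE; apply: (mulfI (iQ_neq0 s0)).
  rewrite -rmorphM -hw0 rmorph_sum mulr_sumr; apply: eq_bigr => i _.
  by rewrite !mxE rmorphM mulrA mulrCA divff ?mulr1 // iQ_neq0.
pose be i := \sum_t w0 (enum_val t) * p t i.
have hbe i : iQ (be i) = iQ b * (y *m pinvmx W) 0 i.
  rewrite mxE rmorph_sum mulr_sumr; apply: eq_bigr => t _.
  by rewrite mxE rmorphM -hp mulrCA.
have hbeW (t : K) : \sum_i be i * co i t.1 t.2 = b * w0 t.
  apply: (proj1 hQ); rewrite rmorph_sum rmorphM.
  have : (y *m pinvmx W *m W) 0 (enum_rank t) = y 0 (enum_rank t).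
    by rewrite mulmxKpV // hy submxMl.
  rewrite !mxE enum_rankK => <-; rewrite mulr_sumr; apply: eq_bigr => i _.
  by rewrite rmorphM hbe mxE [W _ _]mxE enum_rankK mulrA.
exists be; apply/eqP; rewrite -subr_eq0; apply/eqP.
pose df : mEnd M := scal b * f - \sum_i scal (be i) * h i; rewrite -/df.
suff df0 u : df (m u) = 0.
  apply: hom_ext => x; have [e ->] := hm x.
  rewrite (raddf_sum df) big1 // => u _.
  by have := mhomZ df (e u) (m u); rewrite df0 scaler0.
apply: (motive_torsion s0).
have -> : df (m u) = toAL b *: f (m u) - \sum_i toAL (be i) *: h i (m u).
  rewrite -[LHS]/((scal b * f : mEnd M) (m u) - (\sum_i scal (be i) * h i : mEnd M) (m u)).
  by rewrite End_sumE.
apply: hg1 => i; rewrite hg3.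
have gamB x1 x2 : gam (x1 - x2) i = gam x1 i - gam x2 i.
  by rewrite hg2 -scaleN1r hg3 mulN1r.
rewrite gamB hg3 gam_sum mulrBr mulrCA (hf (u, i)).
apply/eqP; rewrite subr_eq0; apply/eqP.
transitivity (\sum_v ct_pure (ks_cst A) j (b * (s * w0 ((u, i), v))) (l v)).
  rewrite mulr_sumr; apply: eq_bigr => v _.
  by rewrite ct_pureM mul1r -hw0.
under [in RHS]eq_bigr do rewrite hg3 (hco _ (u, i)) mulr_sumr.
rewrite exchange_big mulr_sumr; apply: eq_bigr => v _ /=.
transitivity (toAL s * ct_pure (ks_cst A) j (\sum_i0 be i0 * co i0 (u, i) v) (l v)).
  by rewrite (hbeW ((u, i), v)) ct_pureM mul1r; congr ct_pure; ring.
congr (_ * _); rewrite ct_pure_suml.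
by apply: eq_bigr => i' _; rewrite ct_pureM mul1r.
Qed.

Definition esc (a : ringOf A) : E := epure (scal a) 1.

Lemma escD a b : esc (a + b) = esc a + esc b.
Proof. by rewrite /esc rmorphD epureD. Qed.

Lemma escM a b : esc (a * b) = esc a * esc b.
Proof. by rewrite /esc epureM rmorphM mulr1. Qed.

Lemma esc1 : esc 1 = 1.
Proof. by rewrite /esc rmorph1. Qed.

Lemma esc0 : esc 0 = 0.
Proof. by apply: (addrI (esc 0)); rewrite -escD !addr0. Qed.

Lemma esc_epure a h q : esc a * epure h q = epure (scal a * h) q.
Proof. by rewrite epureM mul1r. Qed.

Lemma esc_cancel a x y : a != 0 -> esc a * x = esc a * y -> x = y.
Proof.
move=> a0 h; suff e : epure 1 (iQ a)^-1 * esc a = 1.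
  by rewrite -[x]mul1r -[y]mul1r -e -!mulrA h.
by rewrite epureM mul1r -[scal a]mulr1 epureS !mulr1 mulfV ?iQ_neq0.
Qed.

(* H lies between the span R of the b_i and a^-1 R, and a^-1 R / R is finite since
   A / aA is, k being finite. *)
Lemma bounded_module_fg n (b : 'I_n -> E) (H : E -> Prop) (a : ringOf A) :
  a != 0 -> (forall x y, H x -> H y -> H (x + y)) ->
  (forall al x, H x -> H (esc al * x)) -> H 0 -> (forall i, H (b i)) ->
  (forall x, H x -> exists al : 'I_n -> ringOf A, esc a * x = \sum_i esc (al i) * b i) ->
  exists m (g : 'I_m -> E), forall x, H x <->
    exists al : 'I_m -> ringOf A, x = \sum_i esc (al i) * g i.
Proof.
move=> a0 HD HZ H0 Hb Ha.
have H_sum (I : finType) (y : I -> E) : (forall i, H (y i)) -> H (\sum_i y i).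
  by move=> hy; apply: big_ind.
have [D hD] := @ksubring_finite_quotients _ _ A a a0.
have [|d [e [_ _ he]]] := max_rel_free (lam := ks_cst A) (multiples_submodule a)
    (J := fun=> True) (D := D).
  by move=> d e _; apply: hD.
(* Every class of [A / aA] is a [k]-combination of the [e s], so the finitely many matrices over [k]
   represent all classes of [a^-1 R / R]. *)
pose num (X : 'M[k]_(n, d)) := \sum_i esc (\sum_s ks_cst A (X i s) * e s) * b i.
pose rho X : E := epure 1 (iQ a)^-1 * num X.
have rhoE X : esc a * rho X = num X.
  rewrite mulrA esc_epure -[epure _ _]mulr1 mulr1 epureS mulfV ?iQ_neq0 //.
  exact: mul1r.
(* Representatives outside [H] are replaced by [0], so that all generators lie in [H]. *)
pose g X := if pselect (H (rho X)) is left _ then rho X else 0.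
have Hg X : H (g X) by rewrite /g; case: pselect.
pose g' (i : 'I_(n + #|{: 'M[k]_(n, d)}|)) : E :=
  match split i with inl i' => b i' | inr s => g (enum_val s) end.
exists _, g' => x; split; last first.
  move=> [al ->]; apply: H_sum => i; apply: HZ; rewrite /g'.
  by case: (split i).
move=> Hx; have [al hal] := Ha x Hx.
have /choice [cw hcw] : forall i, exists cw : ('I_d -> k) * ringOf A,
    al i = \sum_s ks_cst A (cw.1 s) * e s + a * cw.2.
  move=> i; have [co [w hw]] := he (al i) Logic.I; exists (co, w) => /=.
  by rewrite -hw addrC subrK.
pose X := \matrix_(i, s) (cw i).1 s.
pose y := \sum_i esc (cw i).2 * b i.
have hxy : x = y + rho X.
  apply: (esc_cancel a0); rewrite hal mulrDr rhoE addrC mulr_sumr -big_split.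
  apply: eq_bigr => i _; rewrite {1}hcw escD mulrDl /= mulrA -escM; congr (_ + _).
  by congr (esc _ * _); apply: eq_bigr => s _; rewrite mxE.
have HX : H (rho X).
  have -> : rho X = x + esc (- 1) * y.
    rewrite hxy addrAC -[X in X + _ + _]mul1r -esc1 -mulrDl -escD subrr esc0 mul0r.
    by rewrite add0r.
  by apply: HD => //; apply: (HZ); apply: H_sum => i; apply: (HZ).
exists (fun i => match split i with inl i' => (cw i').2
  | inr s => if enum_val s == X then 1 else 0 end).
rewrite big_split_ord /= hxy; congr (_ + _).
  by apply: eq_bigr => i _; rewrite /g' (unsplitK (inl i)).
rewrite (bigD1 (enum_rank X)) //= /g' (unsplitK (inr _)) enum_rankK eqxx esc1 mul1r.
rewrite big1 ?addr0; last first.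
  move=> s hs; rewrite (unsplitK (inr _)); case: eqVneq => [h|_]; last by rewrite esc0 mul0r.
  by case/eqP: hs; rewrite -h enum_valK.
by rewrite /g; case: pselect.
Qed.

End EndomorphismAlgebra.

(** * The order defined by an isogenous motive *)

Section MaximalOrder.
Variables (k : finFieldType) (C : curve k) (inf : rational_point C).
Variables (L : fieldType) (j : {rmorphism k -> L}) (c : characteristic inf j).
Variable F : function_fieldL j C.
Local Notation A := (affine_ring inf).
Local Notation toAL a := (ct_inl (ks_cst A) j a).
Local Notation sigmaA := (sigma : ctensor (ks_cst A) j -> ctensor (ks_cst A) j).
Variables (Q : fieldType) (iQ : {rmorphism ringOf A -> Q}).
Hypothesis hQ : is_fraction_field iQ.
Variables (M M' : motive c F) (f : mhom M' M) (g : mhom M M') (a : ringOf A).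
Hypothesis f_inj : injective f.
Hypothesis fgK : isogeny_inverse f g a.
Local Notation E := (EndQ M iQ).
Local Notation scal := (End_scalar M).
Local Notation epure := (EndQ_pure iQ).

(** [M] has no torsion and [f] is injective, so [z'] is determined by [z]; this uniqueness makes
    [z |-> z'] linear and compatible with tau. *)
Lemma conj_End_of_stable (h : mEnd M) (s : ringOf A) : s != 0 ->
  (forall z, exists z', h (f z) = toAL s *: f z') ->
  conj_End f g a (epure h (iQ s)^-1).
Proof.
have [a0 fg gf] := fgK; move=> s0 /choice [h' hh'].
have sinj x y : toAL s *: x = toAL s *: y -> x = y :> M.
  move=> e; apply/eqP; rewrite -subr_eq0; apply/eqP/(motive_torsion s0).
  by rewrite scalerBr e subrr.
have h'_lin : linear h'.
  by move=> t x y; apply/f_inj/sinj; rewrite -hh' !linearP /= !hh'.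
pose h'l : {linear M' -> M'} := HB.pack h' (GRing.isLinear.Build _ _ _ _ _ h'_lin).
have sE (x : M) : toAL s *: x = scal s x by [].
have h'_tau x : h' (mot_tau M' x) = mot_tau M' (bc_map sigmaA h' x).
  apply/f_inj/sinj; rewrite -hh' !hom_tau sE hom_tau; congr (mot_tau M _).
  rewrite -(bc_map_comp h f) -(bc_map_comp f h'l) -(bc_map_comp (scal s) (f \o h'l)).
  by congr bc_map; apply: funext => z; apply: hh'.
exists (@Defs.Hom _ _ _ _ _ _ _ M' M' h' h'_lin h'_tau).
rewrite -(epure_cancel hQ h _ a0) -[RHS](epure_cancel hQ _ _ s0) mulrC; congr EndQ_pure.
apply: hom_ext => x /=; rewrite -hh'.
have := congr1 (fun u : mEnd M => u x) fg => /= ->.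
by rewrite mhomZ.
Qed.

Lemma conj_End_bound (x : E) : conj_End f g a x -> exists h : mEnd M, esc iQ M a * x = epure h 1.
Proof.
have [a0 _ _] := fgK; move=> [h ->]; exists (hom_comp f (hom_comp h g)).
by rewrite esc_epure epureS mulfV // (iQ_neq0 hQ).
Qed.

Lemma conj_EndD (x y : E) :
  conj_End f g a x -> conj_End f g a y -> conj_End f g a (x + y).
Proof.
move=> [h ->] [h' ->]; exists (h + h'); rewrite -epureD; congr EndQ_pure.
by apply: hom_ext => z /=; rewrite raddfD.
Qed.

Lemma conj_End0 : conj_End f g a (0 : E).
Proof.
exists 0; have [a0 _ _] := fgK; apply: (addrI (epure 0 (iQ a)^-1)).
rewrite -[X in _ = _ + X]/(epure _ _) -epureD addr0 add0r; congr EndQ_pure.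
by apply: hom_ext => z /=; rewrite raddf0.
Qed.

Lemma conj_EndZ al (x : E) : conj_End f g a x -> conj_End f g a (esc iQ M al * x).
Proof.
move=> [h ->]; exists (End_scalar M' al * h); rewrite esc_epure; congr EndQ_pure.
by apply: hom_ext => z /=; rewrite mhomZ.
Qed.

Lemma conj_End1 : conj_End f g a (1 : E).
Proof.
have [a0 fg _] := fgK; exists 1.
have -> : hom_comp f (hom_comp (1 : mEnd M') g) = scal a * 1 by rewrite mulr1 -fg; apply: hom_ext.
by rewrite epureS mulfV // (iQ_neq0 hQ).
Qed.

Lemma conj_EndM (x y : E) :
  conj_End f g a x -> conj_End f g a y -> conj_End f g a (x * y).
Proof.
have [a0 _ gf] := fgK; move=> [h ->] [h' ->]; exists (h * h'); rewrite epureM.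
rewrite -[RHS](epure_cancel hQ _ _ a0); congr EndQ_pure.
apply: hom_ext => z /=.
have := congr1 (fun u : mEnd M' => u (h' (g z))) gf => /= ->.
by rewrite !mhomZ.
Qed.

Lemma conj_End_order (R : E -> Prop) : is_order R -> (forall x, R x -> conj_End f g a x) ->
  is_order (@conj_End _ _ _ _ _ _ _ _ _ f g a Q iQ).
Proof.
move=> [R1 RM [n [b hb]] Rspan] RH; have [a0 _ _] := fgK.
split; first exact: conj_End1.
- exact: conj_EndM.
- have Rb i : R (b i).
    apply/hb; exists (fun i' => if i' == i then 1 else 0).
    rewrite (bigD1 i) //= eqxx big1 => [|i' /negPf ->].
      by rewrite addr0 -/(esc iQ M 1) esc1 mul1r.
    by rewrite -/(esc iQ M 0) esc0 mul0r.
  have [s [h [s0 hs]]] := epure_common_denominator hQ b.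
  have [|d d0 hd] := @End_bounded _ _ _ _ _ _ F Q iQ hQ M n h.
    move=> v; have [m [u [b' [hb' hv]]]] := Rspan (epure v 1).
    have /choice [al hal] := fun i => proj1 (hb _) (hb' i).
    have /choice [num hnum] := fun i => proj2 hQ (u i).
    have /choice [den hden] := hnum.
    pose D := \prod_i den i.
    have iD0 : iQ D != 0.
      rewrite rmorph_prod; apply/prodf_neq0 => i _; apply: (iQ_neq0 hQ).
      by case: (hden i).
    have D0 : D != 0 by apply: contraNneq iD0 => ->; rewrite rmorph0.
    (* [D] clears the denominators of the [u i], and [s] that of the generators [b l = h l / s]. *)
    exists (s * D), (fun l => \sum_i (\prod_(i' | i' != i) den i') * num i * al i l).
    split; first exact: (affine_mul_neq0 hQ).
    have iDE i : iQ D * u i = iQ ((\prod_(i' | i' != i) den i') * num i).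
      have [di0 ->] := hden i; rewrite /D (bigD1 i) //= !rmorphM; field.
      exact: (iQ_neq0 hQ).
    apply: (epure_inj hQ (q := (iQ s)^-1)); first by rewrite invr_neq0 // (iQ_neq0 hQ).
    rewrite epureS rmorphM mulrAC mulfV ?mul1r ?(iQ_neq0 hQ) //.
    rewrite -[iQ D]mulr1 -epureS -esc_epure hv epure_sum mulr_sumr.
    transitivity (\sum_i \sum_l esc iQ M ((\prod_(i' | i' != i) den i') * num i * al i l) * b l).
      apply: eq_bigr => i _; rewrite hal !mulr_sumr; apply: eq_bigr => l _.
      rewrite -/(esc iQ M (al i l)) [esc iQ M (_ * al i l)]escM !mulrA.
      congr (_ * _ * _).
      by rewrite esc_epure epureS iDE /esc -[scal (_ * _)]mulr1 epureS mulr1.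
    rewrite exchange_big; apply: eq_bigr => l _ /=.
    rewrite -mulr_suml hs.
    have -> : \sum_i esc iQ M ((\prod_(i' | i' != i) den i') * num i * al i l) =
      esc iQ M (\sum_i (\prod_(i' | i' != i) den i') * num i * al i l).
      by rewrite (big_morph (esc iQ M) (@escD _ _ _ _ _ _ _ _ _ _) (@esc0 _ _ _ _ _ _ _ _ _ _)).
    by rewrite esc_epure.
  (* [a] carries [conj_End] into [End(M)], and [d] carries [End(M)] into the span of the
     [h i = s b i]. *)
  apply: (bounded_module_fg hQ (b := b) (a := d * a)) => //.
  + exact: (affine_mul_neq0 hQ).
  + exact: conj_EndD.
  + exact: conj_EndZ.
  + exact: conj_End0.
  + by move=> i; apply: RH.
  + move=> x /conj_End_bound [v hv]; have [be hbe] := hd v.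
    exists (fun i => be i * s); rewrite escM -mulrA hv esc_epure hbe epure_sum.
    apply: eq_bigr => i _; rewrite hs escM -mulrA.
    by rewrite [esc iQ M s * _]esc_epure [X in _ = _ * X]epureS mulfV ?(iQ_neq0 hQ) // esc_epure.
- move=> x; have [n' [u [b' [hb' hx]]]] := Rspan x.
  by exists n', u, b'; split=> // i; apply: RH.
Qed.

End MaximalOrder.

Theorem theorem10p7 (k : finFieldType) (C : curve k) (inf : rational_point C)
    (L : fieldType) (j : {rmorphism k -> L}) (c : characteristic inf j)
    (F : function_fieldL j C)
    (Q : fieldType) (iQ : {rmorphism ringOf (affine_ring inf) -> Q})
    (hQ : is_fraction_field iQ)
    (M : motive c F) (R : EndQ M iQ -> Prop) (hR : is_maximal_order R) :
  exists (M' : motive c F) (f : mhom M' M),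
    isogeny f /\
    exists (g : mhom M M') (a : ringOf (affine_ring inf)),
      isogeny_inverse f g a /\
      forall x : EndQ M iQ, R x <-> conj_End f g a x.
Proof.
have [ordR maxR] := hR; have [R1 RM [n [b hb]] _] := ordR.
have [a [h [a0 ha]]] := epure_common_denominator hQ b.
have epure_comb (s : ringOf (affine_ring inf)) (al : 'I_n -> ringOf (affine_ring inf)) : s != 0 ->
    \sum_i EndQ_pure iQ (End_scalar M (al i)) 1 * b i =
    EndQ_pure iQ (End_scalar M s * \sum_i End_scalar M (al i) * h i) ((iQ s)^-1 * (iQ a)^-1).
  move=> s0; rewrite (epure_cancel hQ) // epure_sum; apply: eq_bigr => i _.
  by rewrite ha epureM mul1r.
(* As [1] in [R] is an [A]-combination of the [h i / a], multiplication by [a] is an [A]-combination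
   of the [h i]. *)
have a_image x : ct_inl _ j a *: x \in image_pred h.
  have [al hal] := proj1 (hb 1) R1.
  have e : End_scalar M a = \sum_i End_scalar M (al i) * h i.
    apply: (epure_inj hQ (q := (iQ a)^-1)); first by rewrite invr_neq0 // (iQ_neq0 hQ).
    rewrite -[End_scalar M a]mulr1 epureS mulfV ?(iQ_neq0 hQ) // epure_sum.
    rewrite -[LHS]/(1 : EndQ M iQ) hal; apply: eq_bigr => i _.
    by rewrite ha epureM mul1r.
  apply/image_predP; exists (fun i => ct_inl _ j (al i) *: x).
  rewrite -[LHS]/(End_scalar M a x) e End_sumE; apply: eq_bigr => i _.
  by rewrite mhomZ.
have [M' [f [g [f_inj f_im gf fg]]]] := image_motive a0 a_image.
have fgK : isogeny_inverse f g a by split=> //; apply: hom_ext.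
have RH x : R x -> conj_End f g a x.
  have [v [s [s0 ->]]] := epure_frac hQ x => Rx.
  apply: (conj_End_of_stable hQ f_inj fgK s0) => z.
  have /image_predP [y ->] : f z \in image_pred h by apply/f_im; exists z.
  have Rb i : R (b i).
    apply/hb; exists (fun i' => if i' == i then 1 else 0).
    rewrite (bigD1 i) //= eqxx big1 => [|i' /negPf ->].
      by rewrite addr0 -/(esc iQ M 1) esc1 mul1r.
    by rewrite -/(esc iQ M 0) esc0 mul0r.
  have /choice [al hal] := fun i => proj1 (hb _) (RM _ _ Rx (Rb i)).
  (* This is [x * b i] in [R] with denominators cleared, for [x = v / s] and [b i = h i / a]; it
     shows that [v] maps [M'] into [s M']. *)
  have e i : v * h i = End_scalar M s * \sum_l End_scalar M (al i l) * h l.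
    apply: (epure_inj hQ (q := (iQ s)^-1 * (iQ a)^-1)).
      by rewrite mulf_neq0 // invr_neq0 // (iQ_neq0 hQ).
    by rewrite -epureM -ha hal (epure_comb _ _ s0).
  have : \sum_l h l (\sum_i ct_inl _ j (al i l) *: y i) \in image_pred h.
    by apply/image_predP; exists (fun l => \sum_i ct_inl _ j (al i l) *: y i).
  move=> /f_im [z' hz']; exists z'; rewrite hz' raddf_sum scaler_sumr /=.
  under [RHS]eq_bigr do rewrite raddf_sum scaler_sumr.
  rewrite exchange_big; apply: eq_bigr => i _ /=.
  rewrite -[LHS]/((v * h i : mEnd M) (y i)) e End_scalar_mulE End_sumE scaler_sumr.
  by apply: eq_bigr => l _; rewrite mhomZ.
exists M', f; split.
  split=> // m; exists (ct_inl _ j a); first exact: (ct_inl_neq0 F a0).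
  by exists (g m).
exists g, a; split=> // x; split; first exact: RH.
move: x; apply: (maxR _ (conj_End_order hQ fgK ordR RH) RH).
Qed.
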